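(* Let $d\geqslant 1$, let $p(\cdot)$ be a jump distribution on $\mathbb{Z}^d$ and let $\lambda\in(0,\infty)$ be a sleep rate. Then there is a number $\zeta_c$ (depending only on $d$, $p(\cdot)$ and $\lambda$) such that, for every translation-ergodic distribution $\nu$ supported on $(\mathbb{N}_0)^{\mathbb{Z}^d}$ with average density $\zeta=\int \eta(\boldsymbol{0})\,\nu(\mathrm{d}\eta)<\infty$, the Activated Random Walk dynamics with initial distribution $\nu$ satisfies $$\mathbf{P}^{\nu}(\text{system stays active})=\begin{cases}0,&\zeta<\zeta_c,\\ 1,&\zeta>\zeta_c.\end{cases}$$
   Context: Activated Random Walk (ARW) on $\mathbb{Z}^d$. Fix $d\geqslant1$, a sleep rate $0<\lambda<\infty$ and a jump distribution $p(\cdot)$, i.e. a probability distribution on $\mathbb{Z}^d$ supported on the nearest neighbors $\{\pm e_1,\dots,\pm e_d\}$ of the origin $\boldsymbol{0}$ and whose support generates the group $\mathbb{Z}^d$. Let $\mathbb{N}_0=\{0,1,2,\dots\}$ and $\mathbb{N}_{\mathfrak{s}}=\mathbb{N}_0\cup\{\mathfrak{s}\}$, ordered by $0<\mathfrak{s}<1<2<\cdots$, with $|\mathfrak{s}|=1$, $|n|=n$, $\mathfrak{s}+1=2$, $1\cdot\mathfrak{s}=\mathfrak{s}$ and $n\cdot\mathfrak{s}=n$ for $n\geqslant2$. A configuration is $\eta\in(\mathbb{N}_{\mathfrak{s}})^{\mathbb{Z}^d}$: site $x$ contains $\eta(x)$ active particles if $\eta(x)\in\mathbb{N}_0$ and one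 sleeping particle if $\eta(x)=\mathfrak{s}$. Evolution: at each site $x$ a clock rings at rate $(1+\lambda)\,\eta_t(x)\,\mathbf{1}_{\{\eta_t(x)\neq\mathfrak{s}\}}$. When it rings, with probability $\frac{\lambda}{1+\lambda}$ the value $\eta(x)$ is replaced by $\eta(x)\cdot\mathfrak{s}$; otherwise, with probability $\frac{p(y-x)}{1+\lambda}$ for each $y$, $\eta(x)$ is replaced by $\eta(x)-1$ and $\eta(y)$ by $\eta(y)+1$. For a translation-ergodic distribution $\nu$ on $(\mathbb{N}_{\mathfrak{s}})^{\mathbb{Z}^d}$ with $\int|\eta(\boldsymbol{0})|\nu(\mathrm{d}\eta)<\infty$ there is a process $(\eta_t)_{t\geqslant0}$ with these rates and $\eta_0\sim\nu$; its law $\mathbf{P}^{\nu}$ is characterized by $\mathbf{P}^{\nu}(\mathcal{A})=\lim_{V\uparrow\mathbb{Z}^d}\mathbf{P}^{\nu}_V(\mathcal{A})$ for every event $\mathcal{A}$ determined by $(\eta_s(x))_{x\in B,\,s\in[0,t]}$ with $B$ finite and $t<\infty$, where $\mathbf{P}^{\nu}_V$ is the law of the (finite) system started from $\eta_0\cdot\mathbf{1}_V$, $V$ finite. The system stays active if, for each site, there are arbitrarily large times at which the site has at least one active particle. It fixates if, for each site, there is a (random) time after which the site is always either vacant or occupied by exactly one sleeping particle. *)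

(* Defs.v *)
From HB Require Import structures.
From mathcomp Require Import all_boot all_order all_algebra finmap.
From mathcomp Require Import all_classical all_reals all_analysis.
From mathcomp Require Import measurable_realfun.

Set Implicit Arguments.
Unset Strict Implicit.
Unset Printing Implicit Defensive.

Import Order.TTheory GRing.Theory Num.Theory.
Import numFieldNormedType.Exports.

Local Open Scope classical_set_scope.
Local Open Scope ring_scope.

Notation Zd d := 'rV[int]_d.

Inductive occupation := Active of nat | Sleeping.

HB.instance Definition _ := gen_eqMixin occupation.
HB.instance Definition _ := gen_choiceMixin occupation.
HB.instance Definition _ := isPointed.Build occupation (Active 0).

Definition mass (k : occupation) : nat :=
  if k is Active n then n else 1.

Definition active (k : occupation) : nat :=
  if k is Active n then n else 0.

Definition fall_asleep (k : occupation) : occupation :=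
  if k is Active 1 then Sleeping else k.

(* An arriving particle wakes up a sleeping one: s + 1 = 2. *)
Definition gain (k : occupation) : occupation :=
  if k is Active n then Active n.+1 else Active 2.

(* Only ever applied where a clock rings, i.e. to Active n with 0 < n. *)
Definition lose (k : occupation) : occupation :=
  if k is Active n then Active n.-1 else Sleeping.

(* The product of the discrete sigma-algebras. *)
Definition cfg_gen (d : nat) : set (set (Zd d -> occupation)) :=
  [set E | exists x k, E = [set eta | eta x = k]].

Notation cfg d := (g_sigma_algebraType (@cfg_gen d)).

Definition sleep_at d (x : Zd d) (eta : cfg d) : cfg d :=
  fun z => if z == x then fall_asleep (eta z) else eta z.

(* Used with y != x only, since jump distributions do not charge 0. *)
Definition jump d (x y : Zd d) (eta : cfg d) : cfg d :=
  fun z => if z == x then lose (eta z)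
           else if z == y then gain (eta z) else eta z.

Definition restrict d (V : {fset Zd d}) (eta : cfg d) : cfg d :=
  fun z => if z \in V then eta z else Active 0.

Definition translate d (x : Zd d) (eta : cfg d) : cfg d :=
  fun z => eta (z + x).

Record jump_distribution (R : realType) d (p : Zd d -> R) : Prop := {
  jump_ge0 : forall z, 0 <= p z;
  jump_sum1 : \sum_(z \in [set: Zd d]) p z = 1;
  jump_nn : forall z, p z != 0 ->
    exists i : 'I_d, z = delta_mx 0 i \/ z = - delta_mx 0 i;
  jump_generates : forall H : {pred Zd d}, zmod_closed H ->
    (forall z, p z != 0 -> z \in H) -> forall z, z \in H }.

Definition translation_invariant (R : realType) d
    (nu : probability (cfg d) R) :=
  forall (x : Zd d) (A : set (cfg d)), measurable A ->
    nu (translate x @^-1` A) = nu A.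

Definition translation_ergodic (R : realType) d
    (nu : probability (cfg d) R) :=
  translation_invariant nu /\
  forall A : set (cfg d), measurable A ->
    (forall x : Zd d, translate x @^-1` A = A) ->
    nu A = 0%E \/ nu A = 1%E.

Definition density (R : realType) d (nu : probability (cfg d) R) : \bar R :=
  (\int[nu]_eta (mass (eta 0%R))%:R%:E)%E.

(* At every site, right-continuous with left limits for the discrete topology,
   i.e. piecewise constant with finitely many jumps in bounded time.  Values at
   negative times are irrelevant: the sigma-algebra below does not see them. *)
Definition cadlag (R : realType) d (w : R -> cfg d) :=
  forall x : Zd d,
    (forall t, 0 <= t -> \forall s \near t^'+, w s x = w t x) /\
    (forall t, 0 < t -> exists k, \forall s \near t^'-, w s x = k).

Record trajectory (R : realType) d := Trajectory {
  state :> R -> cfg d;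
  state_cadlag : cadlag state }.

Lemma cadlag_empty (R : realType) d :
  cadlag (fun (_ : R) (_ : Zd d) => Active 0).
Proof.
move=> x; split=> [t _|t _]; first exact: nearW.
by exists (Active 0); exact: nearW.
Qed.

HB.instance Definition _ (R : realType) d := gen_eqMixin (trajectory R d).
HB.instance Definition _ (R : realType) d := gen_choiceMixin (trajectory R d).
HB.instance Definition _ (R : realType) d :=
  isPointed.Build (trajectory R d) (Trajectory (@cadlag_empty R d)).

Definition window_gen (R : realType) d (B : set (Zd d)) (I : set R) :
    set (set (trajectory R d)) :=
  [set E | exists x s k, [/\ B x, I s & E = [set w : trajectory R d | w s x = k]]].

Definition path_gen (R : realType) d :=
  @window_gen R d setT [set s | 0 <= s].

Notation path_space R d := (g_sigma_algebraType (@path_gen R d)).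

(* The events determined by (eta_s(x)) for x in B and s in [0, t]. *)
Definition window_event (R : realType) d (B : {fset Zd d}) (t : R)
    (A : set (path_space R d)) :=
  <<s @window_gen R d [set` B] `[0, t] >> A.

Definition ring_rate (R : realType) (lam : R) (k : occupation) : R :=
  (1 + lam) * (active k)%:R.

(* Here and in ring_prob the sums over Z^d have finite support when eta has
   finitely many particles. *)
Definition total_rate (R : realType) d (lam : R) (eta : cfg d) : R :=
  \sum_(x \in [set: Zd d]) ring_rate lam (eta x).

(* Probability that the next ring turns eta into eta' (possibly eta' = eta:
   a sleep instruction has no effect on two or more particles).  If no clock
   can ring, the system stays at eta. *)
Definition ring_prob (R : realType) d (p : Zd d -> R) (lam : R)
    (eta eta' : cfg d) : R :=
  if total_rate lam eta == 0 then `[< eta' = eta >]%:R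
  else \sum_(x \in [set: Zd d])
    ring_rate lam (eta x) / total_rate lam eta *
    (lam / (1 + lam) * `[< eta' = sleep_at x eta >]%:R +
     \sum_(y \in [set: Zd d])
       p (y - x) / (1 + lam) * `[< eta' = jump x y eta >]%:R).

(* Q is the law of the continuous-time Markov chain with initial law mu (a law
   on configurations with finitely many particles) and the above rates: given
   the past, the chain waits at Y n for an exponential time tau n of parameter
   total_rate (infinite if that rate is 0), then moves according to
   ring_prob. *)
Definition finite_ARW_law (R : realType) d (p : Zd d -> R) (lam : R)
    (mu : set (cfg d) -> \bar R) (Q : probability (path_space R d) R) :=
  exists (dO : measure_display) (Omega : measurableType dO)
    (Pr : probability Omega R)
    (Y : nat -> Omega -> cfg d) (tau : nat -> Omega -> \bar R)
    (X : Omega -> path_space R d),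
  [/\ forall n, measurable_fun setT (Y n),
      forall n, measurable_fun setT (tau n),
      forall n (xi : nat -> cfg d) (t : nat -> R), (forall i, 0 <= t i) ->
        Pr [set o | (forall i, (i <= n)%N -> Y i o = xi i) /\
                    (forall i, (i < n)%N -> ((t i)%:E < tau i o)%E)] =
        (mu [set xi 0%N] *
         (\prod_(i < n) (expR (- (total_rate lam (xi i) * t i)) *
                         ring_prob p lam (xi i) (xi i.+1)))%:E)%E,
      measurable_fun setT X /\
      {ae Pr, forall o, forall n (t : R), 0 <= t ->
        (\sum_(i < n) tau i o <= t%:E < \sum_(i < n.+1) tau i o)%E ->
        X o t = Y n o} &
      forall A, measurable A -> Q A = Pr (X @^-1` A)].

(* The limit V -> Z^d is along the finite sets directed by inclusion. *)
Definition exhaustion d : set_system {fset Zd d} :=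
  filter_from setT (fun V0 => [set V | (V0 `<=` V)%fset]).

(* P is P^nu, PV V being the law of the system started from eta_0 * 1_V.  The
   window events form an algebra generating the sigma-algebra, so that P is
   unique. *)
Definition ARW_law (R : realType) d (p : Zd d -> R) (lam : R)
    (nu : probability (cfg d) R) (P : probability (path_space R d) R) :=
  exists PV : {fset Zd d} -> probability (path_space R d) R,
    (forall V, finite_ARW_law p lam (pushforward nu (restrict V)) (PV V)) /\
    forall B t A, 0 <= t -> window_event B t A ->
      PV V A @[V --> @exhaustion d] --> P A.

Definition stays_active (R : realType) d : set (path_space R d) :=
  [set w | forall (x : Zd d) (T : R),
    exists t, [/\ 0 <= t, T <= t & (0 < active (w t x))%N]].

(* Main.v *)
(* Attach to every site an i.i.d. stack of instructions and topple all unstable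
   sites in parallel.  The odometer is monotone in the initial configuration, so
   explosion of the odometer at the origin is a property of (configuration,
   stacks) whose conditional probability given the configuration is, by
   ergodicity, almost surely 0 or almost surely 1.  Non-explosion passes from a
   law [nu] to any ergodic law [mu] of smaller density: the particles of [mu] are
   first moved, by toppling, into a configuration dominated by an independent
   sample of [nu], which is then stabilized.  As two particles per site explode
   with positive probability, [zeta_c] is the supremum of the densities of the
   non-exploding ergodic laws.

   In a finite volume the jump chain of the continuous-time process is an annealed
   reading of the stacks, so the number of departures from a site before time t is
   at most its odometer, and it exceeds k by time t with high probability when the
   odometer of a smaller volume already produces k departures: until then some
   site still owes a toppling, and such sites are served at rate at least
   [1 + lam].  Departures are visible as drops of the rank
   0 < 1 < s < 2 < 3 ... of the state of a site along rational times, which turns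
   these bounds into bounds on window events, stable under V -> Z^d. *)

From HB Require Import structures.
Require Import Defs.
From mathcomp Require Import all_boot all_order all_algebra finmap.
From mathcomp Require Import all_classical all_reals all_analysis.
From mathcomp Require Import measurable_realfun.
From mathcomp Require Import zify ring lra.

Set Implicit Arguments.
Unset Strict Implicit.
Unset Printing Implicit Defensive.

Import Order.TTheory GRing.Theory Num.Theory.
Import numFieldNormedType.Exports.

Local Open Scope classical_set_scope.
Local Open Scope ring_scope.

(** * Independent instructions *)

(** The product of the ergodic laws [mu] and [nu] need not be ergodic, so the event that filling
    explodes could have any probability. Mass conservation is applied on this event itself: its
    conditional probability given one of the two configurations is an invariant function of it,
    hence almost surely constant, so the event is uncorrelated with either density at the origin.
    Filling is not legal for the activated dynamics; this is harmless because the odometer of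
    parallel toppling lies below every odometer that leaves all sites stable, legal or not. For the
    instructions left by filling to be fresh, filling must read one instruction at a time without
    looking ahead, whence a sequential greedy order next to the parallel one. The zero-one law comes
    from [c <= c ^+ 2]: explosion spreads to far sites, and its finite-time versions at distant
    sites are independent given the configuration. In finite volume the total rate grows with the
    volume; the estimates stay uniform because mean holding times, the inverses of the total rate,
    compensate the small chance that a given site is served. *)

Lemma measurable_bigcup_count d (X : measurableType d) (I : countType)
    (D : set I) (F : I -> set X) :
  (forall i, D i -> measurable (F i)) -> measurable (\bigcup_(i in D) F i).
Proof.
move=> mF; rewrite bigcup_mkcond; apply: countable_bigcupT_measurable.
  exact: countableP.
by move=> i; case: ifPn => // /set_mem; exact: mF.
Qed.

Lemma measurable_bigcap_count d (X : measurableType d) (I : countType)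
    (D : set I) (F : I -> set X) :
  (forall i, D i -> measurable (F i)) -> measurable (\bigcap_(i in D) F i).
Proof.
move=> mF; rewrite -[X in measurable X]setCK setC_bigcap; apply: measurableC.
by apply: measurable_bigcup_count => i Di; apply: measurableC; exact: mF.
Qed.

Section coding.
Context (R : realType) (T : finType) (q : T -> R).
Hypothesis q_ge0 : forall t, 0 <= q t.
Hypothesis q_sum1 : \sum_t q t = 1.
Variable t0 : T.

(** [[0, 1)] is cut into consecutive intervals of lengths [q t], ordered by [enum_rank]; a letter of
    weight zero gets an empty interval. *)
Let left (t : T) : R := \sum_(s | (enum_rank s < enum_rank t)%N) q s.

Let left_ge0 t : 0 <= left t. Proof. exact: sumr_ge0. Qed.

Let right_sum t : left t + q t = \sum_(s | (enum_rank s <= enum_rank t)%N) q s.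
Proof.
rewrite [RHS](bigD1 t)//= addrC; congr (_ + _).
apply: eq_bigl => s; rewrite ltn_neqAle andbC; congr (_ && _).
by rewrite val_eqE (inj_eq enum_rank_inj).
Qed.

Let right_le1 t : left t + q t <= 1.
Proof.
rewrite right_sum -q_sum1 [leRHS](bigID (fun s => (enum_rank s <= enum_rank t)%N))/=.
by rewrite lerDl sumr_ge0.
Qed.

Let left_mono s t : (enum_rank s < enum_rank t)%N -> left s + q s <= left t.
Proof.
move=> st; rewrite right_sum /left.
rewrite [leRHS](bigID (fun u => (enum_rank u <= enum_rank s)%N))/=.
rewrite [X in _ <= X + _](eq_bigl (fun u => (enum_rank u <= enum_rank s)%N)).
  by rewrite lerDl sumr_ge0.
by move=> u /=; case: (leqP (enum_rank u) (enum_rank s)) => us; rewrite ?andbT ?andbF// (leq_ltn_trans us st).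
Qed.

Let inside (u : R) (t : T) : bool := left t <= u < left t + q t.

Definition digit (u : R) : T := odflt t0 [pick t | inside u t].

Let digitP u t : inside u t -> digit u = t.
Proof.
rewrite /digit; case: pickP => [s|/(_ t)/=-> //].
rewrite /inside => /andP[s1 s2] /andP[u1 u2] /=.
case: (ssrnat.ltngtP (enum_rank s) (enum_rank t)) => [/left_mono|/left_mono|].
- by move=> st; exfalso; lra.
- by move=> st; exfalso; lra.
- by move=> e; apply: enum_rank_inj; exact: val_inj.
Qed.

Let inside_digit u : 0 <= u < 1 -> inside u (digit u).
Proof.
move=> /andP[u0 u1]; rewrite /digit.
case: pickP => //= no; exfalso.
(* A point in none of the intervals lies to the right of each of them in turn, hence at [1] or
   beyond. *)
have key n : (n <= #|T|)%N -> \sum_(s | (enum_rank s < n)%N) q s <= u.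
  elim: n => [|n IHn] ns; first by rewrite big_pred0.
  pose t := enum_val (Ordinal ns); have := no t; have := IHn (ltnW ns).
  rewrite (_ : \sum_(s | (enum_rank s < n)%N) q s = left t); last first.
    by apply: eq_bigl => s; rewrite /t enum_valK.
  rewrite (_ : \sum_(s | (enum_rank s < n.+1)%N) q s = left t + q t); last first.
    by rewrite right_sum; apply: eq_bigl => s; rewrite /t enum_valK ltnS.
  by rewrite /inside => -> /= /negbT; rewrite -leNgt.
have := key #|T| (leqnn _); rewrite (eq_bigl predT) ?q_sum1; first by lra.
by move=> s; rewrite ltn_ord.
Qed.

(** Rescales the interval of the first digit to [[0, 1)], as in a base expansion with digits of
    unequal weights. *)
Definition expand (u : R) : R := (u - left (digit u)) / q (digit u).

Definition digits (u : R) (n : nat) : T := digit (iter n expand u).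

(** Prefixing a letter [t] maps the interval of [w] by the contraction of ratio [q t] and offset
    [left t], so a cylinder is an interval whose length is the product of the weights. *)
Lemma digits_cylinder (w : seq T) : exists a : R, 0 <= a /\
  a + \prod_(t <- w) q t <= 1 /\
  [set u | 0 <= u < 1 /\ forall i, (i < size w)%N -> digits u i = nth t0 w i] =
  [set u | a <= u < a + \prod_(t <- w) q t].
Proof.
elim: w => [|t w [a [a0 [a1 IH]]]].
  exists 0; rewrite big_nil add0r; split => //; split => //.
  by apply/seteqP; split => u /=; [case|split].
have pq : 0 <= \prod_(t <- w) q t by exact: prodr_ge0.
exists (left t + q t * a); rewrite big_cons; split.
  by rewrite addr_ge0// mulr_ge0.
split.
  rewrite -addrA -mulrDr; apply: le_trans (right_le1 t).
  by rewrite lerD2l ler_piMr.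
have [qt0|qt_neq0] := eqVneq (q t) 0.
  apply/seteqP; split => u /=; last by rewrite qt0; lra.
  move=> [u01 /(_ 0%N isT)]; rewrite /digits/= => du.
  by have := inside_digit u01; rewrite du /inside qt0; lra.
have qt : 0 < q t by rewrite lt_neqAle eq_sym qt_neq0 q_ge0.
have step u : inside u t -> digits u =
    fun i => if i is j.+1 then digits ((u - left t) / q t) j else t.
  move=> ut; apply/funext => -[|j]; rewrite /digits /=; first exact: digitP.
  by rewrite -iterS iterSr /expand (digitP ut).
have resc u : (0 <= (u - left t) / q t < 1) = inside u t.
  rewrite /inside ler_pdivlMr// mul0r ltr_pdivrMr// mul1r subr_ge0.
  by rewrite ltrBlDl.
apply/seteqP; split => u /=.
- move=> [u01 du]; have ut : inside u t.
    by move: (inside_digit u01); rewrite -[digit u]/(digits u 0%N) (du 0%N).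
  have : [set u | 0 <= u < 1 /\ forall i, (i < size w)%N ->
      digits u i = nth t0 w i] ((u - left t) / q t).
    split; first by rewrite resc.
    by move=> i iw; have := du i.+1 iw; rewrite step.
  rewrite IH/= ler_pdivlMr// ltr_pdivrMr// => /andP[]; lra.
- move=> ut.
  have : [set u | a <= u < a + \prod_(t <- w) q t] ((u - left t) / q t).
    by move: ut => /=; rewrite ler_pdivlMr// ltr_pdivrMr// => /andP[]; lra.
  rewrite -IH/= resc => -[ins H]; split.
    move: ins; rewrite /inside => /andP[i1 i2].
    by rewrite (le_trans (left_ge0 t) i1) (lt_le_trans i2 (right_le1 t)).
  by move=> [_|i iw]; rewrite step//=; exact: H.
Qed.

Lemma measurable_digits n t : measurable [set u : R | 0 <= u < 1 /\ digits u n = t].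
Proof.
rewrite (_ : [set _ | _] = \bigcup_(w in [set w : seq T | size w = n.+1 /\ nth t0 w n = t])
   [set u | 0 <= u < 1 /\ forall i, (i < size w)%N -> digits u i = nth t0 w i]).
  apply: measurable_bigcup_count => w _; have [a [_ [_ ->]]] := digits_cylinder w.
  rewrite (_ : [set _ | _] = `[a, (a + \prod_(t <- w) q t)[%classic).
    exact: measurable_itv.
  by apply/seteqP; split => u /=; rewrite in_itv.
apply/seteqP; split => u /=.
- move=> [u01 <-]; exists (mkseq (digits u) n.+1).
    by split; [rewrite size_mkseq|rewrite nth_mkseq].
  by split=> // i; rewrite size_mkseq => ?; rewrite nth_mkseq.
- move=> [w [sw wn] [u01 H]]; split => //.
  by rewrite H ?sw.
Qed.

End coding.

Lemma measure_bigcup_seq d (X : measurableType d) (R : realType)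
    (mu : {measure set X -> \bar R}) (I : choiceType) (r : seq I) (F : I -> set X) :
  uniq r -> (forall i, i \in r -> measurable (F i)) ->
  (forall i j, i \in r -> j \in r -> F i `&` F j !=set0 -> i = j) ->
  mu (\bigcup_(i in [set` r]) F i) = (\sum_(i <- r) mu (F i))%E.
Proof.
by move=> ur mF tF; rewrite measure_fin_bigcup// -fsbig_seq.
Qed.

Definition stack_gen (K : countType) (U : finType) : set (set (K -> option U)) :=
  [set E | exists k t, E = [set w | w k = t]].

Notation stacks K U := (g_sigma_algebraType (@stack_gen K U)).

Definition cyl (K : countType) (U : finType) (s : seq K) (f : K -> option U) :
  set (stacks K U) := [set w | forall k, k \in s -> w k = f k].

Section iid.
Context (R : realType) (K : countType) (U : finType) (q : option U -> R).
Hypothesis q_ge0 : forall t, 0 <= q t.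
Hypothesis q_sum1 : \sum_t q t = 1.

Lemma measurable_coord (k : K) (B : set (option U)) :
  measurable [set w : stacks K U | B (w k)].
Proof.
rewrite (_ : [set _ | _] = \bigcup_(t in B) [set w : stacks K U | w k = t]).
  by apply: measurable_bigcup_count => t _; apply: sub_sigma_algebra; exists k, t.
by apply/seteqP; split => w /= => [Bw|[t Bt ->]] //; exists (w k).
Qed.

Lemma measurable_cyl s f : measurable (@cyl K U s f).
Proof.
rewrite (_ : cyl _ _ = \bigcap_(k in [set` s]) [set w : stacks K U | w k = f k]) //.
by apply: measurable_bigcap_count => k _; exact: (measurable_coord k [set f k]).
Qed.

Local Notation leb := (@lebesgue_measure R).
Let dig := digits q None.

(** Digits outside [S] are free: the lengths of all matching words are summed, and each free factor
    contributes [\sum_t q t = 1]. *)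
Let digits_prod n (S : pred nat) (f : nat -> option U) :
  leb [set u | 0 <= u < 1 /\ forall i, (i < n)%N -> S i -> dig u i = f i] =
  (\prod_(i < n) (if S i then q (f i) else 1))%:E.
Proof.
pose Q (i : 'I_n) : pred (option U) := fun t => S i ==> (t == f i).
have -> : \prod_(i < n) (if S i then q (f i) else 1) =
    \prod_(i < n) \sum_(t | Q i t) q t.
  apply: eq_bigr => i _; rewrite /Q; case: (S i) => /=; last by rewrite q_sum1.
  by rewrite big_pred1_eq.
rewrite bigA_distr_big_dep/=.
pose C (w : {ffun 'I_n -> option U}) := [set u : R | 0 <= u < 1 /\
  forall i, (i < size (fgraph w))%N -> dig u i = nth None (fgraph w) i].
have sz (w : {ffun 'I_n -> option U}) : size (fgraph w) = n.
  by rewrite size_tuple card_ord.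
have wn (w : {ffun 'I_n -> option U}) (i : 'I_n) : nth None (fgraph w) i = w i.
  by rewrite nth_fgraph_ord.
have mC w : measurable (C w) /\ leb (C w) = (\prod_i q (w i))%:E.
  have [a [a0 [a1]]] := digits_cylinder q_ge0 q_sum1 None (fgraph w).
  rewrite -/(C w) => ->.
  rewrite (_ : [set u | _] = `[a, (a + \prod_(t <- fgraph w) q t)[%classic); last first.
    by apply/seteqP; split => u /=; rewrite in_itv.
  split; first exact: measurable_itv.
  rewrite lebesgue_measure_itv/= lte_fin.
  have -> : \prod_i q (w i) = \prod_(t <- fgraph w) q t.
    rewrite (big_nth None) big_mkord sz; apply: eq_bigr => i _.
    by rewrite wn.
  have p0 : 0 <= \prod_(t <- fgraph w) q t by exact: prodr_ge0.
  case: ltP => h; first by rewrite -EFinD; congr EFin; lra.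
  by congr EFin; lra.
rewrite (_ : [set u | _] = \bigcup_(w in [set` enum (family Q)]) C w).
  rewrite measure_bigcup_seq.
  - by rewrite big_enum -sumEFin; apply: eq_bigr => w _; exact: (mC w).2.
  - exact: enum_uniq.
  - by move=> w _; exact: (mC w).1.
  - move=> w w' _ _ [u [[_ h] [_ h']]]; apply/ffunP => i.
    by rewrite -!wn -h ?sz// -h' ?sz.
apply/seteqP; split => u /=.
- move=> [u01 h]; exists [ffun i : 'I_n => dig u i].
    rewrite /= mem_enum; apply/familyP => i; rewrite ffunE /Q unfold_in/=.
    by apply/implyP => Si; rewrite h.
  split => // i; rewrite sz => ilt.
  by rewrite (wn _ (Ordinal ilt)) ffunE.
- move=> [w /=]; rewrite mem_enum => /familyP fw [u01 h]; split => // i ilt Si.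
  rewrite h ?sz// (wn _ (Ordinal ilt)).
  by have := fw (Ordinal ilt); rewrite /Q unfold_in/= Si => /eqP.
Qed.

Let U01 : probability _ R := @uniform_prob R 0 1 ltr01.

Let U01E (A : set R) : measurable A -> A `<=` [set u | 0 <= u < 1] ->
  U01 A = leb A.
Proof.
move=> mA A01; rewrite /U01 /= /uniform_prob.
rewrite -[RHS]mul1e -integral_cst//; apply: eq_integral => x /set_mem /A01 /=.
by rewrite /uniform_pdf => /andP[-> /ltW ->]; rewrite subr0 invr1.
Qed.

Lemma iid_exists : exists Q : probability (stacks K U) R,
  forall s f, uniq s -> Q (cyl s f) = (\prod_(k <- s) q (f k))%:E.
Proof.
(* The value [None] off [[0, 1)] only makes [phi] total: the uniform law does not charge that
   set. *)
pose phi (u : measurableTypeR R) : stacks K U := fun k => if 0 <= u < 1 then dig u (choice.pickle k) else None.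
have m01 : measurable [set u : R | 0 <= u < 1].
  rewrite (_ : [set _ | _] = `[0, 1[%classic); first exact: measurable_itv.
  by apply/seteqP; split => u /=; rewrite in_itv.
have mphi : measurable_fun setT phi.
  apply: (@measurability _ _ _ _ setT phi (@stack_gen K U)) => //.
  move=> _ [_ [k [t ->]] <-]; rewrite setTI.
  rewrite (_ : phi @^-1` _ = [set u | 0 <= u < 1 /\ dig u (choice.pickle k) = t] `|`
     (if t is None then ~` [set u : R | 0 <= u < 1] else set0)).
    apply: measurableU; first exact: measurable_digits.
    by case: t => [_|] //; exact: measurableC.
  rewrite /phi; apply/seteqP; split => u /=.
    by case: ifPn => [? ?|/negP ? <-]; [left|right].
  by case=> [[-> //]|]; case: t => [_ //|/negP/negbTE ->].
pose X : {mfun measurableTypeR R >-> stacks K U} :=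
  HB.pack phi (isMeasurableFun.Build _ _ _ _ phi mphi).
exists (distribution U01 X) => s f us.
rewrite /distribution /pushforward/=.
pose n := (\max_(k <- s) (choice.pickle k)).+1.
pose S : pred nat := fun i => i \in map choice.pickle s.
pose g (i : nat) := if choice.unpickle i is Some k then f k else None.
have ks k : k \in s -> (choice.pickle k < n)%N.
  by move=> kin; rewrite /n ltnS (leq_bigmax_seq (F := choice.pickle)).
have prodE : \prod_(k <- s) q (f k) = \prod_(i < n) (if S i then q (g i) else 1).
  rewrite -(big_mkord xpredT (fun i => if S i then q (g i) else 1)).
  rewrite -big_mkcond/= -[RHS]big_filter.
  transitivity (\prod_(i <- map choice.pickle s) q (g i)).
    by rewrite big_map; apply: eq_bigr => k _; rewrite /g choice.pickleK.
  apply: perm_big; rewrite perm_sym; apply: uniq_perm; first by rewrite filter_uniq// iota_uniq.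
    by rewrite map_inj_uniq//; exact: pcan_inj choice.pickleK.
  move=> i; rewrite mem_filter mem_index_iota /S.
  case: (boolP (i \in map choice.pickle s)) => //= /mapP[k ks' ->].
  exact: ks.
rewrite prodE -digits_prod.
have -> : [set u | 0 <= u < 1 /\ forall i, (i < n)%N -> S i -> dig u i = g i] =
    (phi @^-1` cyl s f) `&` [set u | 0 <= u < 1].
  apply/seteqP; split => u /=.
  - move=> [u01 h]; split => // k ks'; rewrite /phi u01 h ?ks//.
      by rewrite /g choice.pickleK.
    by rewrite /S map_f.
  - move=> [h u01]; split => // i _ /mapP[k kin ->].
    by have := h k kin; rewrite /phi u01 /g choice.pickleK.
have mA : measurable (phi @^-1` cyl s f).
  by rewrite -[X in measurable X]setTI; apply: (mphi measurableT); exact: measurable_cyl.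
rewrite -U01E; [|exact: measurableI|by move=> u []].
have full : U01 [set u : R | 0 <= u < 1] = 1%E.
  rewrite U01E// (_ : [set _ | _] = `[0, 1[%classic).
    by rewrite lebesgue_measure_itv/= lte01 sube0.
  by apply/seteqP; split => u /=; rewrite in_itv.
apply/eqP; rewrite eq_le; apply/andP; split; last first.
  by apply: le_measure; rewrite ?inE//; exact: measurableI.
rewrite -[X in (U01 X <= _)%E](setUIDK _ [set u : R | 0 <= u < 1]).
rewrite measureU0//; [exact: measurableI|exact: measurableD|].
apply: (@subset_measure0 _ _ _ U01 _ (~` [set u : R | 0 <= u < 1])) => //.
- exact: measurableD.
- exact: measurableC.
by have := probability_setC U01 m01; rewrite full subee.
Qed.

(** Cylinders over finitely many indices, together with the empty set, form a generating family
    closed under intersection. *)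
Lemma law_unique (Q Q' : {measure set (stacks K U) -> \bar R}) :
  (Q setT < +oo)%E ->
  (forall s f, uniq s -> Q (cyl s f) = Q' (cyl s f)) ->
  forall A, measurable A -> Q A = Q' A.
Proof.
move=> Qfin QQ' A mA.
pose G : set (set (stacks K U)) :=
  [set E | E = set0 \/ exists s f, uniq s /\ E = cyl s f].
have GT : G setT.
  by right; exists [::], (fun=> None); split => //; apply/seteqP; split.
apply: (@measure_unique _ _ _ G (fun=> setT)) => //.
- apply/seteqP; split; last first.
    apply: smallest_sub; first exact: sigma_algebra_measurable.
    by move=> E [->|[s [f [_ ->]]]] //; exact: measurable_cyl.
  apply: smallest_sub; first exact: smallest_sigma_algebra.
  move=> _ [k [t ->]]; apply: sub_sigma_algebra; right.
  exists [:: k], (fun=> t); split => //; apply/seteqP; split => w /=.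
    by move=> wk j; rewrite inE => /eqP ->.
  by apply; rewrite inE.
- move=> E F [->|[s [f [us ->]]]]; first by left; rewrite set0I.
  move=> [->|[s' [f' [us' ->]]]]; first by left; rewrite setI0.
  have [agree|] := pselect (forall k, k \in s -> k \in s' -> f k = f' k).
    right; exists (undup (s ++ s')), (fun k => if k \in s then f k else f' k).
    split; first exact: undup_uniq.
    apply/seteqP; split => w /=.
      move=> [h h'] k; rewrite mem_undup mem_cat.
      by case: (boolP (k \in s)) => [/h//|_ /h'].
    move=> h; split => k ks.
      by rewrite h ?ks// mem_undup mem_cat ks.
    rewrite h ?mem_undup ?mem_cat ?ks ?orbT//.
    by case: ifPn => // ks'; exact: agree.
  move=> no; left; apply/seteqP; split => // w [h h']; apply: no => k ks ks'.
  by rewrite -h// -h'.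
- by rewrite bigcup_const.
- move=> E [->|[s [f [us ->]]]]; first by rewrite !measure0.
  exact: QQ'.
Qed.

End iid.

(** * Odometers and parallel toppling *)

Definition dir d (e : 'I_d * bool) : Zd d :=
  if e.2 then delta_mx 0 e.1 else - delta_mx 0 e.1.

Notation stack d := (stacks (Zd d * nat)%type ('I_d * bool)%type).

Section odometers.
Context (d : nat).
Implicit Types (w : stack d) (xi h g : Zd d -> nat) (x y : Zd d).

Definition flow w h x e : nat := count (fun j => w (x, j) == Some e) (iota 0 (h x)).

Definition outflow w h x : nat := \sum_e flow w h x e.

Definition inflow w h x : nat := \sum_e flow w h (x - dir e) e.

Definition asleep w h x : bool := if h x is j.+1 then w (x, j) == None else false.

(** The subtraction is truncated: this is the true number of particles only if [outflow] does not
    exceed the supply, which has to be proved wherever exact counting matters. *)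
Definition load xi w h x : nat := xi x + inflow w h x - outflow w h x.

Lemma flow_local w h h' x e : h x = h' x -> flow w h x e = flow w h' x e.
Proof. by rewrite /flow => ->. Qed.

Lemma flow_le w h h' x e : (h x <= h' x)%N -> (flow w h x e <= flow w h' x e)%N.
Proof.
by move=> hh; rewrite /flow -(subnKC hh) iotaD count_cat leq_addr.
Qed.

Lemma outflow_local w h h' x : h x = h' x -> outflow w h x = outflow w h' x.
Proof. by move=> hh; apply: eq_bigr => e _; exact: flow_local. Qed.

Lemma outflowE w h x : outflow w h x = count (fun j => w (x, j) != None) (iota 0 (h x)).
Proof.
rewrite /outflow /flow; elim: (iota _ _) => [|j s IHs] /=.
  by rewrite big1.
rewrite big_split/= IHs; congr (_ + _)%N.
case: (w (x, j)) => [e|] /=; last by rewrite big1.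
by rewrite (bigD1 e)//= eqxx big1// => e' /negPf; rewrite (inj_eq (@Some_inj _)) eq_sym => ->.
Qed.

Lemma outflow_le w h x : (outflow w h x <= h x)%N.
Proof. by rewrite outflowE -[X in (_ <= X)%N](size_iota 0) count_size. Qed.

Lemma inflow_le w h h' x : (forall y, (h y <= h' y)%N) ->
  (inflow w h x <= inflow w h' x)%N.
Proof. by move=> hh; apply: leq_sum => e _; exact: flow_le. Qed.

Lemma asleep_local w h h' x : h x = h' x -> asleep w h x = asleep w h' x.
Proof. by rewrite /asleep => ->. Qed.

Definition incr h x : Zd d -> nat := fun y => (h y + (y == x))%N.

Lemma flow_incr w h x y e :
  flow w (incr h x) y e = (flow w h y e + ((y == x) && (w (x, h x) == Some e)))%N.
Proof.
rewrite /flow /incr; case: eqVneq => [->|_] /=; last by rewrite !addn0.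
by rewrite iotaD count_cat/= add0n addn0.
Qed.

Lemma outflow_incr w h x y :
  outflow w (incr h x) y = (outflow w h y + ((y == x) && (w (x, h x) != None)))%N.
Proof.
rewrite !outflowE /incr; case: eqVneq => [->|_] /=; last by rewrite !addn0.
by rewrite iotaD count_cat/= add0n addn0.
Qed.

Lemma inflow_incr w h x y :
  inflow w (incr h x) y =
  (inflow w h y + (if w (x, h x) is Some e then y == (x + dir e)%R else false))%N.
Proof.
rewrite /inflow; under eq_bigr do rewrite flow_incr.
rewrite big_split/=; congr (_ + _)%N.
case: (w (x, h x)) => [e|]; last by rewrite big1// => e _; rewrite andbF.
rewrite (bigD1 e)//= eqxx andbT subr_eq big1 ?addn0// => e' /negPf.
by rewrite (inj_eq (@Some_inj _)) eq_sym => ->; rewrite andbF.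
Qed.

Definition stack_drop w g : stack d := fun k => w (k.1, g k.1 + k.2)%N.

Lemma flow_add w g h x e :
  flow w (fun y => g y + h y)%N x e = (flow w g x e + flow (stack_drop w g) h x e)%N.
Proof.
rewrite /flow iotaD count_cat add0n; congr (_ + _)%N.
by rewrite -[X in iota X _]addn0 iotaDl count_map.
Qed.

Lemma outflow_add w g h x :
  outflow w (fun y => g y + h y)%N x = (outflow w g x + outflow (stack_drop w g) h x)%N.
Proof. by rewrite /outflow -big_split/=; apply: eq_bigr => e _; rewrite flow_add. Qed.

Lemma inflow_add w g h x :
  inflow w (fun y => g y + h y)%N x = (inflow w g x + inflow (stack_drop w g) h x)%N.
Proof. by rewrite /inflow -big_split/=; apply: eq_bigr => e _; rewrite flow_add. Qed.

Definition stack_shift y w : stack d := fun k => w (k.1 + y, k.2).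

Lemma flow_shift y w h x e :
  flow (stack_shift y w) (fun z => h (z + y)) x e = flow w h (x + y) e.
Proof. by []. Qed.

Lemma inflow_shift y w h x :
  inflow (stack_shift y w) (fun z => h (z + y)) x = inflow w h (x + y).
Proof. by apply: eq_bigr => e _; rewrite flow_shift addrAC. Qed.

End odometers.

(* A site x is unstable when [rule x N b], N being the number of particles at x
   and b telling whether the last instruction used at x was a sleep. *)
Section toppling.
Context (d : nat) (rule : Zd d -> nat -> bool -> bool).
Hypothesis rule_mono : forall x N N' b, (N <= N')%N -> rule x N b -> rule x N' b.
Implicit Types (w : stack d) (xi h g : Zd d -> nat) (x y : Zd d).

Definition unstable xi w h x := rule x (load xi w h x) (asleep w h x).

Fixpoint parallel xi w n : Zd d -> nat := fun x =>
  if n is m.+1 then (parallel xi w m x + unstable xi w (parallel xi w m) x)%N else 0%N.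

(** With [h x] frozen, more particles and more topplings elsewhere can only increase the load at
    [x], while the last instruction used there stays the same. *)
Lemma attractive xi xi' w h h' x : (forall y, (xi y <= xi' y)%N) ->
  (forall y, (h y <= h' y)%N) -> h x = h' x ->
  unstable xi w h x -> unstable xi' w h' x.
Proof.
move=> xx hh hx; rewrite /unstable (asleep_local w hx); apply: rule_mono.
rewrite /load (outflow_local w hx) leq_sub2r// leq_add//; exact: inflow_le.
Qed.

(** Sequential toppling stays below parallel toppling run one step longer: where the latter is not
    already ahead at [x], attractivity makes [x] unstable for it too. *)
Lemma parallel_step xi w h n x : (forall y, (h y <= parallel xi w n y)%N) ->
  unstable xi w h x -> forall y, (incr h x y <= parallel xi w n.+1 y)%N.
Proof.
move=> hn ux y; rewrite /incr/=; case: eqVneq => [->|_]; last first.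
  by rewrite addn0 (leq_trans (hn y))// leq_addr.
have := hn x; rewrite leq_eqVlt => /orP[/eqP e|lt].
  by rewrite (attractive _ hn e ux)// e.
by rewrite addn1 (leq_trans lt)// leq_addr.
Qed.

Lemma parallel_mono_init xi xi' w n x : (forall y, (xi y <= xi' y)%N) ->
  (parallel xi w n x <= parallel xi' w n x)%N.
Proof.
move=> xx; elim: n x => [//|n IHn] x /=.
have := IHn x; rewrite leq_eqVlt => /orP[/eqP e|lt].
  rewrite e leq_add2l; case: (boolP (unstable xi w _ x)) => // u.
  by rewrite (attractive xx IHn e u).
have : (unstable xi w (parallel xi w n) x <= 1)%N by exact: leq_b1.
by move=> /(leq_add lt); rewrite addSn => h; rewrite -ltnS; lia.
Qed.

(** Least action principle. Nothing requires [v] to be reached by topplings of unstable sites: if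
    parallel toppling has caught up with [v] at [x], stability of [v] blocks it there. *)
Lemma parallel_le_stable xi xi' w v : (forall y, (xi y <= xi' y)%N) ->
  (forall x, ~~ unstable xi' w v x) -> forall n x, (parallel xi w n x <= v x)%N.
Proof.
move=> xx st; elim=> [//|n IHn] x /=.
have := IHn x; rewrite leq_eqVlt => /orP[/eqP e|lt].
  case: (boolP (unstable xi w _ x)) => [u|_]; last by rewrite addn0.
  by have := st x; rewrite (attractive xx IHn e u).
have : (unstable xi w (parallel xi w n) x <= 1)%N by exact: leq_b1.
by lia.
Qed.

Lemma parallel_leS xi w n m x : (n <= m)%N -> (parallel xi w n x <= parallel xi w m x)%N.
Proof.
move=> /subnK <-; elim: (m - n)%N => [//|k IHk]; rewrite addSn /=.
by rewrite (leq_trans IHk)// leq_addr.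
Qed.

Lemma parallel_le_time xi w n x : (parallel xi w n x <= n)%N.
Proof.
elim: n => //= n IHn; have : (unstable xi w (parallel xi w n) x <= 1)%N by exact: leq_b1.
by lia.
Qed.

Definition explodes xi w x := forall k, exists n, (k <= parallel xi w n x)%N.

(** Infinitely many particles are sent from [x] to its neighbour. If the neighbour toppled fewer
    than [k] times, its load would eventually stay above [c], and it would topple at every later
    step. *)
Lemma explodes_spread xi w x e c : (forall N b, (c <= N)%N -> rule (x + dir e) N b) ->
  (forall m, exists j, (m <= j)%N /\ w (x, j) = Some e) ->
  explodes xi w x -> explodes xi w (x + dir e).
Proof.
move=> hc often ex; apply: contrapT => /existsNP[k] /forallNP nk.
have small n : (parallel xi w n (x + dir e) < k)%N by rewrite ltnNge; exact/negP/nk.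
have big m : exists J, forall h, (J <= h x)%N -> (m <= flow w h x e)%N.
  elim: m => [|m [J HJ]]; first by exists 0%N.
  have [j [Jj wj]] := often J; exists j.+1 => h jh.
  pose h1 : Zd d -> nat := fun=> j.
  apply: (@leq_trans (flow w (incr h1 x) x e)); last first.
    by apply: flow_le; rewrite /incr /h1 eqxx addn1.
  by rewrite flow_incr eqxx /h1 wj eqxx addn1 ltnS HJ.
(* At least [k + c] arrivals and fewer than [k] departures leave a load of at least [c]. *)
have [J HJ] := big (k + c)%N; have [n0 Hn0] := ex J.
have un n : (n0 <= n)%N -> unstable xi w (parallel xi w n) (x + dir e).
  move=> nn; apply: hc; rewrite /load.
  have h1 := HJ _ (leq_trans Hn0 (parallel_leS xi w x nn)).
  have h2 : (flow w (parallel xi w n) x e <= inflow w (parallel xi w n) (x + dir e))%N.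
    by rewrite /inflow (bigD1 e)//= addrK leq_addr.
  have h3 := outflow_le w (parallel xi w n) (x + dir e).
  have h4 := small n; lia.
have grow j : (j <= parallel xi w (n0 + j) (x + dir e))%N.
  elim: j => // j IHj; rewrite addnS /= un ?leq_addr//; lia.
by have := grow k; have := small (n0 + k)%N; lia.
Qed.

Lemma not_explodes xi w x : ~ explodes xi w x ->
  exists n0, forall n, (n0 <= n)%N -> parallel xi w n x = parallel xi w n0 x.
Proof.
move=> /existsNP[k] /forallNP nk.
have bd n : (parallel xi w n x <= k)%N by rewrite leqNgt; apply/negP => /ltnW /nk.
have ex : exists m, [exists i : 'I_k.+1, (i == m :> nat) && `[< exists n, parallel xi w n x = m >]].
  exists 0%N; apply/existsP; exists ord0; apply/asboolP.
  by exists 0%N.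
have ub m : [exists i : 'I_k.+1, (i == m :> nat) && `[< exists n, parallel xi w n x = m >]] ->
    (m <= k)%N.
  by move=> /existsP[i /andP[/eqP <- _]]; rewrite -ltnS.
case: (ex_maxnP ex ub) => m /existsP[_ /andP[_ /asboolP[n0 en0]]] mx.
exists n0 => n nn; apply/eqP; rewrite eqn_leq [X in _ && X]parallel_leS// andbT en0.
apply: mx; apply/existsP.
have lt : (parallel xi w n x < k.+1)%N by rewrite ltnS.
by exists (Ordinal lt); rewrite /= eqxx; apply/asboolP; exists n.
Qed.

(** Instability at [x] involves only [x] and its neighbours, so it would already show at the finite
    step [N], after which [x] would topple once more. *)
Lemma limit_odometer xi w : (forall x, ~ explodes xi w x) ->
  exists L, (forall x, exists n0, forall n, (n0 <= n)%N -> parallel xi w n x = L x) /\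
            (forall x, ~~ unstable xi w L x).
Proof.
move=> nex; have [nn Hnn] := choice (fun x => not_explodes (nex x)).
pose L x := parallel xi w (nn x) x.
exists L; split=> [x|x]; first by exists (nn x); exact: Hnn.
pose N := (nn x + \sum_e nn (x - dir e)%R)%N.
have eqx : parallel xi w N x = L x by apply: Hnn; rewrite leq_addr.
have eqe e : parallel xi w N (x - dir e) = L (x - dir e).
  apply: Hnn; rewrite /N (bigD1 e)//=; lia.
have -> : unstable xi w L x = unstable xi w (parallel xi w N) x.
  rewrite /unstable (asleep_local w (esym eqx)); congr (rule _ _ _).
  rewrite /load (outflow_local w (esym eqx)); congr (_ + _ - _)%N.
  by apply: eq_bigr => e _; apply: flow_local; rewrite eqe.
apply/negP => u; have := Hnn x N.+1; rewrite -/(L x) /= u eqx => /(_ _).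
by rewrite /N => h; have := h (ltac:(lia)); lia.
Qed.

End toppling.

Lemma parallel_shift d (rule rule' : Zd d -> nat -> bool -> bool) y xi w n x :
  (forall z N b, rule' z N b = rule (z + y) N b) ->
  parallel rule' (fun z => xi (z + y)) (stack_shift y w) n x =
  parallel rule xi w n (x + y).
Proof.
move=> rr; elim: n x => // n IHn x /=.
have IH : parallel rule' (fun z => xi (z + y)) (stack_shift y w) n =
   (fun z => parallel rule xi w n (z + y)) by apply/funext => z; exact: IHn.
rewrite IH; congr (_ + nat_of_bool _)%N; rewrite /unstable rr; congr (rule _ _ _).
by rewrite /load inflow_shift.
Qed.

(** One bit of memory is enough: a load of two or more decreases only through a toppling, so under
    legal topplings a load of one after a sleep means that the sleep found a lone particle. *)
Definition arw_rule d (x : Zd d) (N : nat) (b : bool) : bool :=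
  (1 < N)%N || ((N == 1%N) && ~~ b).

Definition fill_rule d (eta : Zd d -> nat) (x : Zd d) (N : nat) (b : bool) : bool :=
  (eta x < N)%N.

Lemma arw_rule_mono d (x : Zd d) N N' b :
  (N <= N')%N -> arw_rule x N b -> arw_rule x N' b.
Proof. by rewrite /arw_rule; case: b => /=; lia. Qed.

Lemma fill_rule_mono d (eta : Zd d -> nat) (x : Zd d) N N' b :
  (N <= N')%N -> fill_rule eta x N b -> fill_rule eta x N' b.
Proof. by rewrite /fill_rule; lia. Qed.

(** After [g] each load is at most [eta], so the load after [g] and [L] is at most the one computed
    from [eta] with the remaining stacks. Where [L x] is zero the second system counts the particle
    as awake, which errs on the right side. *)
Lemma stable_concat d (w : stack d) (xi eta g L : Zd d -> nat) :
  (forall x, ~~ unstable (fill_rule eta) xi w g x) ->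
  (forall x, ~~ unstable (@arw_rule d) eta (stack_drop w g) L x) ->
  forall x, ~~ unstable (@arw_rule d) xi w (fun y => g y + L y)%N x.
Proof.
move=> sg sL x; have := sL x; apply: contra.
have := sg x; rewrite /unstable /fill_rule -leqNgt => lg.
have ll : (load xi w (fun y => g y + L y) x <= load eta (stack_drop w g) L x)%N.
  by move: lg; rewrite /load inflow_add outflow_add; lia.
move=> u; have := arw_rule_mono ll u; rewrite /arw_rule => /orP[->//|/andP[e _]].
apply/orP; right; rewrite e/=; move: u; rewrite /arw_rule => /orP[|/andP[_]].
  by move: ll; rewrite (eqP e); lia.
by apply: contra; rewrite /asleep /stack_drop /=; case: (L x) => // j; rewrite addnS.
Qed.

(** * Laws on stacks of instructions *)

Lemma measure_bigcup_null d (X : measurableType d) (R : realType)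
    (mu : {measure set X -> \bar R}) (I : countType) (F : I -> set X) :
  (forall i, measurable (F i)) -> (forall i, mu (F i) = 0%E) ->
  mu (\bigcup_i F i) = 0%E.
Proof.
move=> mF F0; apply: measure_negligible; first exact: measurable_bigcup_count.
rewrite (_ : \bigcup_i F i =
    \bigcup_n (if choice.unpickle n is Some i then F i else set0)).
  apply: negligible_bigcup => n; case: choice.unpickle => [i|].
    by apply/negligibleP => //; exact: F0.
  exact: negligible_set0.
apply/seteqP; split => x; first by move=> [i _ Fi]; exists (choice.pickle i); rewrite ?choice.pickleK.
by move=> [n _]; case: choice.unpickle => // i Fi; exists i.
Qed.

Section discrete_measurability.
Context d (X : measurableType d).

(** Measurability for the discrete sigma-algebra, stated through preimages so that [A] carries no
    measurable structure. *)
Definition dmeas (A : Type) (f : X -> A) := forall B : set A, measurable (f @^-1` B).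

Lemma dmeas_cst (A : Type) (a : A) : dmeas (fun=> a).
Proof.
move=> B; have [Ba|nBa] := pselect (B a).
  by rewrite (_ : _ @^-1` _ = setT)//; apply/seteqP; split.
by rewrite (_ : _ @^-1` _ = set0)//; apply/seteqP; split.
Qed.

Lemma dmeas_comp (A B : Type) (g : A -> B) (f : X -> A) :
  dmeas f -> dmeas (fun x => g (f x)).
Proof. by move=> mf C; exact: (mf (g @^-1` C)). Qed.

Lemma dmeas_dep (A : countType) (B : Type) (g : X -> A) (f : A -> X -> B) :
  dmeas g -> (forall a, dmeas (f a)) -> dmeas (fun x => f (g x) x).
Proof.
move=> mg mf C.
rewrite (_ : _ @^-1` _ = \bigcup_(a in setT) ((g @^-1` [set a]) `&` (f a @^-1` C))).
  by apply: measurable_bigcup_count => a _; apply: measurableI; [exact: mg|exact: mf].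
by apply/seteqP; split => x /= => [Cx|[a _ [<-]]//]; exists (g x).
Qed.

Lemma dmeas_op (A B : countType) (C : Type) (op : A -> B -> C) (f : X -> A) (g : X -> B) :
  dmeas f -> dmeas g -> dmeas (fun x => op (f x) (g x)).
Proof.
move=> mf mg; apply: (@dmeas_dep A C f (fun a x => op a (g x)) mf) => a.
exact: (dmeas_comp (op a) mg).
Qed.

Lemma dmeas_sum (I : Type) (r : seq I) (F : I -> X -> nat) :
  (forall i, dmeas (F i)) -> dmeas (fun x => \sum_(i <- r) F i x)%N.
Proof.
move=> mF; elim: r => [|i r IHr].
  by under eq_fun do rewrite big_nil; exact: dmeas_cst.
under eq_fun do rewrite big_cons; exact: (dmeas_op addn (mF i) IHr).
Qed.

Lemma dmeas_set (A : Type) (f : X -> A) (P : A -> Prop) :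
  dmeas f -> measurable [set x | P (f x)].
Proof. by move=> mf; exact: (mf [set a | P a]). Qed.

Lemma measurable_pred (b : X -> bool) : measurable [set x | b x] -> dmeas b.
Proof.
move=> mb B; rewrite (_ : b @^-1` B = ([set x | b x] `&` [set x | B true]) `|`
   (~` [set x | b x] `&` [set x | B false])).
  apply: measurableU; apply: measurableI => //.
  - exact: (dmeas_cst true B).
  - exact: measurableC.
  - exact: (dmeas_cst false B).
apply/seteqP; split => x /=; first by case: (b x) => ?; [left|right].
by case=> [[->]//|[/negP/negbTE ->]].
Qed.

End discrete_measurability.

Lemma dmeas_measurable_comp d1 d2 (X : measurableType d1) (Y : measurableType d2)
    (A : Type) (f : Y -> A) (phi : X -> Y) :
  measurable_fun setT phi -> dmeas f -> dmeas (fun x => f (phi x)).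
Proof. by move=> mphi mf B; rewrite -[X in measurable X]setTI; exact: (mphi measurableT _ (mf B)). Qed.

Section measurable_maps.
Context dX (X : measurableType dX) (K : countType) (U : finType).

Lemma dmeas_coord (k : K) : dmeas (fun w : stacks K U => w k).
Proof. by move=> B; exact: measurable_coord. Qed.

Lemma measurable_to_stacks (phi : X -> stacks K U) :
  (forall k, dmeas (fun x => phi x k)) -> measurable_fun setT phi.
Proof.
move=> mphi; apply: (@measurability _ _ _ _ setT phi (@stack_gen K U)) => //.
by move=> _ [_ [k [t ->]] <-]; rewrite setTI; exact: (mphi k [set t]).
Qed.

Lemma measurable_preimage dY (Y : measurableType dY) (phi : X -> Y) (A : set Y) :
  measurable_fun setT phi -> measurable A -> measurable (phi @^-1` A).
Proof. by move=> mphi mA; rewrite -[X in measurable X]setTI; exact: (mphi measurableT). Qed.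

End measurable_maps.

Section parallel_measurability.
Context dX (X : measurableType dX) (d : nat).
Variables (rule : X -> Zd d -> nat -> bool -> bool) (xi : X -> Zd d -> nat)
  (w : X -> stack d).
Hypothesis mrule : forall x N b, dmeas (fun o => rule o x N b).
Hypothesis mxi : forall x, dmeas (fun o => xi o x).
Hypothesis mw : forall k, dmeas (fun o => w o k).

Lemma dmeas_flow (h : X -> Zd d -> nat) x e :
  dmeas (fun o => h o x) -> dmeas (fun o => flow (w o) (h o) x e).
Proof.
move=> mh; rewrite /flow.
apply: (@dmeas_dep _ X nat nat (fun o => h o x)
  (fun n o => count (fun j => w o (x, j) == Some e) (iota 0 n))) => // n.
under eq_fun do rewrite -sum1_count big_mkcond.
apply: dmeas_sum => j; exact: (dmeas_comp (fun t => if t == Some e then 1 else 0)%N (mw (x, j))).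
Qed.

Lemma dmeas_outflow (h : X -> Zd d -> nat) x :
  dmeas (fun o => h o x) -> dmeas (fun o => outflow (w o) (h o) x).
Proof. by move=> mh; apply: dmeas_sum => e; exact: dmeas_flow. Qed.

Lemma dmeas_inflow (h : X -> Zd d -> nat) x :
  (forall y, dmeas (fun o => h o y)) -> dmeas (fun o => inflow (w o) (h o) x).
Proof. by move=> mh; apply: dmeas_sum => e; exact: dmeas_flow. Qed.

Lemma dmeas_load (h : X -> Zd d -> nat) x :
  (forall y, dmeas (fun o => h o y)) -> dmeas (fun o => load (xi o) (w o) (h o) x).
Proof.
move=> mh; apply: (dmeas_op subn); last exact: dmeas_outflow.
by apply: (dmeas_op addn) => //; exact: dmeas_inflow.
Qed.

Lemma dmeas_unstable (h : X -> Zd d -> nat) x : (forall y, dmeas (fun o => h o y)) ->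
  dmeas (fun o => unstable (rule o) (xi o) (w o) (h o) x).
Proof.
move=> mh; rewrite /unstable.
apply: (@dmeas_dep _ X nat bool _ (fun N o => rule o x N (asleep (w o) (h o) x))).
  exact: dmeas_load.
move=> N; apply: (@dmeas_dep _ X bool bool _ (fun b o => rule o x N b)) => //.
rewrite /asleep; apply: (@dmeas_dep _ X nat bool (fun o => h o x)
  (fun n o => if n is j.+1 then w o (x, j) == None else false)) => // -[|j].
  exact: dmeas_cst.
exact: (dmeas_comp (fun t => t == None) (mw (x, j))).
Qed.

Lemma dmeas_parallel n x : dmeas (fun o => parallel (rule o) (xi o) (w o) n x).
Proof.
elim: n x => [|n IHn] x /=; first exact: dmeas_cst.
by apply: (dmeas_op (fun m (b : bool) => (m + b)%N)) => //; exact: dmeas_unstable.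
Qed.

Lemma measurable_explodes x :
  measurable [set o | explodes (rule o) (xi o) (w o) x].
Proof.
rewrite (_ : [set _ | _] = \bigcap_(k in setT) \bigcup_(n in setT)
    [set o | (k <= parallel (rule o) (xi o) (w o) n x)%N]).
  apply: measurable_bigcap_count => k _; apply: measurable_bigcup_count => n _.
  exact: (dmeas_set (fun m => k <= m)%N (dmeas_parallel n x)).
apply/seteqP; split => o /= h k; first by move=> _; have [n] := h k; exists n.
by have [//|n _] := h k; exists n.
Qed.

End parallel_measurability.

Notation history d := (seq (Zd d * option ('I_d * bool))%type).

Section histories.
Context (d : nat).
Implicit Types (w : stack d) (s : history d) (x : Zd d).

(* The most recent toppling comes first in a history. *)
Definition visits s x : nat := count (fun k => k.1 == x) s.

Fixpoint compat w s : bool :=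
  if s is k :: s' then (w (k.1, visits s' k.1) == k.2) && compat w s' else true.

Fixpoint used s : seq (Zd d * nat) :=
  if s is k :: s' then (k.1, visits s' k.1) :: used s' else [::].

Lemma visits_cons s k : visits (k :: s) = incr (visits s) k.1.
Proof. by apply/funext => x; rewrite /visits /incr /= addnC eq_sym. Qed.

Lemma used_lt s k : k \in used s -> (k.2 < visits s k.1)%N.
Proof.
elim: s => //= -[x t] s IHs; rewrite inE => /predU1P[->/=|/IHs].
  by rewrite eqxx.
by move=> /leq_trans; apply; rewrite leq_addl.
Qed.

Lemma uniq_used s : uniq (used s).
Proof.
elim: s => //= k s ->; rewrite andbT; apply/negP => /used_lt /=.
by rewrite ltnn.
Qed.

Fixpoint recorded s : Zd d * nat -> option ('I_d * bool) :=
  if s is k :: s' then fun i => if i == (k.1, visits s' k.1) then k.2 else recorded s' i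
  else fun=> None.

Lemma compatP w s : compat w s <-> (forall i, i \in used s -> w i = recorded s i).
Proof.
elim: s => [|k s IHs]; first by split.
split=> /=.
  move=> /andP[/eqP wk /IHs h] i; rewrite inE.
  by case: eqVneq => [->//|_ /=]; exact: h.
move=> h; rewrite -[k.2](_ : recorded (k :: s) (k.1, visits s k.1) = _); last first.
  by rewrite /= eqxx.
rewrite h ?mem_head//= eqxx/=; apply/IHs => i iu.
have := h i; rewrite inE iu orbT => ->//; case: eqP => // e.
by have := used_lt iu; rewrite e ltnn.
Qed.

End histories.

Section stack_laws.
Context (R : realType) (d : nat) (q : option ('I_d * bool) -> R).
Hypothesis q_ge0 : forall t, 0 <= q t.
Hypothesis q_sum1 : \sum_t q t = 1.
Variable Q : probability (stack d) R.
Hypothesis Qcyl : forall s f, uniq s -> Q (cyl s f) = (\prod_(k <- s) q (f k))%:E.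

(** Both sides are finite measures in [A], so cylinders suffice. The conclusion says that [phi] has
    law [Q] and is independent of [D], an event of probability [c]. *)
Lemma law_transport (D : set (stack d)) (phi : stack d -> stack d) (c : R) :
  0 <= c -> measurable D -> measurable_fun setT phi ->
  (forall s f, uniq s -> Q (D `&` phi @^-1` cyl s f) = (c * \prod_(k <- s) q (f k))%:E) ->
  forall A, measurable A -> Q (D `&` phi @^-1` A) = (c%:E * Q A)%E.
Proof.
move=> c0 mD mphi H A mA.
pose m0 : {measure set (stack d) -> \bar R} := pushforward (mrestr Q mD) phi.
pose m1 := m0 mphi.
pose m2 : {measure set (stack d) -> \bar R} := mscale (NngNum c0) Q.
have m1E B : m1 B = Q (D `&` phi @^-1` B) by rewrite /m1 /= /pushforward /mrestr setIC.
rewrite -m1E -[RHS]/(m2 A); apply: law_unique => //.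
- rewrite m1E (le_lt_trans (probability_le1 Q _)) ?ltry//.
  by apply: measurableI => //; rewrite preimage_setT.
- by move=> s f us; rewrite m1E H// /m2 /= /mscale/= Qcyl// EFinM.
Qed.

Lemma law_reindex (phi psi : Zd d * nat -> Zd d * nat) : cancel phi psi ->
  forall A : set (stack d), measurable A -> Q [set w : stack d | A (w \o phi)] = Q A.
Proof.
move=> phiK A mA; rewrite -[RHS]mul1e -(@law_transport setT (fun w => w \o phi) 1)//.
- by rewrite setTI.
- by apply: measurable_to_stacks => k; exact: dmeas_coord.
move=> s f us; rewrite setTI mul1r.
have -> : (fun w : stack d => w \o phi) @^-1` cyl s f = cyl (map phi s) (f \o psi).
  apply/seteqP; split => w /= h k.
    by move=> /mapP[i si ->]; rewrite /= phiK -(h i si).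
  by move=> ks; rewrite /= h/= ?phiK// map_f.
rewrite Qcyl ?map_inj_uniq//; last exact: can_inj phiK.
by rewrite big_map; congr EFin; apply: eq_bigr => i _; rewrite /= phiK.
Qed.

Lemma law_shift y (A : set (stack d)) : measurable A -> Q (stack_shift y @^-1` A) = Q A.
Proof.
move=> mA; pose phi (k : Zd d * nat) := (k.1 + y, k.2).
pose psi (k : Zd d * nat) := (k.1 - y, k.2).
apply: (@law_reindex phi psi) => // -[x j]; by rewrite /phi /psi /= addrK.
Qed.

Definition mix (S : pred (Zd d * nat)) (w w' : stack d) : stack d :=
  fun k => if S k then w k else w' k.

(** Taking the coordinates outside [S] from an independent copy leaves the law unchanged. This is
    the form in which independence of events reading disjoint sets of instructions is used. *)
Lemma law_mix (S : pred (Zd d * nat)) (A : set (stack d)) : measurable A ->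
  (Q \x Q)%E [set ww | A (mix S ww.1 ww.2)] = Q A.
Proof.
move=> mA; pose phi (ww : stack d * stack d) := mix S ww.1 ww.2.
have mphi : measurable_fun setT phi.
  apply: measurable_to_stacks => k; rewrite /phi /mix; case: (S k).
    exact: (dmeas_measurable_comp measurable_fst (dmeas_coord k)).
  exact: (dmeas_measurable_comp measurable_snd (dmeas_coord k)).
pose m0 : {measure set (stack d) -> \bar R} := pushforward (Q \x Q)%E phi.
pose m1 := m0 mphi.
rewrite -[LHS]/(m1 A); apply: law_unique => //.
  rewrite /m1/= /pushforward preimage_setT.
  exact: le_lt_trans (probability_le1 (Q \x Q)%E measurableT) (ltry 1).
move=> s f us; rewrite /m1/= /pushforward.
have -> : phi @^-1` cyl s f = cyl [seq k <- s | S k] f `*` cyl [seq k <- s | ~~ S k] f.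
  apply/seteqP; split => -[w w'] /=.
    move=> h; split => k; rewrite mem_filter => /andP[Sk ks];
      have := h k ks; rewrite /phi /mix/= ?Sk//.
    by move: Sk => /= /negbTE ->.
  move=> [h h'] k ks; rewrite /phi /mix/=; case: ifPn => Sk.
    by apply: h; rewrite mem_filter Sk.
  by apply: h'; rewrite mem_filter /= Sk.
transitivity (Q (cyl [seq k <- s | S k] f) * Q (cyl [seq k <- s | ~~ S k] f))%E.
  by apply: product_measure1E; exact: measurable_cyl.
rewrite !Qcyl ?filter_uniq// -EFinM; congr EFin.
by rewrite !big_filter [RHS](bigID S).
Qed.

Definition hist_prob (s : history d) : R := \prod_(k <- s) q k.2.

Lemma hist_prob_ge0 s : 0 <= hist_prob s. Proof. exact: prodr_ge0. Qed.

Lemma measurable_compat s : measurable [set w : stack d | compat w s].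
Proof.
elim: s => [|k s IHs] /=; first by rewrite set_true.
rewrite (_ : [set w | _] = [set w : stack d | w (k.1, visits s k.1) = k.2] `&` [set w | compat w s]).
  by apply: measurableI => //; exact: (dmeas_coord _ [set k.2]).
by apply/seteqP; split => w /= => [/andP[/eqP]|[/eqP -> ->]].
Qed.

Lemma measurable_drop g : measurable_fun setT (fun w : stack d => stack_drop w g).
Proof. by apply: measurable_to_stacks => k; exact: dmeas_coord. Qed.

(** Compatibility with [s] reads exactly the indices [used s], and the dropped stack reads only
    later ones; on cylinders the product therefore splits. *)
Lemma prob_compat_drop s (A : set (stack d)) : measurable A ->
  Q ([set w | compat w s] `&` [set w | A (stack_drop w (visits s))]) =
  ((hist_prob s)%:E * Q A)%E.
Proof.
apply: (@law_transport _ (fun w => stack_drop w (visits s))).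
- exact: hist_prob_ge0.
- exact: measurable_compat.
- exact: measurable_drop.
move=> r f ur.
pose phi (k : Zd d * nat) := (k.1, visits s k.1 + k.2)%N.
pose F k := if k \in used s then recorded s k else f (k.1, k.2 - visits s k.1)%N.
have phi_inj : injective phi.
  by move=> [x j] [y i] [<- /eqP]; rewrite eqn_add2l => /eqP ->.
have Fphi k : F (phi k) = f k.
  rewrite /F; case: ifPn => [/used_lt/=|_ /=]; first by rewrite ltnNge leq_addr.
  by rewrite addKn; case: k.
have -> : [set w | compat w s] `&` (fun w => stack_drop w (visits s)) @^-1` cyl r f =
    cyl (used s ++ map phi r) F.
  apply/seteqP; split => w /=.
    move=> [/compatP h h'] k; rewrite mem_cat => /orP[ku|/mapP[i ir ->]].
      by rewrite /F ku h.
    by rewrite Fphi; exact: h'.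
  move=> h; split.
    by apply/compatP => i iu; rewrite h ?mem_cat ?iu// /F iu.
  by move=> k kr; rewrite -Fphi -h// mem_cat map_f ?orbT.
rewrite Qcyl; last first.
  rewrite cat_uniq uniq_used map_inj_uniq// ur andbT/=.
  apply/hasPn => _ /mapP[k kr ->]; apply/negP => /used_lt /=.
  by rewrite ltnNge leq_addr.
rewrite big_cat big_map/=; congr (_ * _)%:E; last by apply: eq_bigr => k _; rewrite Fphi.
rewrite /F big_seq; under eq_bigr => k -> do [].
rewrite -big_seq; elim: s {phi F phi_inj Fphi} => [|k s IHs] /=.
  by rewrite /hist_prob !big_nil.
rewrite /hist_prob !big_cons eqxx; congr (_ * _); rewrite -[RHS]IHs.
apply: eq_big_seq => i iu; case: eqP => // e.
by have := used_lt iu; rewrite e ltnn.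
Qed.

Lemma prob_compat s : Q [set w | compat w s] = (hist_prob s)%:E.
Proof.
have := prob_compat_drop s measurableT; rewrite probability_setT mule1 => <-.
by congr (Q _); apply/seteqP; split => w //= [].
Qed.

Section strategy.
Variable strat : history d -> option (Zd d).

(** The choice of the next site depends on the history alone, so the instruction revealed there is
    always a new one. *)
Fixpoint run w n s : history d :=
  if n is m.+1 then
    if strat s is Some x then run w m ((x, w (x, visits s x)) :: s) else run w m s
  else s.

Lemma dmeas_run n s : dmeas (fun w : stack d => run w n s).
Proof.
elim: n s => [|n IHn] s /=; first exact: dmeas_cst.
case: (strat s) => [x|] //.
apply: (@dmeas_dep _ _ _ _ (fun w : stack d => w (x, visits s x))
  (fun t w => run w n ((x, t) :: s))) => //; exact: dmeas_coord.
Qed.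

Lemma measurable_drop_run n s :
  measurable_fun setT (fun w : stack d => stack_drop w (visits (run w n s))).
Proof.
apply: measurable_to_stacks => k.
apply: (@dmeas_dep _ (stack d) (history d) (option ('I_d * bool))
    (fun w => run w n s) (fun s' w => stack_drop w (visits s') k)).
  exact: dmeas_run.
by move=> s'; exact: dmeas_coord.
Qed.

Lemma prob_split_coord (k : Zd d * nat) (A : set (stack d)) : measurable A ->
  Q A = (\sum_t Q (A `&` [set w | w k = t]))%E.
Proof.
move=> mA; rewrite -big_enum -measure_bigcup_seq.
- congr (Q _); apply/seteqP; split => w; last by case=> t _ [].
  by move=> Aw; exists (w k) => //=; rewrite mem_enum.
- exact: enum_uniq.
- by move=> t _; apply: measurableI => //; exact: (dmeas_coord k [set t]).
- by move=> t t' _ _ [w [[_ <-] [_ <-]]].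
Qed.

(** A strong Markov property: what a strategy leaves unread is again i.i.d. The induction splits on
    the next revealed instruction, whose weights sum to one. *)
Lemma law_drop_run n s (A : set (stack d)) : measurable A ->
  Q ([set w | compat w s] `&` [set w | A (stack_drop w (visits (run w n s)))]) =
  ((hist_prob s)%:E * Q A)%E.
Proof.
move=> mA; elim: n s => [|n IHn] s /=; first exact: prob_compat_drop.
have mAn m s' : measurable ([set w | compat w s'] `&`
    [set w | A (stack_drop w (visits (run w m s')))]).
  apply: measurableI; first exact: measurable_compat.
  exact: (measurable_preimage (measurable_drop_run m s')).
case E: (strat s) => [x|]; last exact: IHn.
rewrite (@prob_split_coord (x, visits s x)); last first.
  by have := mAn n.+1 s; rewrite /= E.
transitivity (\sum_t (q t * hist_prob s)%:E * Q A)%E.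
  apply: eq_bigr => t _.
  rewrite -[(q t * _)%R](_ : hist_prob ((x, t) :: s) = _); last by rewrite /hist_prob big_cons.
  rewrite -IHn; congr (Q _); apply/seteqP; split => w /=.
    by move=> [[-> Aw] <-]; rewrite eqxx.
  by move=> [/andP[/eqP <- ->] Aw].
rewrite -ge0_sume_distrl; last first.
  by move=> t _; rewrite lee_fin mulr_ge0// hist_prob_ge0.
by rewrite sumEFin -mulr_suml q_sum1 mul1r.
Qed.

End strategy.

Lemma law_drop_run0 strat n (A : set (stack d)) : measurable A ->
  Q [set w | A (stack_drop w (visits (run strat w n [::])))] = Q A.
Proof.
move=> mA; have := law_drop_run strat n [::] mA.
by rewrite /hist_prob big_nil mul1e => <-; congr (Q _); apply/seteqP; split => w // [].
Qed.

Lemma ae_often x t : 0 < q t ->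
  Q [set w | ~ forall m, exists j, (m <= j)%N /\ w (x, j) = t] = 0%E.
Proof.
move=> qt; pose E := [set w : stack d | forall j, w (x, j) <> t].
have mE : measurable E.
  rewrite (_ : E = \bigcap_(j in setT) [set w : stack d | w (x, j) <> t]).
    by apply: measurable_bigcap_count => j _; exact: (dmeas_coord _ [set~ t]).
  by apply/seteqP; split => w h j //; [move=> _; exact: h|exact: h].
have E0 : Q E = 0%E.
  (* Reading the first instruction at [x] gives [Q E = (1 - q t) * Q E], which forces [Q E = 0]. *)
  have QE : Q E = (\sum_(t' | t' != t) (q t')%:E * Q E)%E.
    rewrite {1}(@prob_split_coord (x, 0%N) E mE) (bigD1 t)//=.
    rewrite (_ : E `&` _ = set0) ?measure0 ?add0e; last first.
      by apply/seteqP; split => w // [/(_ 0%N)].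
    apply: eq_bigr => t' tt'.
    rewrite -[q t'](_ : hist_prob [:: (x, t')] = _); last by rewrite /hist_prob big_seq1.
    rewrite -prob_compat_drop//; congr (Q _); apply/seteqP; split => w /=.
      move=> [Ew wt']; rewrite wt' eqxx; split => // j.
      by rewrite /stack_drop /=; exact: Ew.
    rewrite andbT => -[/eqP wt' Ew]; split => //= -[|j].
      by rewrite wt' => e; move: tt'; rewrite e eqxx.
    by have := Ew j; rewrite /stack_drop/= eqxx.
  have fin : Q E \is a fin_num by rewrite fin_num_measure.
  move: QE; rewrite -(fineK fin) -ge0_sume_distrl; last by move=> *; rewrite lee_fin.
  rewrite sumEFin -EFinM => -[h].
  have : \sum_(t' | t' != t) q t' = 1 - q t.
    by have := q_sum1; rewrite (bigD1 t)//= => <-; rewrite addrAC subrr add0r.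
  move=> e; move: h; rewrite e => h; congr EFin; nra.
rewrite (_ : [set w | _] = \bigcup_(m in setT) [set w : stack d | E (fun k => w (k.1, m + k.2)%N)]).
  have mEm m : measurable [set w : stack d | E (fun k => w (k.1, m + k.2)%N)].
    pose ph (w : stack d) : stack d := fun k => w (k.1, m + k.2)%N.
    apply: (@measurable_preimage _ (stack d) _ (stack d) ph) mE.
    by apply: measurable_to_stacks => k; exact: dmeas_coord.
  apply: measure_bigcup_null => // m.
  pose phi (k : Zd d * nat) := (k.1, m + k.2)%N.
  pose psi (k : Zd d * nat) := (k.1, k.2 - m)%N.
  rewrite -E0 -(@law_reindex phi psi)// => -[y j]; by rewrite /phi/psi/= addKn.
apply/seteqP; split => w /=.
  move=> /existsNP[m /forallNP h]; exists m => // j wj; apply: (h (m + j)%N).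
  by rewrite leq_addr.
move=> [m _ h] /(_ m) [j [mj wj]]; apply: (h (j - m)%N).
by rewrite /= subnKC.
Qed.

End stack_laws.

(** * Configurations *)

Section configurations.
Context (d : nat).

Lemma dmeas_cfg (x : Zd d) : dmeas (fun eta : cfg d => eta x).
Proof.
move=> B.
(* [option nat] is a countable code for [occupation], so that the preimage of any set is a countable
   union of generators. *)
pose dec (o : option nat) := if o is Some n then Active n else Sleeping.
rewrite (_ : _ @^-1` B = \bigcup_(o in [set o | B (dec o)]) [set eta : cfg d | eta x = dec o]).
  by apply: measurable_bigcup_count => o _; apply: sub_sigma_algebra; exists x, (dec o).
apply/seteqP; split => eta /=; last by move=> [k Bk ->].
move=> Be; exists (if eta x is Active n then Some n else None).
  by move: Be => /=; case: (eta x).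
by rewrite /=; case: (eta x).
Qed.

Lemma dmeas_mass (x : Zd d) : dmeas (fun eta : cfg d => mass (eta x)).
Proof. exact: dmeas_comp (dmeas_cfg x). Qed.

Lemma measurable_to_cfg dX (X : measurableType dX) (phi : X -> cfg d) :
  (forall x, dmeas (fun o => phi o x)) -> measurable_fun setT phi.
Proof.
move=> mphi; apply: (@measurability _ _ _ _ setT phi (@cfg_gen d)) => //.
by move=> _ [_ [x [k ->]] <-]; rewrite setTI; exact: (mphi x [set k]).
Qed.

Lemma measurable_translate (x : Zd d) : measurable_fun setT (translate x : cfg d -> cfg d).
Proof. by apply: measurable_to_cfg => y; exact: dmeas_cfg. Qed.

Definition masses (eta : cfg d) : Zd d -> nat := fun x => mass (eta x).

End configurations.

Definition instr_prob (R : realType) d (p : Zd d -> R) (lam : R)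
    (t : option ('I_d * bool)) : R :=
  if t is Some e then p (dir e) / (1 + lam) else lam / (1 + lam).

Lemma dir_inj d : injective (@dir d).
Proof.
have dE (e : 'I_d * bool) (j : 'I_d) : dir e ord0 j = (if e.2 then 1 else -1) *+ (j == e.1) :> int.
  by rewrite /dir; case: e.2; rewrite !mxE eqxx/=; case: (j == e.1); rewrite ?mulr1n ?mulr0n ?oppr0.
move=> e f ef; have := congr1 (fun z : Zd d => z ord0 e.1) ef; rewrite !dE eqxx.
case: eqP => [e1|_]; last by case: e.2.
by move: e f e1 {ef} => [i b] [j b'] /= -> ; case: b; case: b'.
Qed.

Section instructions.
Context (R : realType) (d : nat) (p : Zd d -> R) (lam : R).
Hypotheses (hp : jump_distribution p) (lam_gt0 : 0 < lam).
Local Notation q := (instr_prob p lam).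

Lemma lam1_gt0 : 0 < 1 + lam. Proof. exact: addr_gt0. Qed.

Lemma instr_prob_ge0 t : 0 <= q t.
Proof.
case: t => [e|] /=; apply: divr_ge0; rewrite ?(ltW lam_gt0) ?(ltW lam1_gt0)//.
exact: jump_ge0.
Qed.

Lemma sum_dir (f : Zd d -> R) : (forall z, p z = 0 -> f z = 0) ->
  \sum_(z \in [set: Zd d]) f z = \sum_e f (dir e).
Proof.
move=> f0; rewrite (fsbigE (map (@dir d) (index_enum _)))//.
- by rewrite big_map; apply: eq_bigl => e; exact: mem_set.
- by rewrite map_inj_uniq ?index_enum_uniq//; exact: dir_inj.
- move=> z _ zn; apply: f0; apply/eqP/negPn/negP => pz; move/negP: zn; apply.
  have [i [->|->]] := jump_nn hp pz; apply/mapP.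
    by exists (i, true); rewrite ?mem_index_enum.
  by exists (i, false); rewrite ?mem_index_enum.
Qed.

Lemma sum_p_dir : \sum_e p (dir e) = 1.
Proof. by rewrite -(jump_sum1 hp) (@sum_dir p). Qed.

Lemma big_option (T : finType) (f : option T -> R) : \sum_t f t = f None + \sum_e f (Some e).
Proof.
rewrite (bigD1 None)//=; congr (_ + _).
rewrite (reindex_omap Some id)/=; last by case.
by apply: eq_bigl => e; rewrite eqxx.
Qed.

Lemma instr_prob_sum1 : \sum_t q t = 1.
Proof.
rewrite big_option/= -mulr_suml sum_p_dir -mulrDl.
by have := lam1_gt0 => h; field; lra.
Qed.

Lemma jump_dirs (H : {pred Zd d}) : zmod_closed H ->
  (forall e, 0 < q (Some e) -> dir e \in H) -> forall z, z \in H.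
Proof.
move=> zH He; apply: (jump_generates hp zH) => z pz.
have pos e : p (dir e) != 0 -> 0 < q (Some e).
  move=> pe; rewrite lt_neqAle instr_prob_ge0 andbT eq_sym mulf_neq0//.
  by rewrite invr_eq0; have := lam1_gt0; lra.
have [i [e|e]] := jump_nn hp pz.
  by rewrite e; apply: (He (i, true)); apply: pos; rewrite /dir/= -e.
by rewrite e; apply: (He (i, false)); apply: pos; rewrite /dir/= -e.
Qed.

Lemma exists_dir : exists e, 0 < q (Some e).
Proof.
apply: contrapT => /forallNP h.
have : \sum_t q t = q None.
  rewrite big_option big1 ?addr0// => e _.
  by have := h e; have := instr_prob_ge0 (Some e); lra.
rewrite instr_prob_sum1/= => /eqP; rewrite eq_sym; apply/negP.
by rewrite lt_eqF// ltr_pdivrMr ?lam1_gt0//; lra.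
Qed.

End instructions.

(** * Almost invariant events and consequences of ergodicity *)

Section invariant_core.
Context (R : realType) (d : nat) (p : Zd d -> R) (lam : R).
Hypotheses (hp : jump_distribution p) (lam_gt0 : 0 < lam).
Context dT (X : measurableType dT) (P : probability X R) (T : Zd d -> X -> X).
Hypothesis mT : forall x, measurable_fun setT (T x).
Hypothesis T0 : forall o, T 0 o = o.
Hypothesis TD : forall x y o, T x (T y o) = T (x + y) o.
Hypothesis PT : forall x A, measurable A -> P (T x @^-1` A) = P A.

Let mpre x A : measurable A -> measurable (T x @^-1` A).
Proof. exact: measurable_preimage. Qed.

Lemma null_diffC (A B : set X) : measurable A -> measurable B -> P A = P B ->
  P (A `\` B) = 0%E -> P (B `\` A) = 0%E.
Proof.
move=> mA mB AB; have fin C : measurable C -> (P C < +oo)%E.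
  by move=> mC; exact: le_lt_trans (probability_le1 P mC) (ltry 1).
rewrite !measureD ?fin//= setIC AB => h.
exact: h.
Qed.

(** The sites [x] for which [A] is almost contained in its preimage under [T x] form a subgroup:
    they are closed under opposites because an almost inclusion between events of equal probability
    is an almost equality. The jump directions generate everything. *)
Lemma spread_all A : measurable A ->
  (forall e, 0 < instr_prob p lam (Some e) -> P (A `\` T (dir e) @^-1` A) = 0%E) ->
  forall x, P (A `\` T x @^-1` A) = 0%E.
Proof.
move=> mA He x.
pose H : {pred Zd d} := fun x => `[< P (A `\` T x @^-1` A) = 0%E >].
suff : x \in H by move=> /asboolP.
have mD y : measurable (A `\` T y @^-1` A) by apply: measurableD => //; exact: mpre.
apply: (jump_dirs hp lam_gt0); last by move=> e qe; apply/asboolP/He.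
have Hopp y : y \in H -> - y \in H.
  move=> /asboolP h; apply/asboolP.
  have h' := null_diffC mA (mpre y mA) (esym (PT y mA)) h.
  have mD' : measurable (T y @^-1` A `\` A) by apply: measurableD => //; exact: mpre.
  rewrite -(PT (- y) mD') in h'; rewrite -[RHS]h'; congr (P _).
  by apply/seteqP; split => o /=; rewrite TD addrN T0.
split; first by apply/asboolP; rewrite (_ : _ `\` _ = set0) ?measure0//;
  apply/seteqP; split => o //= -[Ao]; rewrite T0.
move=> y z /asboolP hy /Hopp /asboolP hz; apply/asboolP.
have U0 : P ((A `\` T (- z) @^-1` A) `|` T (- z) @^-1` (A `\` T y @^-1` A)) = 0%E.
  have pz : P (T (- z) @^-1` (A `\` T y @^-1` A)) = 0%E.
    by rewrite -[RHS]hy; apply: PT; exact: mD.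
  by rewrite measureU0 ?hz//; apply: mpre; exact: mD.
apply: (subset_measure0 _ _ _ U0); first exact: mD.
  by apply: measurableU; [exact: mD|exact/mpre/mD].
move=> u [Au nAu]; have [h|h] := pselect (A (T (- z) u)); last by left.
by right; split => //=; rewrite TD.
Qed.

Lemma invariant_coreE A : measurable A ->
  (forall x, P (A `\` T x @^-1` A) = 0%E) ->
  P (A `\` \bigcap_x T x @^-1` A) = 0%E.
Proof.
move=> mA h; rewrite setDE setC_bigcap setI_bigcupr.
by apply: measure_bigcup_null => // x; apply: measurableD => //; exact: mpre.
Qed.

End invariant_core.

Section ergodicity.
Context (R : realType) (d : nat) (p : Zd d -> R) (lam : R).
Hypotheses (hp : jump_distribution p) (lam_gt0 : 0 < lam).
Context (nu : probability (cfg d) R).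
Hypothesis nuE : translation_ergodic nu.

Lemma translate0 (eta : cfg d) : translate 0 eta = eta.
Proof. by apply/funext => z; rewrite /translate addr0. Qed.

Lemma translateD (x y : Zd d) (eta : cfg d) :
  translate x (translate y eta) = translate (x + y) eta.
Proof. by apply/funext => z; rewrite /translate addrA. Qed.

(** Ergodicity speaks of exactly invariant events. A one-sided inclusion along the jump directions
    is, by preservation of probability, an almost equality, and [A] may be replaced by its invariant
    core [C]. *)
Lemma ergodic01 (A : set (cfg d)) : measurable A ->
  (forall e, 0 < instr_prob p lam (Some e) -> translate (dir e) @^-1` A `<=` A) ->
  nu A = 0%E \/ nu A = 1%E.
Proof.
move=> mA sub; have [inv erg] := nuE.
pose C := \bigcap_x (translate x @^-1` A).
have mpre x B : measurable B -> measurable (translate x @^-1` B : set (cfg d)).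
  exact: measurable_preimage (measurable_translate x).
have mC : measurable C by apply: measurable_bigcap_count => x _; exact: mpre.
have CA : C `<=` A by move=> eta /(_ 0 I); rewrite /= translate0.
have D0 : nu (A `\` C) = 0%E.
  apply: (invariant_coreE (P := nu) (fun x => measurable_translate x)) => //.
  apply: (spread_all hp lam_gt0 (fun x => measurable_translate x)) => //.
  - exact: translate0.
  - exact: translateD.
  move=> e qe; apply: (null_diffC (P := nu)) => //; [exact: mpre|exact: inv|].
  by rewrite (_ : _ `\` _ = set0) ?measure0//; apply/seteqP; split => o //= -[/(sub e qe)].
have -> : nu A = nu C.
  rewrite -(setUIDK A C) measureU0//; [|exact: measurableI|exact: measurableD].
  by rewrite (setIidr CA).
apply: erg => // x; apply/seteqP; split => eta h y _ /=.
  by have := h (y - x) I; rewrite /= translateD subrK.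
by rewrite translateD; exact: h.
Qed.

(** Each sublevel set of [G] has probability zero or one by [ergodic01]; the constant is the infimum
    of the levels of probability one. *)
Lemma ergodic_const (G : cfg d -> \bar R) : measurable_fun setT G ->
  (forall eta, (0 <= G eta <= 1)%E) ->
  (forall e eta, 0 < instr_prob p lam (Some e) -> (G eta <= G (translate (dir e) eta))%E) ->
  exists c : R, [/\ 0 <= c <= 1 & nu [set eta | G eta <> c%:E] = 0%E].
Proof.
move=> mG G01 Ge.
pose S (r : R) := [set eta | (G eta <= r%:E)%E].
have mS r : measurable (S r).
  by rewrite -[S r]setTI; apply: emeasurable_fun_infty_c.
have S01 r : nu (S r) = 0%E \/ nu (S r) = 1%E.
  apply: ergodic01 => // e qe eta /= /(le_trans _); apply; exact: Ge.
have Smono r s : r <= s -> S r `<=` S s.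
  by move=> rs eta /= /le_trans; apply; rewrite lee_fin.
pose I := [set r : R | nu (S r) = 1%E].
have S1 : nu (S 1) = 1%E.
  rewrite (_ : S 1 = setT) ?probability_setT//; apply/seteqP; split => // eta _ /=.
  by have /andP[] := G01 eta.
have I0 r : I r -> 0 <= r.
  move=> Ir; rewrite leNgt; apply/negP => r0; move: Ir; rewrite /I/=.
  rewrite (_ : S r = set0) ?measure0; first by move=> /eqP; rewrite eq_sym onee_eq0.
  apply/seteqP; split => // eta /= h; have /andP[h0 _] := G01 eta.
  by have := le_trans h0 h; rewrite lee_fin leNgt r0.
have hI : has_inf I by split; [exists 1|exists 0 => r /I0].
pose c := inf I.
exists c; split.
  apply/andP; split; first by apply: lb_le_inf; [exists 1|move=> r /I0].
  by apply: ge_inf => //; exists 0 => r /I0.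
have -> : [set eta | G eta <> c%:E] =
   \bigcup_(k : rat) (if ratr k < c then S (ratr k) else if c < ratr k then ~` S (ratr k) else set0).
  apply/seteqP; split => eta /=.
  - have /andP[g0 g1] := G01 eta.
    have gfin : G eta \is a fin_num by rewrite ge0_fin_numE// (le_lt_trans g1)// ltry.
    rewrite -(fineK gfin) => /eqP; rewrite eqe neq_lt => /orP[] h.
      have [k] := rat_in_itvoo h; rewrite in_itv/= => /andP[k1 k2].
      exists k => //; rewrite k2 /S/= -(fineK gfin) lee_fin; exact: ltW.
    have [k] := rat_in_itvoo h; rewrite in_itv/= => /andP[k1 k2].
    exists k => //; rewrite ltNge (ltW k1)/= k1 /S/= -(fineK gfin) lee_fin.
    by apply/negP; rewrite -ltNge.
  - move=> [k _]; case: ifPn => [kc Sk e|_]; first by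
      move: Sk; rewrite /S/= e lee_fin leNgt kc.
    case: ifPn => // ck Sk e; apply: Sk; rewrite /S/= e lee_fin; exact: ltW.
apply: measure_bigcup_null => k.
  by case: ifPn => // _; case: ifPn => // _; exact: measurableC.
case: ifPn => [kc|_].
  have [//|S1k] := S01 (ratr k).
  have : c <= ratr k by apply: ge_inf => //; exists 0 => r /I0.
  by rewrite leNgt kc.
case: ifPn => [ck|_]; last by rewrite measure0.
have k0 : 0 < ratr k - c by rewrite subr_gt0.
have [r Ir] := inf_adherent k0 hI; rewrite addrC subrK => rk.
have : nu (S (ratr k)) = 1%E.
  apply/eqP; rewrite eq_le probability_le1//= -Ir.
  by apply: le_measure; rewrite ?inE//; apply: Smono; exact: ltW.
by move=> e; have := probability_setC nu (mS (ratr k)); rewrite e subee.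
Qed.

End ergodicity.

(** * Zero-one law for explosion *)

(** Real valued, so that linear arithmetic applies. *)
Definition prob d (X : measurableType d) (R : realType) (P : probability X R) (A : set X) : R :=
  fine (P A).

Section real_probability.
Context d (X : measurableType d) (R : realType) (P : probability X R).
Implicit Types A B : set X.

Lemma probE A : measurable A -> P A = (prob P A)%:E.
Proof. by move=> mA; rewrite /prob fineK// fin_num_measure. Qed.

Lemma prob_ge0 A : 0 <= prob P A. Proof. exact: fine_ge0. Qed.

Lemma prob_le1 A : measurable A -> prob P A <= 1.
Proof. by move=> mA; rewrite -lee_fin -probE// probability_le1. Qed.

Lemma probT : prob P setT = 1. Proof. by rewrite /prob probability_setT. Qed.

Lemma prob0 : prob P set0 = 0. Proof. by rewrite /prob measure0. Qed.

Lemma prob_sub A B : measurable A -> measurable B -> A `<=` B -> prob P A <= prob P B.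
Proof. by move=> mA mB AB; rewrite -lee_fin -!probE// le_measure ?inE. Qed.

Lemma prob_U A B : measurable A -> measurable B -> prob P (A `|` B) <= prob P A + prob P B.
Proof.
move=> mA mB; rewrite -lee_fin EFinD -!probE//; last exact: measurableU.
exact: measureU2.
Qed.

Lemma prob_setC A : measurable A -> prob P (~` A) = 1 - prob P A.
Proof.
move=> mA; apply: EFin_inj; rewrite EFinB -!probE//; last exact: measurableC.
exact: probability_setC.
Qed.

Lemma prob_setD A B : measurable A -> measurable B -> B `<=` A ->
  prob P (A `\` B) = prob P A - prob P B.
Proof.
move=> mA mB BA; apply: EFin_inj; rewrite EFinB -!probE//; last exact: measurableD.
rewrite measureD//; first by rewrite (setIidr BA).
exact: le_lt_trans (probability_le1 P mA) (ltry 1).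
Qed.

Lemma prob_nondecreasing (F : nat -> set X) (r : R) : (forall n, measurable (F n)) ->
  (forall n m, (n <= m)%N -> F n `<=` F m) ->
  r < prob P (\bigcup_n F n) -> exists n, r < prob P (F n).
Proof.
move=> mF ndF h; apply: contrapT => /forallNP no.
have mU : measurable (\bigcup_n F n) by exact: bigcupT_measurable.
have cv : P (F n) @[n --> \oo] --> P (\bigcup_n F n).
  by apply: nondecreasing_cvg_mu => // n m nm; apply/subsetPset; exact: ndF.
have : (P (\bigcup_n F n) <= r%:E)%E.
  rewrite -(cvg_lim _ cv)//; apply: lime_le; first by apply/cvg_ex; exists (P (\bigcup_n F n)).
  by apply: nearW => n; rewrite probE// lee_fin leNgt; apply/negP/no.
by rewrite probE// lee_fin leNgt h.
Qed.

Lemma prob_nonincreasing (F : nat -> set X) (r : R) : (forall n, measurable (F n)) ->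
  (forall n m, (n <= m)%N -> F m `<=` F n) ->
  prob P (\bigcap_n F n) < r -> exists n, prob P (F n) < r.
Proof.
move=> mF niF h.
have mC n : measurable (~` F n) by exact: measurableC.
have [] := @prob_nondecreasing (fun n => ~` F n) (1 - r) mC.
- by move=> n m nm; apply: subsetC; exact: niF.
- rewrite -setC_bigcap prob_setC; last exact: bigcapT_measurable.
  by rewrite ltrD2l ltrN2.
- by move=> n; rewrite prob_setC// ltrD2l ltrN2 => nr; exists n.
Qed.

(** On [D] the events [B n] eventually agree with [A]; their lower and upper limits bound [A] from
    both sides. This carries identities from finite stages of a strategy to its limit. *)
Lemma prob_constant_limit (B : nat -> set X) (A D : set X) (c : R) :
  measurable A -> measurable D -> P D = 1%E -> (forall n, measurable (B n)) ->
  (forall n, prob P (B n) = c) ->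
  (forall u, D u -> exists N, forall n, (N <= n)%N -> (B n u <-> A u)) ->
  prob P A = c.
Proof.
move=> mA mD D1 mB Bc conv.
have pD0 : prob P (~` D) = 0 by rewrite prob_setC// /prob D1 subrr.
have mCD : measurable (~` D) by exact: measurableC.
apply/eqP; rewrite eq_le; apply/andP; split; rewrite leNgt; apply/negP => lt.
- pose F N := \bigcap_(n in [set n | (N <= n)%N]) B n.
  have mF N : measurable (F N) by exact: measurable_bigcap_count.
  have [] := @prob_nondecreasing F c mF.
  + by move=> n m nm u Fu k /= mk; apply: Fu => /=; exact: leq_trans mk.
  + have mU : measurable (\bigcup_n F n) by exact: bigcupT_measurable.
    apply: (lt_le_trans lt); apply: (@le_trans _ _ (prob P ((\bigcup_n F n) `|` ~` D))).
      apply: prob_sub => //; first exact: measurableU.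
      move=> u Au; have [Du|] := pselect (D u); last by right.
      by left; have [N HN] := conv u Du; exists N => // n /= Nn; apply/HN.
    by rewrite (le_trans (prob_U _ _))// pD0 addr0.
  + move=> N; apply/negP; rewrite -leNgt -(Bc N); apply: prob_sub => // u; apply => /=.
    exact: leqnn.
- pose F N := \bigcup_(n in [set n | (N <= n)%N]) B n.
  have mF N : measurable (F N) by exact: measurable_bigcup_count.
  have [] := @prob_nonincreasing F c mF.
  + by move=> n m nm u [k /= mk Bk]; exists k => //=; exact: leq_trans mk.
  + have mI : measurable (\bigcap_n F n) by exact: bigcapT_measurable.
    apply: le_lt_trans lt; apply: (@le_trans _ _ (prob P (A `|` ~` D))).
      apply: prob_sub => //; first exact: measurableU.
      move=> u Fu; have [Du|] := pselect (D u); last by right.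
      left; have [N HN] := conv u Du; have [n /= Nn Bn] := Fu N I.
      exact/(HN n Nn).
    by rewrite (le_trans (prob_U _ _))// pD0 addr0.
  + move=> N; apply/negP; rewrite -leNgt -(Bc N); apply: prob_sub => // u Bu.
    by exists N => /=.
Qed.

End real_probability.

Lemma far_slab (a b : int) (n : nat) :
  `|a - b| <= n%:Z -> `|a| <= n%:Z -> `|b| = (n.*2.+1)%:Z -> False.
Proof.
move=> h1 h2 h3; have := ler_normB a (a - b).
rewrite opprB addrCA subrr addr0 h3 => /le_trans/(_ (lerD h2 h1)).
by rewrite -PoszD lez_nat -addnn ltnn.
Qed.

(** Parallel toppling propagates by one site per step. Following a single coordinate [i] is enough
    to obtain disjoint regions. *)
Lemma parallel_slab d (rule : Zd d -> nat -> bool -> bool) (i : 'I_d) xi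
    (w w' : stack d) n (x : Zd d) :
  (forall (z : Zd d) j, `|z ord0 i - x ord0 i| <= n%:Z -> w (z, j) = w' (z, j)) ->
  parallel rule xi w n x = parallel rule xi w' n x.
Proof.
have dir1 (e : 'I_d * bool) : `|dir e ord0 i| <= 1 :> int.
  by rewrite /dir; case: e => j [] /=; rewrite !mxE eqxx/=; case: (i == j).
elim: n x => [//|n IHn] x ag /=.
have agx : forall y : Zd d, `|y ord0 i - x ord0 i| <= 1 ->
    parallel rule xi w n y = parallel rule xi w' n y.
  move=> y yx; apply: IHn => z j zy; apply: ag.
  rewrite (_ : z ord0 i - _ = (z ord0 i - y ord0 i) + (y ord0 i - x ord0 i)); last by lia.
  by rewrite (le_trans (ler_normD _ _))//; lia.
have agw : forall y : Zd d, `|y ord0 i - x ord0 i| <= 1 -> forall j, w (y, j) = w' (y, j).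
  by move=> y yx j; apply: ag; rewrite (le_trans yx)//; lia.
have xx : `|x ord0 i - x ord0 i| <= 1 :> int by rewrite subrr normr0.
have fl (y : Zd d) e : `|y ord0 i - x ord0 i| <= 1 ->
    flow w (parallel rule xi w n) y e = flow w' (parallel rule xi w' n) y e.
  move=> yx; rewrite /flow agx//; apply: eq_count => j; by rewrite agw.
rewrite (agx x xx); congr (_ + nat_of_bool _)%N; rewrite /unstable; congr (rule _ _ _).
  rewrite /load; congr (_ + _ - _)%N; apply: eq_bigr => e _; apply: fl => //.
  by rewrite !mxE addrAC subrr add0r normrN.
by rewrite /asleep agx//; case: (parallel _ _ _ _ _) => // j; rewrite agw.
Qed.

Lemma arw_rule_big d (x : Zd d) N b : (2 <= N)%N -> arw_rule x N b.
Proof. by rewrite /arw_rule => ->. Qed.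

Section explosion_probability.
Context (R : realType) (d : nat) (p : Zd d -> R) (lam : R).
Hypotheses (hp : jump_distribution p) (lam_gt0 : 0 < lam).
Local Notation q := (instr_prob p lam).
Variable Q : probability (stack d) R.
Hypothesis Qcyl : forall s f, uniq s -> Q (cyl s f) = (\prod_(k <- s) q (f k))%:E.

Let q_ge0 := instr_prob_ge0 hp lam_gt0.
Let q_sum1 := instr_prob_sum1 hp lam_gt0.

Lemma measurable_explodes_stack (rule : Zd d -> nat -> bool -> bool) xi x :
  measurable [set w : stack d | explodes rule xi w x].
Proof.
apply: (@measurable_explodes _ (stack d) d (fun=> rule) (fun=> xi) id) => *;
  [exact: dmeas_cst|exact: dmeas_cst|exact: dmeas_coord].
Qed.

Lemma explodes_spread_ae (rule : Zd d -> nat -> bool -> bool) xi x e c :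
  (forall N b, (c <= N)%N -> rule (x + dir e) N b) -> 0 < q (Some e) ->
  Q ([set w | explodes rule xi w x] `\` [set w | explodes rule xi w (x + dir e)]) = 0%E.
Proof.
move=> hc qe.
pose N := [set w : stack d | ~ forall m, exists j, (m <= j)%N /\ w (x, j) = Some e].
have mN : measurable N.
  rewrite (_ : N = ~` \bigcap_m \bigcup_(j in [set j | (m <= j)%N]) [set w : stack d | w (x, j) = Some e]).
    apply: measurableC; apply: measurable_bigcap_count => m _.
    by apply: measurable_bigcup_count => j _; exact: (dmeas_coord (x, j) [set Some e]).
  apply/seteqP; split => w /= h; apply: contra_not h => h m.
    by have [j mj wj] := h m I; exists j.
  by move=> _; have [j [mj wj]] := h m; exists j.
apply: (subset_measure0 _ mN) => //.
- by apply: measurableD; exact: measurable_explodes_stack.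
- move=> w [ex nex] often; apply: nex; exact: (explodes_spread hc often ex).
exact: (ae_often q_ge0 q_sum1 Qcyl x qe).
Qed.

Definition arw_explodes (eta : cfg d) (x : Zd d) : set (stack d) :=
  [set w | explodes (@arw_rule d) (masses eta) w x].

Lemma measurable_arw_explodes eta x : measurable (arw_explodes eta x).
Proof. exact: measurable_explodes_stack. Qed.

Definition explosion_prob (eta : cfg d) : \bar R := Q (arw_explodes eta 0).

Lemma arw_parallel_translate y (eta : cfg d) w n :
  parallel (@arw_rule d) (masses (translate y eta)) (stack_shift y w) n 0 =
  parallel (@arw_rule d) (masses eta) w n y.
Proof. by rewrite -[in RHS](add0r y) -(@parallel_shift _ _ (@arw_rule d)). Qed.

Lemma explosion_prob_translate y eta :
  explosion_prob (translate y eta) = Q (arw_explodes eta y).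
Proof.
rewrite /explosion_prob -(law_shift Qcyl y); last exact: measurable_arw_explodes.
congr (Q _); apply/seteqP; split => w /= h k; have [n hn] := h k; exists n.
  by rewrite -arw_parallel_translate.
by rewrite arw_parallel_translate.
Qed.

(** Explosion at the origin almost surely spreads to the neighbour; this one-sided monotonicity is
    what [ergodic_const] asks for. *)
Lemma explosion_prob_dir e eta : 0 < q (Some e) ->
  (explosion_prob eta <= explosion_prob (translate (dir e) eta))%E.
Proof.
move=> qe; rewrite explosion_prob_translate /explosion_prob.
have mE x := measurable_arw_explodes eta x.
rewrite -(setUIDK (arw_explodes eta 0) (arw_explodes eta (dir e))) measureU0.
- by apply: le_measure; rewrite ?inE//; exact: measurableI.
- exact: measurableI.
- exact: measurableD.
have := @explodes_spread_ae (@arw_rule d) (masses eta) 0 e 2.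
by rewrite add0r; apply => // *; exact: arw_rule_big.
Qed.

Lemma arw_explodes_far e eta m : 0 < q (Some e) ->
  Q (arw_explodes eta 0 `\` arw_explodes eta (dir e *+ m)) = 0%E.
Proof.
move=> qe; have mE x := measurable_arw_explodes eta x.
elim: m => [|m IHm].
  by rewrite mulr0n setDv measure0.
have h : Q (arw_explodes eta (dir e *+ m) `\` arw_explodes eta (dir e *+ m.+1)) = 0%E.
  rewrite mulrSr; apply: (@explodes_spread_ae _ _ _ _ 2) => // *.
  exact: arw_rule_big.
have U0 : Q ((arw_explodes eta 0 `\` arw_explodes eta (dir e *+ m)) `|`
   (arw_explodes eta (dir e *+ m) `\` arw_explodes eta (dir e *+ m.+1))) = 0%E.
  by rewrite measureU0//; exact: measurableD.
apply: (subset_measure0 _ _ _ U0); first exact: measurableD.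
  by apply: measurableU; exact: measurableD.
move=> w [w0 nw]; have [wm|nwm] := pselect (arw_explodes eta (dir e *+ m) w).
  by right.
by left.
Qed.

Definition reaches k n x : set (cfg d * stack d) :=
  [set ow | (k <= parallel (@arw_rule d) (masses ow.1) ow.2 n x)%N].

Lemma dmeas_arw_parallel n x :
  dmeas (fun ow : cfg d * stack d => parallel (@arw_rule d) (masses ow.1) ow.2 n x).
Proof.
apply: (@dmeas_parallel _ _ d (fun=> @arw_rule d) (fun ow => masses ow.1) snd).
- by move=> *; exact: dmeas_cst.
- by move=> y; exact: (dmeas_measurable_comp measurable_fst (dmeas_mass y)).
- by move=> k; exact: (dmeas_measurable_comp measurable_snd (dmeas_coord k)).
Qed.

Lemma measurable_reaches k n x : measurable (reaches k n x).
Proof. exact: (dmeas_set (fun m => (k <= m)%N) (dmeas_arw_parallel n x)). Qed.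

Lemma measurable_section (B : set (cfg d * stack d)) : measurable B ->
  measurable_fun setT (fun eta => Q [set w | B (eta, w)]).
Proof.
move=> mB; have := measurable_fun_xsection Q mB.
congr (measurable_fun _ _); apply/funext => eta /=; congr (Q _).
by apply/seteqP; split => w /=; rewrite /xsection/= ?inE.
Qed.

Lemma measurable_sectionE (B : set (cfg d * stack d)) eta : measurable B ->
  measurable [set w | B (eta, w)].
Proof.
move=> mB; have := measurable_xsection eta mB; congr measurable.
by apply/seteqP; split => w /=; rewrite /xsection/= ?inE.
Qed.

Lemma measurable_explodes_joint x :
  measurable [set ow : cfg d * stack d | arw_explodes ow.1 x ow.2].
Proof.
apply: (@measurable_explodes _ _ d (fun=> @arw_rule d) (fun ow => masses ow.1) snd).
- by move=> *; exact: dmeas_cst.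
- by move=> y; exact: (dmeas_measurable_comp measurable_fst (dmeas_mass y)).
- by move=> k; exact: (dmeas_measurable_comp measurable_snd (dmeas_coord k)).
Qed.

Lemma measurable_explosion_prob : measurable_fun setT explosion_prob.
Proof. exact: (measurable_section (measurable_explodes_joint 0)). Qed.

(** In [n] steps the two events read instructions in slabs of half-width [n] whose centres are
    [2 * n + 1] apart, hence disjoint. *)
Lemma reaches_indep k n e eta : let y := dir e *+ n.*2.+1 in
  Q ([set w | reaches k n 0 (eta, w)] `&` [set w | reaches k n y (eta, w)]) =
  (Q [set w | reaches k n 0 (eta, w)] * Q [set w | reaches k n y (eta, w)])%E.
Proof.
move=> y; have mr x := measurable_sectionE eta (measurable_reaches k n x).
pose S (k : Zd d * nat) := `|k.1 ord0 e.1| <= n%:Z.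
rewrite -(law_mix Qcyl S); last exact: measurableI.
rewrite -product_measure1E//; congr ((_ \x _)%E _).
have diry : `|y ord0 e.1| = (n.*2.+1)%:Z.
  rewrite /y; have -> : (dir e *+ n.*2.+1) ord0 e.1 = (dir e ord0 e.1) *+ n.*2.+1.
    by elim: (n.*2.+1) => [|m IHm]; rewrite ?mulr0n ?mxE// !mulrSr mxE IHm.
  rewrite normrMn (_ : `|dir e ord0 e.1| = 1) ?natz//.
  by rewrite /dir; case: e.2; rewrite !mxE !eqxx.
apply/seteqP; split => -[w w'] /=; rewrite /reaches/=.
  move=> [h0 hy]; split; [move: h0|move: hy].
    rewrite (@parallel_slab _ _ e.1 _ _ w)// => z j; rewrite /mix /S/= !mxE subr0.
    by move=> ->.
  rewrite (@parallel_slab _ _ e.1 _ _ w')// => z j zy; rewrite /mix /S/=.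
  by case: ifPn => // zn; exfalso; exact: far_slab zy zn diry.
move=> [h0 hy]; split; [move: h0|move: hy].
  rewrite (@parallel_slab _ _ e.1 _ w (mix S w w'))// => z j; rewrite /mix /S/= !mxE subr0.
  by move=> ->.
rewrite (@parallel_slab _ _ e.1 _ w' (mix S w w'))// => z j zy; rewrite /mix /S/=.
by case: ifPn => // zn; exfalso; exact: far_slab zy zn diry.
Qed.

(** Explosion at [0] entails explosion at [y]. Both lie, up to probability [delta] each, in
    independent finite-time events of probability at most [c + delta]. *)
Lemma explosion_bound (c delta : R) k n e eta : 0 < q (Some e) -> 0 <= delta ->
  let y := dir e *+ n.*2.+1 in
  (forall z, explosion_prob (translate z eta) = c%:E) ->
  (forall z, z = 0 \/ z = y ->
    prob Q (\bigcup_m [set w | reaches k m z (eta, w)]) <= c + delta /\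
    prob Q (\bigcup_m [set w | reaches k m z (eta, w)]) <=
       prob Q [set w | reaches k n z (eta, w)] + delta) ->
  c <= (c + delta) ^+ 2 + 2 * delta.
Proof.
move=> qe d0 y cE H.
have mr m x := measurable_sectionE eta (measurable_reaches k m x).
have mE x := measurable_arw_explodes eta x.
pose A x := \bigcup_m [set w | reaches k m x (eta, w)].
have mA x : measurable (A x) by exact: bigcupT_measurable.
pose B x := [set w | reaches k n x (eta, w)].
have BA x : B x `<=` A x by move=> w Bw; exists n.
have EA x : arw_explodes eta x `<=` A x by move=> w /(_ k)[m km]; exists m.
have mD x : measurable (A x `\` B x) by apply: measurableD => //; exact: mr.
have mEE : measurable (arw_explodes eta 0 `\` arw_explodes eta y) by exact: measurableD.
have mBB : measurable (B 0 `&` B y) by apply: measurableI; exact: mr.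
have cQ : prob Q (arw_explodes eta 0) = c.
  by rewrite /prob -explosion_prob_translate cE.
have PBB : prob Q (B 0 `&` B y) = prob Q (B 0) * prob Q (B y).
  by rewrite /prob reaches_indep fineM// ?fin_num_measure//; exact: mr.
have [h1 h2] := H 0 (or_introl erefl); have [h3 h4] := H y (or_intror erefl).
have DA x : prob Q (A x `\` B x) = prob Q (A x) - prob Q (B x).
  by apply: prob_setD => //; exact: mr.
have D0 : prob Q (A 0 `\` B 0) <= delta by rewrite DA /A /B; lra.
have Dy : prob Q (A y `\` B y) <= delta by rewrite DA /A /B; lra.
have b0 : prob Q (B 0) <= c + delta.
  by apply: (le_trans _ h1); apply: prob_sub (BA 0) => //; exact: mr.
have by_ : prob Q (B y) <= c + delta.
  by apply: (le_trans _ h3); apply: prob_sub (BA y) => //; exact: mr.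
have far : prob Q (arw_explodes eta 0 `\` arw_explodes eta y) = 0.
  by rewrite /prob arw_explodes_far.
have : c <= prob Q (B 0 `&` B y) + (0 + (prob Q (A 0 `\` B 0) + prob Q (A y `\` B y))).
  rewrite -cQ -far.
  have mU1 := measurableU _ _ (mD 0) (mD y).
  have mU2 := measurableU _ _ mEE mU1.
  have mU3 := measurableU _ _ mBB mU2.
  apply: (@le_trans _ _ (prob Q ((B 0 `&` B y) `|` ((arw_explodes eta 0 `\` arw_explodes eta y) `|`
     ((A 0 `\` B 0) `|` (A y `\` B y)))))).
    apply: prob_sub => // w w0; have [wy|] := pselect (arw_explodes eta y w); last by right; left.
    have [B0|] := pselect (B 0 w); last by right; right; left; split => //; exact: EA.
    have [By|] := pselect (B y w); last by right; right; right; split => //; exact: EA.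
    by left.
  apply: (le_trans (prob_U _ mBB mU2)); rewrite lerD2l.
  by apply: (le_trans (prob_U _ mEE mU1)); rewrite lerD2l prob_U.
have := prob_ge0 Q (B 0); have := prob_ge0 Q (B y); nra.
Qed.

Theorem explosion01 (nu : probability (cfg d) R) : translation_ergodic nu ->
  nu [set eta | explosion_prob eta <> 0%E] = 0%E \/
  nu [set eta | explosion_prob eta <> 1%E] = 0%E.
Proof.
move=> nuE; have [inv _] := nuE.
have [||c [c01 hc]] := @ergodic_const _ _ _ _ hp lam_gt0 nu nuE _ measurable_explosion_prob.
- move=> eta; rewrite measure_ge0 probability_le1//; exact: measurable_arw_explodes.
- by move=> e eta; exact: explosion_prob_dir.
suff bd delta : 0 < delta -> c <= (c + delta) ^+ 2 + 2 * delta.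
  have cc : c <= c ^+ 2.
    apply/ler_addgt0Pr => ep ep0.
    (* Since [c] and [delta] are at most one, the bound exceeds [c ^+ 2] by at most [5 * delta]. *)
    pose delta := Num.min 1 (ep / 5).
    have d0 : 0 < delta by rewrite /delta lt_min ltr01/=; lra.
    have d1 : delta <= 1 by rewrite /delta ge_min lexx.
    have d5 : delta <= ep / 5 by rewrite /delta ge_min lexx orbT.
    have := bd delta d0; move: c01 => /andP[c0 c1]; nra.
  have [c0|c0] := eqVneq c 0; first by left; rewrite c0 in hc.
  right; suff ce : c = 1 by rewrite ce in hc.
  have : 0 < c by rewrite lt_neqAle eq_sym c0; case/andP: c01.
  move: c01 cc => /andP[_ c1] cc cp; apply/eqP; rewrite eq_le c1/=.
  by rewrite -(ler_pM2l cp) mulr1 -expr2.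
move=> d0.
have [e qe] := exists_dir hp lam_gt0.
have msec (B : set (cfg d * stack d)) : measurable B -> forall r : R,
    measurable [set eta : cfg d | prob Q [set w | B (eta, w)] <= r].
  move=> mB r; rewrite (_ : [set _ | _] = setT `&` [set eta | (Q [set w | B (eta, w)] <= r%:E)%E]).
    exact: (emeasurable_fun_infty_c measurableT (measurable_section mB) r%:E).
  apply/seteqP; split => eta /=.
    by move=> h; split => //; rewrite probE ?lee_fin//; exact: measurable_sectionE.
  by move=> [_]; rewrite probE ?lee_fin//; exact: measurable_sectionE.
have mle (B C : set (cfg d * stack d)) : measurable B -> measurable C ->
    forall r : R, measurable [set eta : cfg d | prob Q [set w | B (eta, w)] <= prob Q [set w | C (eta, w)] + r].
  move=> mB mC r.
  rewrite (_ : [set _ | _] = \bigcap_(k : rat) ([set eta | prob Q [set w | B (eta, w)] <= ratr k + r] `|`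
       ~` [set eta | prob Q [set w | C (eta, w)] <= ratr k])).
    apply: measurable_bigcap_count => k _; apply: measurableU; first exact: msec.
    by apply: measurableC; exact: msec.
  apply/seteqP; split => eta /=.
    move=> h k _; have [Ck|] := pselect (prob Q [set w | C (eta, w)] <= ratr k); last by right.
    by left; apply: (le_trans h); rewrite lerD2r.
  move=> h; rewrite leNgt; apply/negP; rewrite -ltrBrDr => lt.
  have [k] := rat_in_itvoo lt; rewrite in_itv/= => /andP[k1 k2].
  by have [/=|] := h k I; [lra|apply; exact: ltW].
pose Eu k : set (cfg d * stack d) := \bigcup_m reaches k m 0.
have mEu k : measurable (Eu k) by apply: bigcupT_measurable => m; exact: measurable_reaches.
have mr k m := measurable_reaches k m 0.
have mex := measurable_explodes_joint 0.
pose D k := [set eta | prob Q [set w | Eu k (eta, w)] <= prob Q (arw_explodes eta 0) + delta].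
pose D' k n := [set eta | prob Q [set w | Eu k (eta, w)] <=
   prob Q [set w | reaches k n 0 (eta, w)] + delta].
have mD k : measurable (D k) by exact: (mle _ [set ow | arw_explodes ow.1 0 ow.2]).
have mD' k n : measurable (D' k n) by exact: mle.
have msE B eta := @measurable_sectionE B eta.
(* First [k] makes reaching [k] topplings barely more likely than explosion, then [n] makes it
   visible within [n] steps. Keeping probability above one half ensures that the good set meets its
   translate. *)
have [k Dk] : exists k, 1 / 2 < prob nu (D k).
  apply: prob_nondecreasing => //.
    move=> n m nm eta /= h; apply: le_trans h; apply: prob_sub; [exact: msE|exact: msE|].
    move=> w [j _]; rewrite /reaches/= => mj; exists j => //; exact: leq_trans mj.
  rewrite (_ : \bigcup_n D n = setT) ?probT; first by lra.
  apply/seteqP; split => // eta _.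
  have [] := @prob_nonincreasing _ _ _ Q (fun k => [set w | Eu k (eta, w)])
     (prob Q (arw_explodes eta 0) + delta).
  - by move=> n; exact: msE.
  - move=> n m nm w [j _]; rewrite /reaches/= => mj; exists j => //; exact: leq_trans mj.
  - rewrite (_ : \bigcap_n _ = arw_explodes eta 0); first by rewrite ltrDl.
    apply/seteqP; split => w /= h.
      by move=> k; have [n _ kn] := h k I; exists n.
    by move=> k _; have [n kn] := h k; exists n.
  - by move=> n nn; exists n => //; exact: ltW.
have [n Dn] : exists n, 1 / 2 < prob nu (D k `&` D' k n).
  apply: prob_nondecreasing => //.
  - by move=> n; exact: measurableI.
  - move=> n m nm eta [Dk' /= h]; split => //=; apply: (le_trans h); rewrite lerD2r.
    apply: prob_sub; [exact: msE|exact: msE|] => w; rewrite /reaches/= => kn.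
    by rewrite (leq_trans kn)// parallel_leS.
  rewrite -setI_bigcupr (_ : \bigcup_n D' k n = setT) ?setIT//.
  apply/seteqP; split => // eta _.
  have [] := @prob_nondecreasing _ _ _ Q (fun n => [set w | reaches k n 0 (eta, w)])
     (prob Q [set w | Eu k (eta, w)] - delta).
  - by move=> m; exact: msE.
  - move=> i j ij w; rewrite /reaches/= => kn.
    by rewrite (leq_trans kn)// parallel_leS.
  - by rewrite (_ : \bigcup_n _ = [set w | Eu k (eta, w)]) ?ltrBlDr ?ltrDl.
  - by move=> n nn; exists n => //; move: nn; rewrite /D'/= ltrBlDr => /ltW.
pose y := dir e *+ n.*2.+1.
pose G := D k `&` D' k n.
have mG : measurable G by exact: measurableI.
have mGy : measurable (translate y @^-1` G : set (cfg d)).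
  exact: measurable_preimage (measurable_translate y) mG.
pose N := [set eta | exists z, explosion_prob (translate z eta) <> c%:E].
have mc : measurable [set eta | explosion_prob eta <> c%:E].
  rewrite (_ : [set _ | _] = setT `&` [set eta | explosion_prob eta != c%:E]).
    exact: (emeasurable_neq measurableT measurable_explosion_prob c%:E).
  by rewrite setTI; apply/seteqP; split => eta /= /eqP.
have NE : N = \bigcup_z translate z @^-1` [set eta | explosion_prob eta <> c%:E].
  by apply/seteqP; split => eta [z]; [exists z|exists z].
have mN : measurable N.
  rewrite NE; apply: measurable_bigcup_count => z _.
  exact: measurable_preimage (measurable_translate z) mc.
have N0 : nu N = 0%E.
  rewrite NE; apply: measure_bigcup_null => z; last by rewrite -[RHS]hc; exact: inv.
  exact: measurable_preimage (measurable_translate z) mc.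
have pGy : prob nu (translate y @^-1` G) = prob nu G by rewrite /prob inv.
(* [G] and its translate both have probability above one half, so some configuration lies in both
   and outside the null set [N]. *)
have [eta [Geta Gyeta nN]] : exists eta, [/\ G eta, G (translate y eta) & ~ N eta].
  apply: contrapT => /forallNP no.
  have : prob nu G <= prob nu (~` (translate y @^-1` G) `|` N).
    apply: prob_sub => //; first by apply: measurableU => //; exact: measurableC.
    move=> eta Ge; have [Ne|nNe] := pselect (N eta); first by right.
    by left => /= Gy; apply: (no eta).
  have := prob_U nu (measurableC mGy) mN.
  rewrite prob_setC// pGy [prob nu N]/prob N0/=; rewrite -/G in Dn; lra.
have cE z : explosion_prob (translate z eta) = c%:E.
  by apply: contrapT => h; apply: nN; exists z.
have shE m : Q [set w | reaches k m 0 (translate y eta, w)] = Q [set w | reaches k m y (eta, w)].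
  rewrite -(law_shift Qcyl y); last exact: msE.
  congr (Q _); apply/seteqP; split => w /=; rewrite /reaches/=;
    by rewrite arw_parallel_translate.
have shU : Q (\bigcup_m [set w | reaches k m y (eta, w)]) = Q [set w | Eu k (translate y eta, w)].
  rewrite -[RHS](law_shift Qcyl y); last exact: msE.
  congr (Q _); apply/seteqP; split => w /= -[m _ h]; exists m => //; move: h; rewrite /reaches/=;
    by rewrite arw_parallel_translate.
have cQ z : prob Q (arw_explodes (translate z eta) 0) = c.
  by rewrite /prob -/(explosion_prob _) cE.
apply: (@explosion_bound c delta k n e eta qe (ltW d0) cE) => z [->|->].
- have [h1 h2] := Geta; move: h1; rewrite /D/= => h1.
  have := cQ 0; rewrite translate0 => c0; rewrite c0 in h1.
  by split; [exact: h1|exact: h2].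
- have [h1 h2] := Gyeta; move: h1 h2; rewrite /D /D' /= cQ.
  by rewrite {1 2 3}/prob shE -shU; split.
Qed.

End explosion_probability.

(** The default [0] makes the limit a total function, measurable even where the sequence does not
    stabilize. *)
Definition eventual (u : nat -> nat) : nat :=
  xget 0%N [set m | exists N, forall n, (N <= n)%N -> u n = m].

Lemma eventualP u m : (exists N, forall n, (N <= n)%N -> u n = m) -> eventual u = m.
Proof.
move=> h; rewrite /eventual; case: xgetP => [k _ [N HN]|/(_ m)//].
have [M HM] := h; rewrite -(HN (maxn N M)) ?leq_maxl// HM//; exact: leq_maxr.
Qed.

Lemma eventualN u : (forall m, ~ exists N, forall n, (N <= n)%N -> u n = m) -> eventual u = 0%N.
Proof. by move=> h; rewrite /eventual; case: xgetP => // k _ /(h k). Qed.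

Lemma dmeas_eventual d (X : measurableType d) (u : nat -> X -> nat) :
  (forall n, dmeas (u n)) -> dmeas (fun o => eventual (fun n => u n o)).
Proof.
move=> mu.
pose E m := \bigcup_N \bigcap_(n in [set n | (N <= n)%N]) [set o | u n o = m].
have mE m : measurable (E m).
  apply: measurable_bigcup_count => N _; apply: measurable_bigcap_count => n _.
  exact: (mu n [set m]).
have EP m o : E m o <-> exists N, forall n, (N <= n)%N -> u n o = m.
  by split => [[N _ h]|[N h]]; exists N.
move=> B.
rewrite (_ : _ @^-1` B = (\bigcup_(m in B) E m) `|`
   (if `[< B 0%N >] then ~` \bigcup_m E m else set0)).
  apply: measurableU; first by apply: measurable_bigcup_count => m _.
  by case: ifPn => // _; apply: measurableC; exact: measurable_bigcup_count.
apply/seteqP; split => o /=.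
- move=> Bo; have [[m Em]|nE] := pselect (exists m, E m o).
    by left; exists m => //; move: Bo; rewrite (@eventualP _ m)//; exact/EP.
  right; move: Bo; rewrite /preimage/= eventualN; last first.
    by move=> m h; apply: nE; exists m; exact/EP.
  by move=> B0; rewrite asboolT// => -[m _ Em]; apply: nE; exists m.
- move=> [[m Bm /EP Em]|]; first by rewrite (@eventualP _ m).
  case: asboolP => // B0 nE; rewrite eventualN// => m h; apply: nE.
  by exists m => //; exact/EP.
Qed.

(** * Sequential filling by a strategy that does not look ahead *)

Section run_lemmas.
Context (d : nat).
Implicit Types (w : stack d) (s : history d) (x : Zd d).

Lemma mem_used s (k : Zd d * nat) : (k.2 < visits s k.1)%N -> k \in used s.
Proof.
case: k => z j /=; elim: s => //= -[x t] s IHs /=; rewrite inE.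
case: eqVneq => [->|_]; last by rewrite add0n => /IHs ->; rewrite orbT.
rewrite add1n ltnS leq_eqVlt => /orP[/eqP ->|/IHs ->]; last by rewrite orbT.
by rewrite eqxx.
Qed.

Lemma recorded_compat w s : compat w s ->
  forall x j, (j < visits s x)%N -> recorded s (x, j) = w (x, j).
Proof. by move=> /compatP h x j jx; rewrite h//; exact: mem_used. Qed.

(** Instability depends on used instructions only, so the greedy choice is a function of the
    history. *)
Lemma unstable_recorded (rule : Zd d -> nat -> bool -> bool) xi w s x : compat w s ->
  unstable rule xi (recorded s) (visits s) x = unstable rule xi w (visits s) x.
Proof.
move=> cw; have fl y e : flow (recorded s) (visits s) y e = flow w (visits s) y e.
  apply: eq_in_count => j; rewrite mem_iota add0n => /andP[_ jy].
  by rewrite (recorded_compat cw).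
rewrite /unstable; congr (rule _ _ _); first by rewrite /load /inflow /outflow;
  congr (_ + _ - _)%N; apply: eq_bigr => e _; rewrite fl.
rewrite /asleep; case E: (visits s x) => [//|j].
by rewrite (recorded_compat cw)// E.
Qed.

Lemma compat_run strat w n s : compat w s -> compat w (run strat w n s).
Proof.
elim: n s => //= n IHn s cw; case: (strat s) => [x|]; last exact: IHn.
by apply: IHn; rewrite /= eqxx.
Qed.

Lemma run_add strat w n m s : run strat w (n + m) s = run strat w m (run strat w n s).
Proof. by elim: n s => //= n IHn s; case: (strat s) => [x|]; exact: IHn. Qed.

Lemma run_leS strat w n s x : (visits s x <= visits (run strat w n s) x)%N.
Proof.
elim: n s => //= n IHn s; case: (strat s) => [y|] //.
by apply: leq_trans (IHn _); rewrite visits_cons leq_addr.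
Qed.

End run_lemmas.

Section greedy_filling.
Context (d : nat) (xi eta : Zd d -> nat).
Implicit Types (w : stack d) (s : history d) (x : Zd d).

Let unst s x := unstable (fill_rule eta) xi (recorded s) (visits s) x.

Let first s n := if choice.pickle_inv n is Some x then unst s x else false.

(** A parallel step may topple infinitely many sites at once, whereas a strategy reveals one
    instruction at a time. Taking the unstable site of smallest code ensures that none is postponed
    forever. *)
Definition greedy s : option (Zd d) :=
  if pselect (exists n, first s n) is left e then choice.pickle_inv (ex_minn e) else None.

Lemma greedy_some s x : greedy s = Some x ->
  unst s x /\ forall y, unst s y -> (choice.pickle x <= choice.pickle y)%N.
Proof.
rewrite /greedy; case: pselect => // e; case: ex_minnP => n fn mn nx.
have pn : choice.pickle x = n by have := @choice.pickle_invK (Zd d) n; rewrite nx.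
split; first by move: fn; rewrite /first nx.
by move=> y uy; rewrite pn; apply: mn; rewrite /first choice.pickleK_inv.
Qed.

Lemma greedy_none s x : greedy s = None -> ~~ unst s x.
Proof.
rewrite /greedy; case: pselect => [e|ne _].
  by case: ex_minnP => n; rewrite /first; case: choice.pickle_inv.
by apply/negP => ux; apply: ne; exists (choice.pickle x); rewrite /first choice.pickleK_inv.
Qed.

Let r w n := run greedy w n [::].

Let compat_r w n : compat w (r w n). Proof. exact: compat_run. Qed.

Let rS w n : r w n.+1 = if greedy (r w n) is Some x
  then (x, w (x, visits (r w n) x)) :: r w n else r w n.
Proof. by rewrite /r -[n.+1]addn1 run_add/=; case: greedy. Qed.

Lemma greedy_le_parallel w n x :
  (visits (r w n) x <= parallel (fill_rule eta) xi w n x)%N.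
Proof.
elim: n x => [//|n IHn] x; rewrite rS.
case E: (greedy _) => [y|]; last by rewrite (leq_trans (IHn x))// parallel_leS.
have [uy _] := greedy_some E; rewrite visits_cons.
apply: parallel_step => //; first exact: fill_rule_mono.
by move: uy; rewrite /unst (unstable_recorded _ _ _ (compat_r w n)).
Qed.

Let r_mono w n m x : (n <= m)%N -> (visits (r w n) x <= visits (r w m) x)%N.
Proof. by move=> /subnK <-; rewrite addnC /r run_add run_leS. Qed.

Definition greedy_limit w x : nat := eventual (fun n => visits (r w n) x).

Lemma greedy_limitP w : (forall x, ~ explodes (fill_rule eta) xi w x) ->
  forall x, exists N, forall n, (N <= n)%N -> visits (r w n) x = greedy_limit w x.
Proof.
move=> nex x; have /existsNP[k /forallNP nk] := nex x.
have bd n : (visits (r w n) x <= k)%N.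
  rewrite (leq_trans (greedy_le_parallel w n x))// leqNgt; apply/negP => /ltnW.
  exact: nk.
suff [N HN] : exists N, forall n, (N <= n)%N -> visits (r w n) x = visits (r w N) x.
  exists N => n Nn; rewrite HN// /greedy_limit; apply/esym/eventualP.
  by exists N.
have : forall j, (exists N, k - visits (r w N) x <= j)%N ->
   exists N, forall n, (N <= n)%N -> visits (r w n) x = visits (r w N) x.
  elim=> [|j IHj] [N hN].
    exists N => n Nn; have := bd n; have := bd N; have := r_mono w x Nn; lia.
  have [all|] := pselect (forall n, (N <= n)%N -> visits (r w n) x = visits (r w N) x).
    by exists N.
  move=> /existsNP[n /not_implyP[Nn ne]]; apply: IHj; exists n.
  have := r_mono w x Nn; lia.
by move=> /(_ k); apply; exists 0%N; exact: leq_subr.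
Qed.

(** A site [x] unstable in the limit would force, at a late step, a toppling at a site of code at
    most that of [x], where all visits are already over. *)
Lemma greedy_limit_stable w : (forall x, ~ explodes (fill_rule eta) xi w x) ->
  forall x, ~~ unstable (fill_rule eta) xi w (greedy_limit w) x.
Proof.
move=> nex x; have lim := greedy_limitP nex.
have fin K : exists N, forall y, (choice.pickle y < K)%N ->
    forall n, (N <= n)%N -> visits (r w n) y = greedy_limit w y.
  elim: K => [|K [N HN]]; first by exists 0%N.
  case E: (choice.pickle_inv K : option (Zd d)) => [y|]; last first.
    exists N => y; rewrite ltnS leq_eqVlt => /orP[/eqP e|/HN//].
    by move: E; rewrite -e choice.pickleK_inv.
  have [M HM] := lim y; exists (maxn N M) => z.
  rewrite ltnS leq_eqVlt => /orP[/eqP e|zK] n; rewrite geq_max => /andP[Nn Mn].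
    have -> : z = y by move: E; rewrite -e choice.pickleK_inv => -[].
    exact: HM.
  exact: HN.
apply/negP => ux.
have [nn Hnn] := choice (fun y => lim y).
have [N HN] := fin (choice.pickle x).+1.
(* By step [M] the visits to [x], to its neighbours and to all sites of code at most that of [x] are
   final. *)
pose M := (N + (nn x + \sum_e nn (x - dir e)%R))%N.
have eqx : visits (r w M) x = greedy_limit w x by apply: Hnn; rewrite /M; lia.
have eqe e : visits (r w M) (x - dir e) = greedy_limit w (x - dir e).
  by apply: Hnn; rewrite /M (bigD1 e)//=; lia.
have uM : unst (r w M) x.
  rewrite /unst (unstable_recorded _ _ _ (compat_r w M)).
  move: ux; rewrite /unstable (asleep_local w eqx); congr (is_true (fill_rule eta x _ _)).
  rewrite /load (outflow_local w eqx); congr (_ + _ - _)%N.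
  by apply: eq_bigr => e _; apply: flow_local; rewrite eqe.
have := rS w M; case E: (greedy _) => [y|]; last by have := greedy_none x E; rewrite uM.
have [_ /(_ x uM) yx] := greedy_some E => rM.
have h1 := HN y (ltac:(rewrite ltnS; exact: yx)) M (ltac:(rewrite /M; lia)).
have h2 := HN y (ltac:(rewrite ltnS; exact: yx)) M.+1 (ltac:(rewrite /M; lia)).
by move: h2; rewrite rM visits_cons /incr eqxx h1; lia.
Qed.

End greedy_filling.

Section filling_then_activity.
Context (R : realType) (d : nat) (p : Zd d -> R) (lam : R).
Hypotheses (hp : jump_distribution p) (lam_gt0 : 0 < lam).
Local Notation q := (instr_prob p lam).
Variable Q : probability (stack d) R.
Hypothesis Qcyl : forall s f, uniq s -> Q (cyl s f) = (\prod_(k <- s) q (f k))%:E.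

Let q_ge0 := instr_prob_ge0 hp lam_gt0.
Let q_sum1 := instr_prob_sum1 hp lam_gt0.

(** Filling almost surely ends with at most [eta] particles at each site and fresh stacks, with
    which [eta] stabilizes; the sum of the two odometers bounds that of [xi]. *)
Lemma no_explosion_transfer (xi eta : Zd d -> nat) :
  (forall x, Q [set w | explodes (fill_rule eta) xi w x] = 0%E) ->
  (forall x, Q [set w | explodes (@arw_rule d) eta w x] = 0%E) ->
  Q [set w | explodes (@arw_rule d) xi w 0] = 0%E.
Proof.
move=> fill0 arw0.
have mex rule zeta x := @measurable_explodes_stack d rule zeta x.
pose D := ~` \bigcup_x [set w : stack d | explodes (fill_rule eta) xi w x].
have mU : measurable (\bigcup_x [set w : stack d | explodes (fill_rule eta) xi w x]).
  by apply: measurable_bigcup_count => x _; exact: mex.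
have mD : measurable D by exact: measurableC.
have U0 : Q (\bigcup_x [set w : stack d | explodes (fill_rule eta) xi w x]) = 0%E.
  by apply: measure_bigcup_null => x; [exact: mex|exact: fill0].
have D1 : Q D = 1%E.
  by have := probability_setC Q mU; rewrite U0 sube0.
have Dne w : D w -> forall x, ~ explodes (fill_rule eta) xi w x.
  by move=> Dw x ex; apply: Dw; exists x.
pose g := greedy_limit xi eta.
pose phi (w : stack d) : stack d := stack_drop w (g w).
have mg x : dmeas (fun w => g w x).
  apply: dmeas_eventual => n; apply: (dmeas_comp (fun s => visits s x)).
  exact: dmeas_run.
have mphi : measurable_fun setT phi.
  apply: measurable_to_stacks => k.
  apply: (@dmeas_dep _ _ nat _ (fun w => g w k.1) (fun m w => w (k.1, m + k.2)%N)) => // m.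
  exact: dmeas_coord.
have law := @law_transport R d q Q Qcyl D phi 1 ler01 mD mphi.
pose F := \bigcup_x [set w : stack d | explodes (@arw_rule d) eta w x].
have mF : measurable F by apply: measurable_bigcup_count => x _; exact: mex.
have F0 : Q F = 0%E by apply: measure_bigcup_null => x; [exact: mex|exact: arw0].
have DF0 : Q (D `&` phi @^-1` F) = 0%E.
  rewrite law ?F0 ?mule0// => s f us; rewrite mul1r -(Qcyl f us).
  have mA : measurable (D `&` phi @^-1` cyl s f).
    by apply: measurableI => //; apply: measurable_preimage mphi _; exact: measurable_cyl.
  have mc := @measurable_cyl (Zd d * nat)%type ('I_d * bool)%type s f.
  rewrite (probE Q mA) (probE Q mc); congr EFin.
  pose B n := [set w | cyl s f (stack_drop w (visits (run (greedy xi eta) w n [::])))].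
  apply: (@prob_constant_limit _ _ _ Q B _ D) => //.
  - move=> n; apply: measurable_preimage mc; exact: measurable_drop_run.
  - by move=> n; rewrite /prob (law_drop_run0 q_ge0 q_sum1 Qcyl).
  move=> w Dw.
  have fin (l : seq (Zd d * nat)) : exists N, forall n, (N <= n)%N -> forall k, k \in l ->
      visits (run (greedy xi eta) w n [::]) k.1 = g w k.1.
    elim: l => [|k l [N HN]]; first by exists 0%N.
    have [M HM] := greedy_limitP (Dne w Dw) k.1.
    exists (maxn N M) => n; rewrite geq_max => /andP[Nn Mn] j.
    by rewrite inE => /predU1P[->|]; [exact: HM|exact: HN].
  have [N HN] := fin s; exists N => n Nn; split.
    move=> h; split => // k ks; rewrite -(h k ks) /phi /stack_drop.
    by rewrite (HN n Nn k ks).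
  by move=> [_ h] k ks; rewrite -(h k ks) /phi /stack_drop (HN n Nn k ks).
have mDF : measurable (D `&` phi @^-1` F).
  by apply: measurableI => //; exact: measurable_preimage mphi mF.
have CD0 : Q (~` D) = 0%E by rewrite setCK.
have E0 : Q (~` D `|` (D `&` phi @^-1` F)) = 0%E.
  by rewrite measureU0//; exact: measurableC.
apply: (subset_measure0 (mex _ _ _) _ _ E0).
  by apply: measurableU => //; exact: measurableC.
move=> w ex; have [Dw|nD] := pselect (D w); last by left.
right; split => //; apply: contrapT => nF.
have nexp x : ~ explodes (@arw_rule d) eta (phi w) x by move=> h; apply: nF; exists x.
(* The total [g w + L] leaves all sites stable, which is all that [parallel_le_stable] needs. *)
have [L [_ stL]] := limit_odometer nexp.
have st := stable_concat (greedy_limit_stable (Dne w Dw)) stL.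
have [n hn] := ex (g w 0%R + L 0%R).+1%N.
have := @parallel_le_stable _ _ (@arw_rule_mono d) xi xi w _ (fun=> leqnn _) st n 0.
by rewrite leqNgt => /negP; apply.
Qed.

End filling_then_activity.

(** * Comparison of densities *)

Lemma measurable_fun_nat dX (X : measurableType dX) (R : realType) (D : set X) (f : X -> nat) :
  dmeas f -> measurable_fun D (fun o => (f o)%:R%:E : \bar R).
Proof. by move=> mf mD Y mY; apply: measurableI => //; exact: (mf [set n | Y n%:R%:E]). Qed.

Lemma product_preserve d1 d2 (X1 : measurableType d1) (X2 : measurableType d2) (R : realType)
    (P1 : probability X1 R) (P2 : probability X2 R) (f1 : X1 -> X1) (f2 : X2 -> X2) :
  measurable_fun setT f1 -> measurable_fun setT f2 ->
  (forall A, measurable A -> P1 (f1 @^-1` A) = P1 A) ->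
  (forall A, measurable A -> P2 (f2 @^-1` A) = P2 A) ->
  forall A, measurable A ->
  (P1 \x P2)%E ((fun o => (f1 o.1, f2 o.2)) @^-1` A) = (P1 \x P2)%E A.
Proof.
move=> m1 m2 i1 i2 A mA; pose f (o : X1 * X2) := (f1 o.1, f2 o.2).
have mf : measurable_fun setT f.
  apply: measurable_fun_pair; first exact: measurableT_comp m1 measurable_fst.
  exact: measurableT_comp m2 measurable_snd.
pose m0 : {measure set (X1 * X2) -> \bar R} := pushforward (P1 \x P2)%E f.
rewrite [RHS](@product_measure_unique _ _ _ _ _ _ _ (m0 mf))// => B C mB mC.
rewrite /m0 /= /pushforward.
rewrite (_ : f @^-1` _ = (f1 @^-1` B) `*` (f2 @^-1` C)); last first.
  by apply/seteqP; split => -[].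
rewrite product_measure1E.
- by rewrite -[RHS](congr2 _ (i1 B mB) (i2 C mC)).
- exact: measurable_preimage m1 mB.
- exact: measurable_preimage m2 mC.
Qed.

Lemma integral_preserve dX (X : measurableType dX) (R : realType) (P : probability X R)
    (f : X -> X) (D : set X) (g : X -> \bar R) : measurable_fun setT f ->
  (forall A, measurable A -> P (f @^-1` A) = P A) -> measurable D -> f @^-1` D = D ->
  measurable_fun D g -> (forall x, (0 <= g x)%E) ->
  (\int[P]_(x in D) g (f x) = \int[P]_(x in D) g x)%E.
Proof.
move=> mf inv mD fD mg g0.
have := @ge0_integral_pushforward _ _ _ _ R _ mf P D g mD mg (fun x _ => g0 x).
rewrite fD => h; rewrite -[LHS]h; apply: eq_measure_integral => B mB _; exact: inv.
Qed.

Lemma product_null d1 d2 (X1 : measurableType d1) (X2 : measurableType d2) (R : realType)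
    (P1 : probability X1 R) (P2 : probability X2 R) (A : set (X1 * X2)) : measurable A ->
  (forall x, P2 [set y | A (x, y)] = 0%E) -> (P1 \x P2)%E A = 0%E.
Proof.
move=> mA h; rewrite /product_measure1 integral0_eq// => x _ /=.
rewrite -[RHS](h x); congr (P2 _); apply/seteqP.
by split => y /=; rewrite /xsection/= ?inE.
Qed.

Lemma product_null_inv d1 d2 (X1 : measurableType d1) (X2 : measurableType d2) (R : realType)
    (P1 : probability X1 R) (P2 : probability X2 R) (A : set (X1 * X2)) : measurable A ->
  (P1 \x P2)%E A = 0%E -> P1 [set x | P2 [set y | A (x, y)] <> 0%E] = 0%E.
Proof.
move=> mA; rewrite /product_measure1.
have mf : measurable_fun setT (P2 \o xsection A) by exact: measurable_fun_xsection.
have secE x : [set y | A (x, y)] = xsection A x.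
  by apply/seteqP; split => y /=; rewrite /xsection/= ?inE.
move=> h; have : (\int[P1]_(x in setT) `|(P2 \o xsection A) x| = 0)%E.
  by rewrite -[RHS]h; apply: eq_integral => x _; rewrite gee0_abs.
move=> /(ae_eq_integral_abs _ measurableT mf).
move=> [N [mN N0 sub]]; apply: (subset_measure0 _ mN _ N0); last first.
  by move=> x /= nx; apply: sub => /= /(_ I) e; apply: nx; rewrite secE.
rewrite (_ : [set x | _] = setT `&` [set x | (P2 \o xsection A) x != 0%E]).
  exact: emeasurable_neq.
by rewrite setTI; apply/seteqP; split => x /=; rewrite secE => /eqP.
Qed.

Lemma integral_section_gen d1 d2 (X1 : measurableType d1) (X2 : measurableType d2) (R : realType)
    (P1 : probability X1 R) (P2 : probability X2 R) (A : set (X1 * X2)) (F : X1 -> nat) :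
  measurable A -> dmeas F ->
  (\int[P1 \x P2]_(o in A) (F o.1)%:R%:E =
   \int[P1]_x ((F x)%:R%:E * P2 [set y | A (x, y)]))%E.
Proof.
move=> mA mF; rewrite integral_mkcond.
have mFA : measurable_fun setT ((fun o : X1 * X2 => (F o.1)%:R%:E : \bar R) \_ A).
  apply/(measurable_restrictT _ mA)/measurable_fun_nat.
  exact: (dmeas_measurable_comp measurable_fst mF).
have FA0 o : (0 <= ((fun o : X1 * X2 => (F o.1)%:R%:E : \bar R) \_ A) o)%E.
  by rewrite patchE; case: ifPn => // _; rewrite lee_fin.
rewrite (fubini_tonelli1 _ mFA FA0).
apply: eq_integral => x _; rewrite /fubini_F.
have mS : measurable [set y | A (x, y)].
  have := measurable_xsection x mA; congr measurable.
  by apply/seteqP; split => w /=; rewrite /xsection/= ?inE.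
transitivity (\int[P2]_y ((cst (F x)%:R%:E) \_ [set y | A (x, y)]) y)%E.
  apply: eq_integral => y _; rewrite !patchE.
  by rewrite (_ : (x, y) \in A = (y \in [set y | A (x, y)]))//; apply/idP/idP;
    rewrite !inE.
by rewrite -integral_mkcond integral_cst.
Qed.

Section comparison.
Context (R : realType) (d : nat) (p : Zd d -> R) (lam : R).
Hypotheses (hp : jump_distribution p) (lam_gt0 : 0 < lam).
Local Notation q := (instr_prob p lam).
Variable Q : probability (stack d) R.
Hypothesis Qcyl : forall s f, uniq s -> Q (cyl s f) = (\prod_(k <- s) q (f k))%:E.
Variables mu nu : probability (cfg d) R.
Hypotheses (muE : translation_ergodic mu) (nuE : translation_ergodic nu).

Let pair := (cfg d * cfg d)%type.
Let space := (pair * stack d)%type.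
Local Notation M := (mu \x nu)%E.
Local Notation PP := ((mu \x nu) \x Q)%E.

Let q_ge0 := instr_prob_ge0 hp lam_gt0.
Let q_sum1 := instr_prob_sum1 hp lam_gt0.

Let fill (n : nat) (x : Zd d) (o : space) : nat :=
  parallel (fill_rule (masses o.1.2)) (masses o.1.1) o.2 n x.

Let fillx (x : Zd d) : set space :=
  [set o | explodes (fill_rule (masses o.1.2)) (masses o.1.1) o.2 x].

(** Explosion at every site is exactly invariant under joint shifts, unlike [fillx 0], from which it
    differs by a null event. *)
Let A : set space := \bigcap_x fillx x.

Let T2 (y : Zd d) (th : pair) : pair := (translate y th.1, translate y th.2).

Let T (y : Zd d) (o : space) : space := (T2 y o.1, stack_shift y o.2).

Let mrule (x : Zd d) N b : dmeas (fun o : space => fill_rule (masses o.1.2) x N b).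
Proof.
apply: (dmeas_comp (fun m => (m < N)%N)).
exact: (dmeas_measurable_comp (measurableT_comp measurable_snd measurable_fst) (dmeas_mass x)).
Qed.

Let mxi (x : Zd d) : dmeas (fun o : space => masses o.1.1 x).
Proof.
exact: (dmeas_measurable_comp (measurableT_comp measurable_fst measurable_fst) (dmeas_mass x)).
Qed.

Let meta (x : Zd d) : dmeas (fun o : space => masses o.1.2 x).
Proof.
exact: (dmeas_measurable_comp (measurableT_comp measurable_snd measurable_fst) (dmeas_mass x)).
Qed.

Let mw (k : Zd d * nat) : dmeas (fun o : space => o.2 k).
Proof. exact: (dmeas_measurable_comp measurable_snd (dmeas_coord k)). Qed.

Let mfill n x : dmeas (fill n x).
Proof. exact: dmeas_parallel. Qed.

Let mfillx x : measurable (fillx x).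
Proof. exact: measurable_explodes. Qed.

Let mA : measurable A.
Proof. by apply: measurable_bigcap_count => x _; exact: mfillx. Qed.

Let mT2 y : measurable_fun setT (T2 y).
Proof.
apply: measurable_fun_pair.
  exact: measurableT_comp (measurable_translate y) measurable_fst.
exact: measurableT_comp (measurable_translate y) measurable_snd.
Qed.

Let mshift y : measurable_fun setT (@stack_shift d y).
Proof. by apply: measurable_to_stacks => k; exact: dmeas_coord. Qed.

Let mT y : measurable_fun setT (T y).
Proof.
apply: measurable_fun_pair.
  exact: measurableT_comp (mT2 y) measurable_fst.
exact: measurableT_comp (mshift y) measurable_snd.
Qed.

Let PT2 y B : measurable B -> M (T2 y @^-1` B) = M B.
Proof.
move=> mB; apply: (product_preserve (P1 := mu) (P2 := nu)) => //.
- exact: measurable_translate.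
- exact: measurable_translate.
- by move=> C mC; exact: muE.1.
- by move=> C mC; exact: nuE.1.
Qed.

Let PT y B : measurable B -> PP (T y @^-1` B) = PP B.
Proof.
move=> mB; apply: (product_preserve (P1 := M) (P2 := Q)) => //.
- by move=> C mC; exact: PT2.
- by move=> C mC; exact: (law_shift Qcyl).
Qed.

Let fill_T n y x o : fill n x (T y o) = fill n (x + y) o.
Proof. by rewrite /fill /T/= -(@parallel_shift _ _ (fill_rule (masses (translate y o.1.2)))). Qed.

Let fillx_T y x : T y @^-1` fillx x = fillx (x + y).
Proof.
apply/seteqP; split => u h k; have [n hn] := h k; exists n.
  by rewrite -/(fill n (x + y) u) -fill_T.
by rewrite -/(fill n x (T y u)) fill_T.
Qed.

Let PA_T y : T y @^-1` A = A.
Proof.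
apply/seteqP; split => u h x _.
  have := h (x - y) I; rewrite -[_ (T y u)]/((T y @^-1` fillx (x - y)) u).
  by rewrite fillx_T subrK.
by rewrite -[fillx x (T y u)]/((T y @^-1` fillx x) u) fillx_T; exact: h.
Qed.

Let T0 o : T 0 o = o.
Proof.
case: o => -[xi eta] w; rewrite /T /T2/= !translate0; congr (_, _).
by apply/funext => -[x j]; rewrite /stack_shift/= addr0.
Qed.

Let TD x y o : T x (T y o) = T (x + y) o.
Proof.
case: o => -[xi eta] w; rewrite /T /T2/= !translateD; congr (_, _).
by apply/funext => -[z j]; rewrite /stack_shift/= addrA.
Qed.

(** A load of one more than [eta] makes a site topple, so explosion of the filling spreads along
    jump directions for almost every stack. *)
Let fill_null : PP (fillx 0 `\` A) = 0%E.
Proof.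
have AE : A = \bigcap_x T x @^-1` fillx 0.
  by apply: eq_bigcapr => x _; rewrite fillx_T add0r.
rewrite AE; apply: (invariant_coreE (P := PP) mT) => //.
apply: (spread_all hp lam_gt0 mT T0 TD PT) => // e qe.
rewrite fillx_T add0r; apply: product_null; first exact: measurableD.
move=> [xi eta].
have := @explodes_spread_ae R d p lam hp lam_gt0 Q Qcyl (fill_rule (masses eta)) (masses xi) 0 e
  (masses eta (0 + dir e)).+1.
by rewrite add0r; apply => // N b; rewrite /fill_rule.
Qed.

Let section_prob (th : pair) : \bar R := Q [set w | A (th, w)].

Let msection : measurable_fun setT section_prob.
Proof.
have := measurable_fun_xsection Q mA; congr (measurable_fun _ _).
apply/funext => th /=; congr (Q _).
by apply/seteqP; split => y /=; rewrite /xsection/= ?inE.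
Qed.

Let msection_set th : measurable [set w | A (th, w)].
Proof.
have := measurable_xsection th mA; congr measurable.
by apply/seteqP; split => w /=; rewrite /xsection/= ?inE.
Qed.

Let section_ge0 th : (0 <= section_prob th)%E. Proof. exact: measure_ge0. Qed.

Let section_le1 th : (section_prob th <= 1)%E. Proof. exact: probability_le1. Qed.

Let section_T y th : section_prob (T2 y th) = section_prob th.
Proof.
rewrite /section_prob -[LHS](law_shift Qcyl y); last exact: msection_set.
congr (Q _); rewrite -[in RHS](PA_T y).
by apply/seteqP; split.
Qed.

Let integral_section (F : pair -> nat) : dmeas F ->
  (\int[PP]_(o in A) (F o.1)%:R%:E = \int[M]_th ((F th)%:R%:E * section_prob th))%E.
Proof. exact: (integral_section_gen M Q mA). Qed.

(** An invariant [F] is almost surely constant under an ergodic law, hence uncorrelated with the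
    mass at the origin. *)
Let weighted_density (mu' : probability (cfg d) R) (F : cfg d -> \bar R) :
  translation_ergodic mu' -> measurable_fun setT F -> (forall xi, (0 <= F xi <= 1)%E) ->
  (forall y xi, F (translate y xi) = F xi) ->
  (\int[mu']_xi ((mass (xi 0))%:R%:E * F xi) = density mu' * \int[mu']_xi F xi)%E.
Proof.
move=> mu'E mF F01 Finv.
have [||c [/andP[c0 c1] hc]] := @ergodic_const _ _ _ _ hp lam_gt0 mu' mu'E F mF.
- by [].
- by move=> e xi _; rewrite Finv.
have mc : measurable [set xi | F xi <> c%:E].
  rewrite (_ : [set xi | _] = setT `&` [set xi | F xi != c%:E]).
    exact: emeasurable_neq.
  by rewrite setTI; apply/seteqP; split => xi /= /eqP.
have ae : ae_eq mu' setT F (cst c%:E).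
  by exists [set xi | F xi <> c%:E]; split => // xi /= h e; apply: h => _.
have mmass : measurable_fun setT (fun xi : cfg d => (mass (xi 0))%:R%:E : \bar R).
  exact: measurable_fun_nat (dmeas_mass 0).
have F0 xi : (0 <= F xi)%E by case/andP: (F01 xi).
have -> : (\int[mu']_xi F xi = c%:E)%E.
  rewrite (ge0_ae_eq_integral _ _ _ _ _ ae)//.
  rewrite integral_cst// -[RHS]mule1; congr (_ * _)%E; exact: probability_setT.
transitivity (\int[mu']_xi ((mass (xi 0))%:R%:E * c%:E))%E.
  apply: ge0_ae_eq_integral => //.
  - exact: emeasurable_funM.
  - by apply: emeasurable_funM.
  - by move=> xi _; rewrite mule_ge0// lee_fin.
  - by move=> xi _; rewrite mule_ge0// lee_fin.
  - exact: (ae_eqe_mul2l (fun xi : cfg d => (mass (xi 0))%:R%:E) ae).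
have m0 (xi : cfg d) : setT xi -> (0 <= (mass (xi 0))%:R%:E :> \bar R)%E.
  by rewrite lee_fin.
rewrite muleC /density -(ge0_integralZl mu' measurableT mmass m0) ?lee_fin//.
by apply: eq_integral => xi _; rewrite muleC.
Qed.

Let PPA : PP A = (\int[M]_th section_prob th)%E.
Proof.
have := @integral_section (fun=> 1%N) (dmeas_cst _ 1%N).
rewrite integral_cst// mul1e => ->.
by apply: eq_integral => th _; rewrite mul1e.
Qed.

(** Integrating the conditional probability of [A] over [eta] alone leaves an invariant function of
    [xi]: the shift of [xi] is absorbed by shifting [eta], which preserves [nu]. Only [mu] has to be
    ergodic here. *)
Let integral_xi : (\int[PP]_(o in A) (masses o.1.1 0)%:R%:E = density mu * PP A)%E.
Proof.
pose F (xi : cfg d) := (\int[nu]_eta section_prob (xi, eta))%E.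
have mF : measurable_fun setT F.
  exact: (measurable_fun_fubini_tonelli_F section_prob msection section_ge0).
have inv y xi : F (translate y xi) = F xi.
  rewrite /F; transitivity (\int[nu]_eta section_prob (translate y xi, translate y eta))%E.
    have mg : measurable_fun setT (fun eta => section_prob (translate y xi, eta)).
      exact: measurableT_comp msection (measurable_pair1 _).
    by rewrite (integral_preserve (measurable_translate y) _ measurableT _ mg)//; exact: nuE.1.
  by apply: eq_integral => eta _; exact: (section_T y (xi, eta)).
rewrite (integral_section (F := fun th => masses th.1 0)); last first.
  exact: (dmeas_measurable_comp measurable_fst (dmeas_mass 0)).
have mm : measurable_fun setT (fun th : pair => (masses th.1 0)%:R%:E : \bar R).
  apply: measurable_fun_nat; exact: (dmeas_measurable_comp measurable_fst (dmeas_mass 0)).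
rewrite PPA !fubini_tonelli1//=; last 2 first.
- exact: emeasurable_funM.
- by move=> th; rewrite mule_ge0// lee_fin.
rewrite -(@weighted_density mu F)//.
  apply: eq_integral => xi _; rewrite /fubini_F /=.
  have ms : measurable_fun setT (fun eta => section_prob (xi, eta)).
    exact: measurableT_comp msection (measurable_pair1 _).
  by rewrite (ge0_integralZl nu measurableT ms)// lee_fin.
move=> xi; rewrite integral_ge0//=.
rewrite -[leRHS](probability_setT nu) -[leRHS]mul1e -integral_cst//.
apply: ge0_le_integral => //.
exact: measurableT_comp msection (measurable_pair1 _).
Qed.

Let integral_eta : (\int[PP]_(o in A) (masses o.1.2 0)%:R%:E = density nu * PP A)%E.
Proof.
pose F (eta : cfg d) := (\int[mu]_xi section_prob (xi, eta))%E.
have mF : measurable_fun setT F.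
  exact: (measurable_fun_fubini_tonelli_G section_prob msection section_ge0).
have inv y eta : F (translate y eta) = F eta.
  rewrite /F; transitivity (\int[mu]_xi section_prob (translate y xi, translate y eta))%E.
    have mg : measurable_fun setT (fun xi => section_prob (xi, translate y eta)).
      exact: measurableT_comp msection (measurable_pair2 _).
    by rewrite (integral_preserve (measurable_translate y) _ measurableT _ mg)//; exact: muE.1.
  by apply: eq_integral => xi _; exact: (section_T y (xi, eta)).
rewrite (integral_section (F := fun th => masses th.2 0)); last first.
  exact: (dmeas_measurable_comp measurable_snd (dmeas_mass 0)).
have mm : measurable_fun setT (fun th : pair => (masses th.2 0)%:R%:E : \bar R).
  apply: measurable_fun_nat; exact: (dmeas_measurable_comp measurable_snd (dmeas_mass 0)).
rewrite PPA !fubini_tonelli2//=; last 2 first.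
- exact: emeasurable_funM.
- by move=> th; rewrite mule_ge0// lee_fin.
rewrite -(@weighted_density nu F)//.
  apply: eq_integral => eta _; rewrite /fubini_G /=.
  have ms : measurable_fun setT (fun xi => section_prob (xi, eta)).
    exact: measurableT_comp msection (measurable_pair2 _).
  by rewrite (ge0_integralZl mu measurableT ms)// lee_fin.
move=> eta; rewrite integral_ge0//=.
rewrite -[leRHS](probability_setT mu) -[leRHS]mul1e -integral_cst//.
apply: ge0_le_integral => //.
exact: measurableT_comp msection (measurable_pair2 _).
Qed.

Let particles n (o : space) : nat := load (masses o.1.1) o.2 (fun y => fill n y o) 0.

Let outs n (o : space) : nat := outflow o.2 (fun y => fill n y o) 0.

Let ins n (o : space) : nat := inflow o.2 (fun y => fill n y o) 0.

Let mparticles n : dmeas (particles n). Proof. exact: dmeas_load. Qed.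

Let mouts n : dmeas (outs n). Proof. exact: dmeas_outflow. Qed.

Let mins n : dmeas (ins n). Proof. exact: dmeas_inflow. Qed.

Let outs_step n o : (outs n.+1 o <= outs n o +
  unstable (fill_rule (masses o.1.2)) (masses o.1.1) o.2 (fun y => fill n y o) 0)%N.
Proof.
rewrite /outs !outflowE /fill /= iotaD count_cat leq_add2l add0n.
by case: unstable => //=; case: (_ != _).
Qed.

(** The rule topples the origin only when its load exceeds [eta], so in particular when it holds a
    particle; by induction the truncated subtraction in [load] is exact. *)
Let balance n o : (particles n o + outs n o = masses o.1.1 0 + ins n o)%N.
Proof.
suff : (outs n o <= masses o.1.1 0 + ins n o)%N by rewrite /particles /load => /subnK.
elim: n => [|n IHn]; first by rewrite /outs outflowE.
have inc : (ins n o <= ins n.+1 o)%N.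
  by apply: inflow_le => y; exact: parallel_leS.
have := outs_step n o; case: (boolP (unstable _ _ _ _ _)) => [|_ h]; last first.
  by rewrite addn0 in h; rewrite (leq_trans h)// (leq_trans IHn)// leq_add2l.
rewrite /unstable /fill_rule /load -/(ins n o) -/(outs n o) => u h.
by move: u h inc => /=; lia.
Qed.

(** On [A] the origin topples at some step, when its load exceeds [eta]. Later topplings remove one
    particle at most and start only above [eta], so the load never falls below it again. *)
Let particles_eventually o : A o ->
  exists N, forall n, (N <= n)%N -> (masses o.1.2 0 <= particles n o)%N.
Proof.
move=> Ao; have ex0 := Ao 0 I.
have [N uN] : exists N, unstable (fill_rule (masses o.1.2)) (masses o.1.1) o.2
     (fun y => fill N y o) 0.
  apply: contrapT => /forallNP no; have [n] := ex0 1%N.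
  have -> : parallel (fill_rule (masses o.1.2)) (masses o.1.1) o.2 n 0 = 0%N.
    elim: n => //= n ->; have /negP/negbTE := no n.
    by rewrite /fill => ->.
  by [].
have step n : (masses o.1.2 0 <= particles n o)%N -> (masses o.1.2 0 <= particles n.+1 o)%N.
  have inc : (ins n o <= ins n.+1 o)%N.
    by apply: inflow_le => y; exact: parallel_leS.
  have := outs_step n o; have := balance n o; have := balance n.+1 o.
  case: (boolP (unstable _ _ _ _ _)); last by lia.
  rewrite /unstable /fill_rule /= -/(particles n o); lia.
exists N => n /subnK <-; elim: (n - N)%N => [|k IHk]; last by rewrite addSn step.
by move: uN; rewrite /unstable /fill_rule add0n /particles => /ltnW.
Qed.

Let integral_T y (f : space -> \bar R) : measurable_fun setT f -> (forall o, (0 <= f o)%E) ->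
  (\int[PP]_(o in A) f (T y o) = \int[PP]_(o in A) f o)%E.
Proof.
move=> mf f0.
apply: integral_preserve => //; first exact: PT.
exact: measurable_funS mf.
Qed.

Let flow_at n x e (o : space) : nat := flow o.2 (fun y => fill n y o) x e.

Let mflow_at n x e : dmeas (flow_at n x e). Proof. exact: dmeas_flow. Qed.

(** Mass transport: the flow into the origin along [e] is the flow out of the origin along [e] seen
    from the shifted space, and both the law and [A] are invariant. *)
Let ins_outs n :
  (\int[PP]_(o in A) (ins n o)%:R%:E = \int[PP]_(o in A) (outs n o)%:R%:E)%E.
Proof.
have expand (x : 'I_d * bool -> Zd d) :
   (\int[PP]_(o in A) (\sum_e flow_at n (x e) e o)%N%:R%:E =
    \sum_e \int[PP]_(o in A) (flow_at n (x e) e o)%:R%:E)%E.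
  rewrite -ge0_integral_sum//; first by
    apply: eq_integral => o _; rewrite natr_sum sumEFin.
  - by move=> e; exact: measurable_fun_nat (mflow_at n (x e) e).
rewrite (expand (fun e => 0 - dir e)) (expand (fun=> 0)); apply: eq_bigr => e _.
rewrite -(integral_T (dir e)) //; last exact: measurable_fun_nat (mflow_at n _ e).
apply: eq_integral => o _; congr ((_%:R)%:E); rewrite /flow_at /flow fill_T subrK.
apply: eq_count => j; rewrite /T/= /stack_shift/=; congr (o.2 (_, _) == _).
by rewrite subrK.
Qed.

Let outs_fin n : (\int[PP]_(o in A) (outs n o)%:R%:E < +oo)%E.
Proof.
apply: (@le_lt_trans _ _ (\int[PP]_(o in A) (cst n%:R%:E) o)%E).
  apply: ge0_le_integral => //; first exact: measurable_fun_nat.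
  move=> o _; rewrite lee_fin ler_nat; apply: (leq_trans (outflow_le _ _ _)).
  exact: parallel_le_time.
rewrite integral_cst// (le_lt_trans (lee_wpmul2l _ (probability_le1 _ mA)))// ?lee_fin//.
by rewrite mule1 ltry.
Qed.

Let integral_particles n :
  (\int[PP]_(o in A) (particles n o)%:R%:E = density mu * PP A)%E.
Proof.
rewrite -integral_xi.
have mN (f : space -> nat) : dmeas f -> measurable_fun A (fun o => (f o)%:R%:E : \bar R).
  exact: measurable_fun_nat.
have e : (\int[PP]_(o in A) (particles n o)%:R%:E + \int[PP]_(o in A) (outs n o)%:R%:E =
      \int[PP]_(o in A) (masses o.1.1 0)%:R%:E + \int[PP]_(o in A) (outs n o)%:R%:E)%E.
  rewrite -{2}ins_outs -!ge0_integralD//; try exact: mN.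
  by apply: eq_integral => o _; rewrite -!EFinD -!natrD balance.
(* Finite expectation of the flow, at most [n], allows cancelling it, even if the density of [mu]
   were infinite. *)
have fin : (\int[PP]_(o in A) (outs n o)%:R%:E)%E \is a fin_num.
  by rewrite ge0_fin_numE// integral_ge0.
by rewrite -[LHS](addeK _ fin) e addeK.
Qed.

(** The load truncated at [eta] converges to [eta] on [A] and is dominated by it, while the expected
    load on [A] never changes. Without truncation mass could be lost in the limit. *)
Lemma fill_mass_bound : (density nu < +oo)%E ->
  (density nu * PP A <= density mu * PP A)%E.
Proof.
move=> nufin; rewrite -integral_eta.
pose f n (o : space) : \bar R := (minn (particles n o) (masses o.1.2 0))%:R%:E.
pose g (o : space) : \bar R := (masses o.1.2 0)%:R%:E.
have mf n : measurable_fun A (f n).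
  by apply: measurable_fun_nat; exact: (dmeas_op minn).
have mg : measurable_fun A g by exact: measurable_fun_nat.
have cv : (\int[PP]_(o in A) f n o)%E @[n --> \oo] --> (\int[PP]_(o in A) g o)%E.
  apply: (@dominated_cvg _ _ _ PP A mA f g g) => //.
  - move=> o Ao; apply: cvg_near_cst; have [N HN] := particles_eventually Ao.
    exists N => // n /= /HN h; by rewrite /f /g (minn_idPr h).
  - apply/integrableP; split => //.
    rewrite (eq_integral g); last by move=> o _; rewrite gee0_abs ?lee_fin.
    rewrite integral_eta lte_mul_pinfty//; last exact: le_lt_trans (probability_le1 _ mA) (ltry 1).
      by apply: integral_ge0 => eta _; rewrite lee_fin.
    by rewrite ge0_fin_numE// integral_ge0.
  - by move=> n o _; rewrite gee0_abs ?lee_fin// ler_nat geq_minr.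
rewrite -(cvg_lim _ cv)//; apply: lime_le.
  by apply/cvg_ex; exists (\int[PP]_(o in A) g o)%E.
apply: nearW => n; rewrite -(integral_particles n); apply: ge0_le_integral => //.
- by move=> o _; rewrite lee_fin.
- exact: measurable_fun_nat.
- by move=> o _; rewrite lee_fin ler_nat geq_minl.
Qed.

Hypothesis density_lt : (density mu < density nu)%E.
Hypothesis nu_fin : (density nu < +oo)%E.
Hypothesis nu_fix : nu [set eta | explosion_prob Q eta <> 0%E] = 0%E.

Lemma no_fill : PP A = 0%E.
Proof.
have dn0 : (0 <= density mu)%E by apply: integral_ge0 => *; rewrite lee_fin.
have fn : density nu \is a fin_num by rewrite ge0_fin_numE// (le_trans dn0)// ltW.
have fm : density mu \is a fin_num by rewrite ge0_fin_numE// (lt_trans density_lt).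
have fA : PP A \is a fin_num.
  rewrite ge0_fin_numE; last exact: measure_ge0.
  exact: le_lt_trans (probability_le1 _ mA) (ltry 1).
have h0 : 0 <= fine (PP A) by apply: fine_ge0; exact: measure_ge0.
have := fill_mass_bound nu_fin; have := density_lt.
rewrite -(fineK fn) -(fineK fm) -(fineK fA) -!EFinM lte_fin !lee_fin => h1 h2.
congr EFin; apply/eqP; rewrite eq_le h0 andbT leNgt; apply/negP => a0.
by move: h2; rewrite leNgt ltr_pM2r// h1.
Qed.

Lemma explosion_prob_comparison : mu [set xi | explosion_prob Q xi <> 0%E] = 0%E.
Proof.
have fx0 x : PP (fillx x) = 0%E.
  have -> : fillx x = T x @^-1` fillx 0 by rewrite fillx_T add0r.
  rewrite PT//; have mD : measurable (fillx 0 `\` A) by exact: measurableD.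
  have U0 : PP ((fillx 0 `\` A) `|` A) = 0%E.
    by apply: null_set_setU => //; exact: no_fill.
  apply: (subset_measure0 _ _ _ U0) => //; first exact: measurableU.
  by move=> u h; have [Au|] := pselect (A u); [right|left].
pose B1 := \bigcup_x [set th : pair | Q [set w | fillx x (th, w)] <> 0%E].
have msec x : measurable_fun setT (fun th : pair => Q [set w | fillx x (th, w)]).
  have := measurable_fun_xsection Q (mfillx x); congr (measurable_fun _ _).
  apply/funext => th /=; congr (Q _).
  by apply/seteqP; split => y /=; rewrite /xsection/= ?inE.
have mB1x x : measurable [set th : pair | Q [set w | fillx x (th, w)] <> 0%E].
  rewrite (_ : [set th | _] = setT `&` [set th : pair | Q [set w | fillx x (th, w)] != 0%E]).
    exact: emeasurable_neq.
  by rewrite setTI; apply/seteqP; split => th /= /eqP.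
have mB1 : measurable B1 by apply: measurable_bigcup_count => x _; exact: mB1x.
have B10 : M B1 = 0%E.
  by apply: measure_bigcup_null => // x; exact: product_null_inv.
have mE : measurable_fun setT (explosion_prob Q : cfg d -> _) by exact: measurable_explosion_prob.
have mneq0 : measurable [set eta : cfg d | explosion_prob Q eta <> 0%E].
  rewrite (_ : [set th | _] = setT `&` [set th : cfg d | explosion_prob Q th != 0%E]).
    exact: emeasurable_neq.
  by rewrite setTI; apply/seteqP; split => th /= /eqP.
pose N2 := \bigcup_z translate z @^-1` [set eta : cfg d | explosion_prob Q eta <> 0%E].
have mN2x z : measurable (translate z @^-1` [set eta : cfg d | explosion_prob Q eta <> 0%E]).
  exact: measurable_preimage (measurable_translate z) mneq0.
have mN2 : measurable N2 by apply: measurable_bigcup_count => z _; exact: mN2x.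
have N20 : nu N2 = 0%E.
  apply: measure_bigcup_null => // z; by rewrite -[RHS]nu_fix; exact: nuE.1.
have B20 : M (setT `*` N2) = 0%E.
  transitivity (mu setT * nu N2)%E; first exact: product_measure1E.
  by rewrite N20 mule0.
have mB2 : measurable (setT `*` N2 : set pair) by exact: measurableX.
pose E := [set xi : cfg d | explosion_prob Q xi <> 0%E].
(* The event concerns [xi] alone but is excluded by means of a pair; once its product with [setT] is
   null under [M], so is [E] under [mu]. *)
have : M (E `*` setT) = 0%E.
  have U0 : M (B1 `|` (setT `*` N2)) = 0%E by exact: null_set_setU.
  apply: (subset_measure0 _ _ _ U0); [exact: measurableX|exact: measurableU|].
  move=> [xi eta] [/= Exi _].
  have [N2e|nN2] := pselect (N2 eta); first by right.
  left; apply: contrapT => nB1; apply: Exi.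
  apply: (no_explosion_transfer hp lam_gt0 Qcyl (eta := masses eta)) => x.
    by apply: contrapT => h; apply: nB1; exists x.
  have <- := explosion_prob_translate Qcyl x eta.
  by apply: contrapT => h; apply: nN2; exists x.
have -> : M (E `*` setT) = (mu E * nu setT)%E by exact: product_measure1E.
by rewrite probability_setT mule1.
Qed.

End comparison.

(** * Two particles per site *)

Section walkers.
Context (R : realType) (d : nat) (p : Zd d -> R) (lam : R).
Hypotheses (hp : jump_distribution p) (lam_gt0 : 0 < lam).
Local Notation q := (instr_prob p lam).
Variable Q : probability (stack d) R.
Hypothesis Qcyl : forall s f, uniq s -> Q (cyl s f) = (\prod_(k <- s) q (f k))%:E.

Let q_ge0 := instr_prob_ge0 hp lam_gt0.
Let q_sum1 := instr_prob_sum1 hp lam_gt0.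

Definition displacement (t : option ('I_d * bool)) : Zd d :=
  if t is Some e then dir e else 0.

(** One particle is carried for [j] instructions; a sleep leaves it in place, so its path is a lazy
    random walk. *)
Fixpoint walk (w : stack d) j x (s : history d) : history d :=
  if j is i.+1 then
    let t := w (x, visits s x) in walk w i (x + displacement t) ((x, t) :: s)
  else s.

Fixpoint walks (w : stack d) n B (s : history d) : history d :=
  if B is y :: B' then walks w n B' (walk w n y s) else s.

Fixpoint walk_mean j x (g : history d -> R) (s : history d) : R :=
  if j is i.+1 then \sum_t q t * walk_mean i (x + displacement t) g ((x, t) :: s) else g s.

Fixpoint walks_mean n B (g : history d -> R) (s : history d) : R :=
  if B is y :: B' then walk_mean n y (walks_mean n B' g) s else g s.

Let averageE (a : R) : a = \sum_t q t * a.
Proof. by rewrite -mulr_suml q_sum1 mul1r. Qed.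

(** Every instruction met by the walk is new, so conditioning on it multiplies the probability of
    the history by [q t]. *)
Lemma prob_walk (E : history d -> set (stack d)) (g : history d -> R) :
  (forall s, measurable (E s)) ->
  (forall s, Q ([set w | compat w s] `&` E s) = (hist_prob q s * g s)%:E) ->
  forall j x s, measurable [set w | E (walk w j x s) w] /\
  Q ([set w | compat w s] `&` [set w | E (walk w j x s) w]) =
  (hist_prob q s * walk_mean j x g s)%:E.
Proof.
move=> mE QE; elim=> [|j IHj] x s; first by split; [exact: mE|exact: QE].
have mS : measurable [set w | E (walk w j.+1 x s) w].
  rewrite (_ : [set w | _] = \bigcup_t ([set w : stack d | w (x, visits s x) = t] `&`
      [set w | E (walk w j (x + displacement t) ((x, t) :: s)) w])).
    apply: measurable_bigcup_count => t _; apply: measurableI.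
      exact: (dmeas_coord (x, visits s x) [set t]).
    by case: (IHj (x + displacement t) ((x, t) :: s)).
  apply/seteqP; split => w /= => [Ew|[t _ [<-]]//].
  by exists (w (x, visits s x)).
split=> //; rewrite (prob_split_coord _ (x, visits s x)); last first.
  by apply: measurableI => //; exact: measurable_compat.
rewrite mulr_sumr -sumEFin; apply: eq_bigr => t _.
rewrite mulrA [_ * q t]mulrC.
rewrite -[(q t * _)%R](_ : hist_prob q ((x, t) :: s) = _); last by rewrite /hist_prob big_cons.
have [_ <-] := IHj (x + displacement t) ((x, t) :: s).
congr (Q _); apply/seteqP; split => w /=.
  by move=> [[-> Ew] e]; rewrite e eqxx in Ew *.
by move=> [/andP[/eqP e ->] Ew]; rewrite e.
Qed.

Lemma prob_walks n B (K : set (history d)) s : measurable [set w | K (walks w n B s)] /\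
  Q ([set w | compat w s] `&` [set w | K (walks w n B s)]) =
  (hist_prob q s * walks_mean n B (fun s' => `[< K s' >]%:R) s)%:E.
Proof.
elim: B s => [|y B IHB] s /=; last first.
  apply: (@prob_walk (fun s => [set w | K (walks w n B s)])) => s'.
    exact: (IHB s').1.
  exact: (IHB s').2.
split; first exact: (dmeas_cst _ s K).
case: asboolP => Ks; last first.
  rewrite mulr0 (_ : _ `&` _ = set0) ?measure0//.
  by apply/seteqP; split => w // [].
rewrite mulr1 -(prob_compat q_ge0 Qcyl); congr (Q _).
by apply/seteqP; split => w // [].
Qed.

Lemma walk_mean_le j x (g g' : history d -> R) s :
  (forall s, g s <= g' s) -> walk_mean j x g s <= walk_mean j x g' s.
Proof.
move=> gg; elim: j x s => //= j IHj x s; apply: ler_sum => t _.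
exact: ler_wpM2l.
Qed.

Lemma walk_mean_lin j x (g g' : history d -> R) a b s :
  walk_mean j x (fun s => a * g s + b * g' s) s =
  a * walk_mean j x g s + b * walk_mean j x g' s.
Proof.
elim: j x s => //= j IHj x s; rewrite !mulr_sumr -big_split/=.
by apply: eq_bigr => t _; rewrite IHj; ring.
Qed.

Lemma walk_mean_cst j x a s : walk_mean j x (fun=> a) s = a.
Proof.
elim: j x s => //= j IHj x s; under eq_bigr do rewrite IHj.
by rewrite -mulr_suml q_sum1 mul1r.
Qed.

Lemma walks_mean_le n B (g g' : history d -> R) s :
  (forall s, g s <= g' s) -> walks_mean n B g s <= walks_mean n B g' s.
Proof. by move=> gg; elim: B s => //= y B IHB s; exact: walk_mean_le. Qed.

Lemma walk_mean_ext j x (g g' : history d -> R) s : g =1 g' ->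
  walk_mean j x g s = walk_mean j x g' s.
Proof. by move=> /funext ->. Qed.

Lemma walks_mean_lin n B (g g' : history d -> R) a b s :
  walks_mean n B (fun s => a * g s + b * g' s) s =
  a * walks_mean n B g s + b * walks_mean n B g' s.
Proof.
elim: B s => //= y B IHB s; rewrite -walk_mean_lin.
by apply: walk_mean_ext => s'; exact: IHB.
Qed.

Lemma walks_mean_cst n B a s : walks_mean n B (fun=> a) s = a.
Proof.
elim: B s => //= y B IHB s; rewrite -[RHS](walk_mean_cst n y a s).
by apply: walk_mean_ext => s'; exact: IHB.
Qed.

(** Truncated Green function: the expected number of visits to the origin among the first [j]
    positions of the lazy walk from [x]. *)
Fixpoint green j (x : Zd d) : R :=
  if j is i.+1 then (x == 0)%:R + \sum_t q t * green i (x + displacement t) else 0.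

Lemma green_ge0 j x : 0 <= green j x.
Proof.
elim: j x => //= j IHj x; rewrite addr_ge0//; apply: sumr_ge0 => t _.
exact: mulr_ge0.
Qed.

Lemma green_le j x : green j x <= j%:R.
Proof.
elim: j x => //= j IHj x; rewrite -natr1 addrC lerD//; last by case: (_ == _).
rewrite [leRHS]averageE; apply: ler_sum => t _.
exact: ler_wpM2l.
Qed.

Let Z (s : history d) : R := (visits s 0)%:R.

Let Z_cons x t s : Z ((x, t) :: s) = Z s + (x == 0)%:R.
Proof. by rewrite /Z visits_cons /incr natrD /= eq_sym. Qed.

Lemma walk_mean_visits j x s : walk_mean j x Z s = Z s + green j x.
Proof.
elim: j x s => [|j IHj] x s /=; first by rewrite addr0.
under eq_bigr do rewrite IHj Z_cons mulrDr.
by rewrite big_split/= -mulr_suml q_sum1 mul1r addrA.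
Qed.

(** The number [V] of new visits is at most [j], so [V ^+ 2 <= j * V]; the rest is the expansion of
    the square. *)
Lemma walk_mean_visits2 j x a s : 0 <= a ->
  walk_mean j x (fun s => (Z s + a) ^+ 2) s <=
  (Z s + a) ^+ 2 + 2 * (Z s + a) * green j x + j%:R * green j x.
Proof.
move=> a0; elim: j x s => [|j IHj] x s /=; first by rewrite !mulr0 !addr0.
pose u := \sum_t q t * green j (x + displacement t).
pose de : R := (x == 0)%:R.
have u0 : 0 <= u by apply: sumr_ge0 => t _; rewrite mulr_ge0// green_ge0.
have uj : u <= j%:R.
  rewrite [leRHS]averageE; apply: ler_sum => t _.
  by apply: ler_wpM2l => //; exact: green_le.
rewrite -/de -/u.
apply: (@le_trans _ _ ((Z s + de + a) ^+ 2 + 2 * (Z s + de + a) * u + j%:R * u)).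
  rewrite /u mulr_sumr [j%:R * _]mulr_sumr -addrA -big_split/=.
  rewrite [X in X + _]averageE -big_split/=; apply: ler_sum => t _.
  apply: (le_trans (ler_wpM2l (q_ge0 t) (IHj _ _))); rewrite Z_cons -/de.
  by rewrite le_eqVlt; apply/orP; left; apply/eqP; ring.
rewrite -[j.+1%:R]natr1; have : de = 0 \/ de = 1 by rewrite /de; case: (x == 0); [right|left].
have Z0 : 0 <= Z s by rewrite /Z.
move: (Z s) Z0 (j%:R : R) uj => z z0 J uJ.
case=> ->; rewrite -subr_ge0.
  by rewrite (_ : _ - _ = u)//; ring.
by rewrite (_ : _ - _ = J - u) ?subr_ge0//; ring.
Qed.

Let total n B : R := \sum_(y <- B) green n y.

Lemma walks_mean_visits n B s : walks_mean n B Z s = Z s + total n B.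
Proof.
elim: B s => [|y B IHB] s; first by rewrite /total big_nil addr0.
rewrite /=; transitivity (walk_mean n y (fun s => 1 * Z s + total n B * (fun=> 1) s) s).
  by apply: walk_mean_ext => s'; rewrite IHB mul1r mulr1.
by rewrite walk_mean_lin walk_mean_cst walk_mean_visits /total big_cons; ring.
Qed.

(** Successive walks use fresh instructions, so the cross terms factor and only the term [n * V] of
    each walk is added to the square of the mean. *)
Lemma walks_mean_visits2 n B s :
  walks_mean n B (fun s => Z s ^+ 2) s <=
  (Z s + total n B) ^+ 2 + n%:R * total n B.
Proof.
have t0 B' : 0 <= total n B' by apply: sumr_ge0 => y _; exact: green_ge0.
elim: B s => [|y B IHB] s; first by rewrite /total big_nil !addr0 mulr0 addr0.
rewrite /=; apply: le_trans (walk_mean_le n y s IHB) _.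
rewrite (_ : walk_mean n y _ s = walk_mean n y (fun s => 1 * (Z s + total n B) ^+ 2 +
    (n%:R * total n B) * (fun=> 1) s) s); last first.
  by apply: walk_mean_ext => s'; rewrite mul1r mulr1.
rewrite walk_mean_lin walk_mean_cst mul1r mulr1.
have := @walk_mean_visits2 n y (total n B) s (t0 B).
rewrite (_ : total n (y :: B) = green n y + total n B); last by rewrite /total big_cons.
have : 0 <= Z s by rewrite /Z.
have := green_ge0 n y; have := t0 B; have : 0 <= n%:R :> R by [].
move: (n%:R : R) (Z s) (total n B) (green n y) (walk_mean _ _ _ _) => N z mu v m N0 mu0 v0 z0 h.
have := sqr_ge0 v; nra.
Qed.

Lemma green_support j : exists A : {fset Zd d}, forall x, x \notin A -> green j x = 0.
Proof.
elim: j => [|j [A HA]]; first by exists fset0.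
exists [fset x in (0 :: flatten [seq [seq y - displacement t | t <- enum {: option ('I_d * bool)}] | y <- A])]%fset => x.
rewrite !inE negb_or => /andP[x0 xA] /=; rewrite (negbTE x0) add0r big1// => t _.
rewrite HA ?mulr0//; apply: contra xA => xt.
apply/flattenP; exists [seq x + displacement t - displacement t' | t' <- enum {: option ('I_d * bool)}].
  by apply/mapP; exists (x + displacement t).
by apply/mapP; exists t; rewrite ?mem_enum// addrK.
Qed.

(** With one walk started at each site, translation invariance gives exactly one expected walker at
    the origin at each time. *)
Lemma green_total j : \sum_(x \in [set: Zd d]) green j x = j%:R.
Proof.
elim: j => [|j IHj]; first by rewrite (@fsbigTE _ _ _ _ fset0)// big_seq_fset0.
have [A HA] := green_support j; have [A' HA'] := green_support j.+1.
pose sh t := [fset (x - displacement t) | x in A]%fset.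
pose A2 := (A' `|` [fset (0 : Zd d)] `|` \bigcup_(t <- enum {: option ('I_d * bool)}) sh t)%fset.
have A2sh t x : x \notin A2 -> green j (x + displacement t) = 0.
  rewrite !inE !negb_or => /andP[_ xn]; apply: HA; apply: contra xn => xt.
  apply/bigfcupP; exists t; first by rewrite mem_enum.
  by apply/imfsetP; exists (x + displacement t) => //; rewrite addrK.
rewrite (@fsbigTE _ _ _ _ A2); last first.
  by move=> x; rewrite !inE !negb_or -andbA => /and3P[xA _ _]; exact: HA'.
rewrite /= big_split/= exchange_big/= -natr1 addrC; congr (_ + _).
  transitivity (\sum_t q t * j%:R); last by rewrite -mulr_suml q_sum1 mul1r.
  apply: eq_bigr => t _; rewrite -mulr_sumr; congr (_ * _).
  rewrite -(@fsbigTE _ _ _ _ A2 (fun x => green j (x + displacement t)) (A2sh t)).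
  rewrite -IHj [RHS](reindex_fsbigT (fun x => x + displacement t))//.
  by exists (fun x => x - displacement t) => x; rewrite ?addrK ?subrK.
have A20 : 0 \in A2 by rewrite !inE eqxx orbT.
rewrite (bigD1_seq 0 A20 (fset_uniq _))/=.
by rewrite eqxx big1 ?addr0// => x /negbTE ->.
Qed.

Lemma green_starts n : exists B : seq (Zd d), uniq B /\ total n B = n%:R.
Proof.
have [A HA] := green_support n; exists A; split; first exact: fset_uniq.
by rewrite -[RHS]green_total (@fsbigTE _ _ _ _ A (green n) HA).
Qed.

Lemma visits_prob_bound n : (0 < n)%N -> exists B : seq (Zd d), uniq B /\
  1 / 8 <= prob Q [set w | (n <= 2 * visits (walks w n B [::]) 0)%N].
Proof.
move=> n0; have [B [uB tB]] := green_starts n; exists B; split => //.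
pose K : set (history d) := [set s | (n <= 2 * visits s 0)%N].
have [_] := prob_walks n B K [::].
have -> : [set w | compat w [::]] = [set: stack d] by apply/seteqP; split.
rewrite setTI /hist_prob big_nil mul1r /prob => ->/=.
pose N : R := n%:R; have N0 : 0 < N by rewrite ltr0n.
(* If [Z < N / 2] the first term suffices; otherwise [Z <= Z ^+ 2 / (8 * N) + 2 * N]. The mean is
   [N] and the second moment at most [2 * N ^+ 2], so averaging gives
   [N <= N / 2 + N / 4 + 2 * N * P], hence [P >= 1 / 8]. *)
have pw s : Z s <= 1 * (N / 2 + (8 * N)^-1 * Z s ^+ 2) + (2 * N) * `[< K s >]%:R.
  have Z0 : 0 <= Z s by rewrite /Z.
  case: asboolP => /= Ks.
    have : Z s <= (8 * N)^-1 * Z s ^+ 2 + 2 * N.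
      rewrite -subr_ge0 (_ : _ - _ = (8 * N)^-1 * (Z s - 4 * N) ^+ 2).
        by rewrite mulr_ge0 ?sqr_ge0// invr_ge0; lra.
      by field; lra.
    by lra.
  have : Z s <= N / 2.
    move: Ks; rewrite /K/= => /negP; rewrite -ltnNge => /ltnW.
    by rewrite -(ler_nat R) natrM -/(Z s) -/N; lra.
  have : 0 <= (8 * N)^-1 * Z s ^+ 2.
    by rewrite mulr_ge0 ?sqr_ge0// invr_ge0; lra.
  by rewrite mulr0; lra.
have := walks_mean_le n B [::] pw.
rewrite walks_mean_visits walks_mean_lin.
have -> : walks_mean n B (fun s => N / 2 + (8 * N)^-1 * Z s ^+ 2) [::] =
    N / 2 + (8 * N)^-1 * walks_mean n B (fun s => Z s ^+ 2) [::].
  transitivity (walks_mean n B (fun s => N / 2 * (fun=> 1) s + (8 * N)^-1 * Z s ^+ 2) [::]).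
    by congr (walks_mean _ _ _ _); apply/funext => s; rewrite mulr1.
  by rewrite walks_mean_lin walks_mean_cst mulr1.
have := walks_mean_visits2 n B [::]; rewrite tB -/N.
have -> : Z [::] = 0 by [].
rewrite !add0r => h2.
have h3 : (8 * N)^-1 * walks_mean n B (fun s => Z s ^+ 2) [::] <= N / 4.
  apply: (@le_trans _ _ ((8 * N)^-1 * (N ^+ 2 + N * N))).
    by apply: ler_wpM2l => //; rewrite invr_ge0; lra.
  by rewrite le_eqVlt; apply/orP; left; apply/eqP; field; lra.
move=> h4; have h5 : N / 4 <= 2 * N * walks_mean n B (fun s => `[< K s >]%:R) [::] by lra.
by rewrite -(ler_pM2l (_ : 0 < 2 * N)); lra.
Qed.

Let two : Zd d -> nat := fun=> 2%N.

Let height (w : stack d) (s : history d) (x : Zd d) : nat := load two w (visits s) x.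

Let height_step w s x y : (1 < height w s x)%N -> (0 < height w s y)%N ->
  (height w ((x, w (x, visits s x)) :: s) y + (y == x) =
   height w s y + (y == (x + displacement (w (x, visits s x)))%R))%N.
Proof.
rewrite /height /load visits_cons inflow_incr outflow_incr /displacement /two.
case: (w (x, visits s x)) => [e|] /=; last by rewrite addr0 andbF; lia.
by rewrite andbT; case: eqVneq => [->|]; case: (_ == _) => /=; lia.
Qed.

(** All sites stay occupied and the carried particle always shares its site with another one, so
    every step topples a load of at least two, which is legal whatever the last instruction was. *)
Lemma walk_legal w j x s m :
  (forall y, (visits s y <= parallel (@arw_rule d) two w m y)%N) ->
  (forall y, (0 < height w s y)%N) -> (1 < height w s x)%N ->
  (forall y, (visits (walk w j x s) y <= parallel (@arw_rule d) two w (m + j) y)%N) /\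
  exists z, forall y, (height w (walk w j x s) y + (y == x) = height w s y + (y == z))%N.
Proof.
elim: j x s m => [|j IHj] x s m vs hs hx.
  by rewrite addn0; split => //; exists x.
pose t := w (x, visits s x).
have step y : (height w ((x, t) :: s) y + (y == x) =
    height w s y + (y == (x + displacement t)%R))%N by exact: height_step.
have [||| h1 [z hz]] := IHj (x + displacement t) ((x, t) :: s) m.+1.
- move=> y; rewrite visits_cons; apply: parallel_step => //; first exact: arw_rule_mono.
  by apply: arw_rule_big.
- by move=> y; have := step y; have := hs y; case: eqVneq => [->|]; case: (_ == _); lia.
- by have := step (x + displacement t); rewrite eqxx; have := hs (x + displacement t);
    case: eqVneq => [e|]; rewrite ?e; lia.
rewrite addnS -addSn; split => //; exists z => y.
by have := hz y; have := step y; rewrite /= -/t; lia.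
Qed.

(** A finished walk takes a particle away only from its own start; since starts are distinct, the
    later ones still hold two. *)
Lemma walks_legal w n B s m : uniq B ->
  (forall y, (visits s y <= parallel (@arw_rule d) two w m y)%N) ->
  (forall y, (0 < height w s y)%N) -> (forall y, y \in B -> (1 < height w s y)%N) ->
  exists m', forall y, (visits (walks w n B s) y <= parallel (@arw_rule d) two w m' y)%N.
Proof.
elim: B s m => [|b B IHB] s m; first by exists m.
move=> /= /andP[bB uB] vs hs hB.
have hb := hB b (mem_head _ _).
have [h1 [z hz]] := walk_legal n vs hs hb.
apply: (IHB _ (m + n)%N) => //.
  by move=> y; have := hz y; have := hs y; case: eqVneq => [->|]; lia.
move=> y yB; have := hz y; have := hB y; rewrite inE yB orbT => /(_ isT).
by case: eqVneq => [e|_]; [rewrite e (negbTE bB) in yB|lia].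
Qed.

Lemma two_explodes : prob Q [set w | explodes (@arw_rule d) two w 0] != 0.
Proof.
pose F k := \bigcup_m [set w : stack d | (k <= parallel (@arw_rule d) two w m 0)%N].
have mpar m : dmeas (fun w : stack d => parallel (@arw_rule d) two w m 0).
  apply: (@dmeas_parallel _ (stack d) d (fun=> @arw_rule d) (fun=> two) id) => *;
    [exact: dmeas_cst|exact: dmeas_cst|exact: dmeas_coord].
have mF k : measurable (F k).
  by apply: bigcupT_measurable => m; exact: (dmeas_set (fun j => (k <= j)%N) (mpar m)).
have Fk k : 1 / 8 <= prob Q (F k).
  (* Half of [2 * k + 2] exceeds [k], and the length is positive even for [k = 0]. *)
  have [B [uB hB]] := @visits_prob_bound (2 * k).+2 isT.
  apply: (le_trans hB); apply: prob_sub => //.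
    have [mm _] := prob_walks (2 * k).+2 B [set s | ((2 * k).+2 <= 2 * visits s 0)%N] [::].
    exact: mm.
  move=> w /= hw.
  have [| | |m' hm'] := @walks_legal w (2 * k).+2 B [::] 0 uB.
  - by [].
  - by move=> y; rewrite /height /load /two outflowE.
  - by move=> y _; rewrite /height /load /two outflowE.
  exists m' => //=; apply: leq_trans (hm' 0); lia.
have -> : [set w | explodes (@arw_rule d) two w 0] = \bigcap_k F k.
  apply/seteqP; split => w /= h k; first by move=> _; have [m hm] := h k; exists m.
  by have [m _ hm] := h k I; exists m.
apply/negP => /eqP e.
have [||k hk] := @prob_nonincreasing _ _ _ Q F (1 / 8) mF.
- by move=> n m nm w [j _ hj]; exists j => //=; exact: leq_trans hj.
- by rewrite e; lra.
by have := Fk k; rewrite leNgt hk.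
Qed.

End walkers.

(** * The finite-volume chain read from stacks *)

Lemma dmeas_measurable_fun d1 d2 (X : measurableType d1) (Y : measurableType d2)
  (f : X -> Y) : dmeas f -> measurable_fun setT f.
Proof. by move=> mf _ B _; rewrite setTI; exact: mf. Qed.

Lemma dir_neq0 d (e : 'I_d * bool) : dir e != 0.
Proof.
apply/eqP => h; have := congr1 (fun z : Zd d => z ord0 e.1) h.
by rewrite /dir; case: e {h} => i [] /=; rewrite !mxE !eqxx.
Qed.

(** Sleeping is placed between one and two active particles: falling asleep and receiving a particle
    both raise the rank, so it drops exactly at departures. *)
Definition rank (k : occupation) : nat :=
  match k with Active 0 => 0 | Active 1 => 1 | Sleeping => 2 | Active n => n.+1 end%N.

Definition topple d (x : Zd d) (t : option ('I_d * bool)) (eta : cfg d) : cfg d :=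
  if t is Some e then jump x (x + dir e) eta else sleep_at x eta.

Section topplings.
Context (d : nat).
Implicit Types (eta : cfg d) (x y z : Zd d) (w : stack d) (xi h : Zd d -> nat).

Lemma toppleE x t eta z : topple x t eta z =
  if t is Some e then
    if z == x then lose (eta z) else if z == x + dir e then gain (eta z) else eta z
  else if z == x then fall_asleep (eta z) else eta z.
Proof. by case: t. Qed.

Definition loses (k k' : occupation) : bool := (rank k' < rank k)%N.

(** [loses] survives the omission of intermediate states, which suits upper bounds. Requiring also
    an active earlier state makes each observed drop a witness of activity, which suits lower
    bounds. *)
Definition active_loses (k k' : occupation) : bool := (0 < active k)%N && loses k k'.

Definition detects (rho : occupation -> occupation -> bool) :=
  forall eta x t z, (0 < active (eta x))%N ->
  rho (eta z) (topple x t eta z) = (z == x) && (t != None).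

Lemma detects_loses : detects loses.
Proof.
move=> eta x t z act; rewrite toppleE /loses; case: t => [e|] /=.
  case: eqVneq => [->|_] /=.
    by move: act; case: (eta x) => [[|[|[|n]]]|]//= _; rewrite ltnSn.
  by case: ifP => _; rewrite ?ltnn//; case: (eta z) => [[|[|n]]|]//=; rewrite ltnNge leqnSn.
rewrite andbF; case: eqVneq => [->|_]; last by rewrite ltnn.
by case: (eta x) => [[|[|n]]|]//=; rewrite ltnn.
Qed.

Lemma detects_active_loses : detects active_loses.
Proof.
move=> eta x t z act; rewrite /active_loses detects_loses//.
by case: eqVneq => [->|_]; rewrite ?act ?andbF.
Qed.

Definition site_state xi w h x : occupation :=
  if (load xi w h x == 1%N) && asleep w h x then Sleeping else Active (load xi w h x).

(** What is remembered of the legality of past topplings: exactness of the subtraction in [load],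
    and presence of the particle put to sleep. *)
Definition balanced xi w h := forall x,
  (outflow w h x <= xi x + inflow w h x)%N /\ (asleep w h x -> (0 < load xi w h x)%N).

Definition represents xi w h eta := eta = site_state xi w h /\ balanced xi w h.

Lemma active_unstable xi w h eta x : represents xi w h eta ->
  (0 < active (eta x))%N = unstable (@arw_rule d) xi w h x.
Proof.
move=> [-> _]; rewrite /site_state /unstable /arw_rule.
by case: (load xi w h x) => [|[|n]] //=; case: (asleep w h x).
Qed.

Lemma asleep_incr w h x : asleep w (incr h x) x = (w (x, h x) == None).
Proof. by rewrite /asleep /incr eqxx addn1. Qed.

Lemma asleep_incr_neq w h x z : z != x -> asleep w (incr h x) z = asleep w h z.
Proof. by move=> zx; apply: asleep_local; rewrite /incr (negbTE zx) addn0. Qed.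

(** The only delicate site is a neighbour that receives a particle: if marked asleep it is not empty
    by [balanced], so its load becomes two or more and the mark has no effect, as in [s + 1 = 2]. *)
Lemma represents_topple xi w h eta x : represents xi w h eta -> (0 < active (eta x))%N ->
  represents xi w (incr h x) (topple x (w (x, h x)) eta).
Proof.
move=> rep act; have [eE bal] := rep.
have lx : (0 < load xi w h x)%N.
  by move: act; rewrite eE /site_state; case: (load xi w h x) => [|n]//; rewrite if_same.
have notS : eta x = Active (load xi w h x).
  by move: act; rewrite eE /site_state; case: ifP.
set t := w (x, h x).
pose up z : nat := if t is Some e then z == x + dir e else false.
pose dn z : nat := (z == x) && (t != None).
have inE z : inflow w (incr h x) z = (inflow w h z + up z)%N by rewrite inflow_incr.
have outE z : outflow w (incr h x) z = (outflow w h z + dn z)%N by rewrite outflow_incr.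
have ldE z : (load xi w (incr h x) z = load xi w h z + up z - dn z)%N.
  rewrite /load inE outE; have [b _] := bal z; lia.
split; last first.
  move=> z; have [b1 b2] := bal z; split.
    rewrite inE outE /dn; case: eqVneq => [zx|_]; last by rewrite addn0; lia.
    by subst z; move: lx; rewrite /load; case: (t != None) => /=; lia.
  rewrite ldE; case: (eqVneq z x) => [->|zx].
    by rewrite asleep_incr -/t => /eqP t0; rewrite /dn /up t0 eqxx/=; lia.
  by rewrite asleep_incr_neq// /dn (negbTE zx) subn0 => /b2; lia.
apply/funext => z; rewrite toppleE -/t /site_state ldE.
case: (eqVneq z x) => [->|zx].
  rewrite asleep_incr -/t notS /up /dn; case: (t) => [e|] /=.
    by rewrite eqxx andbF addrC -subr_eq subrr eq_sym (negbTE (dir_neq0 e)) addn0 subn1.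
  by rewrite eqxx addn0 subn0 andbT; case: (load xi w h x) lx => [|[|n]].
have dz : dn z = 0%N by rewrite /dn (negbTE zx).
rewrite asleep_incr_neq// dz subn0 /up; case E: t => [e|]; last by rewrite addn0 eE.
case: eqVneq => [_|_]; last by rewrite addn0 eE.
rewrite eE /site_state addn1; have [_ b2] := bal z.
case: (load xi w h z) b2 => [|[|n]] /=.
- by case: (asleep w h z) => // /(_ isT).
- by case: (asleep w h z).
- by [].
Qed.

Lemma represents0 xi w eta : (forall x, eta x = Active (xi x)) ->
  represents xi w (fun=> 0%N) eta.
Proof.
move=> exi; have l0 x : load xi w (fun=> 0%N) x = xi x.
  rewrite /load outflowE subn0 /inflow big1 ?addn0// => e _.
split.
  by apply/funext => x; rewrite /site_state l0 /asleep andbF exi.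
by move=> x; split; [rewrite outflowE|].
Qed.

(** At the first step where parallel toppling overtakes [h], it does so at a site where both agree
    and all else is behind [h]; by attractivity this site is unstable for [h]. *)
Lemma parallel_progress xi0 xi w h n0 : (forall x, (xi0 x <= xi x)%N) ->
  (exists z, (h z < parallel (@arw_rule d) xi0 w n0 z)%N) ->
  exists x, (h x < parallel (@arw_rule d) xi0 w n0 x)%N /\ unstable (@arw_rule d) xi w h x.
Proof.
move=> xx; elim: n0 => [[]//|n IHn] [z hz].
have [/IHn[x [hx ux]]|] := pselect (exists z, (h z < parallel (@arw_rule d) xi0 w n z)%N).
  by exists x; split => //; rewrite (leq_trans hx)// parallel_leS.
move=> /forallNP nz; have le y : (parallel (@arw_rule d) xi0 w n y <= h y)%N.
  by rewrite leqNgt; apply/negP/nz.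
exists z; split => //; move: hz => /=.
case: (boolP (unstable _ _ _ _ z)) => [u|_]; last by rewrite addn0 ltnNge le.
rewrite addn1 ltnS => hz.
apply: (attractive (@arw_rule_mono d) xx le _ u).
by apply/eqP; rewrite eqn_leq le.
Qed.


Lemma parallel_support (V : {fset Zd d}) n : exists U : {fset Zd d}, forall xi w,
  (forall y, y \notin V -> xi y = 0%N) ->
  forall y, y \notin U -> parallel (@arw_rule d) xi w n y = 0%N.
Proof.
elim: n => [|n [U IHn]]; first by exists fset0.
exists (U `|` V `|` [fset z in [seq (v + dir e)%R | v <- enum_fset U, e <- enum {: 'I_d * bool}]])%fset => xi w xi0 y.
rewrite !inE !negb_or => /andP[/andP[yU yV] yn] /=.
rewrite (IHn _ _ xi0 _ yU) /unstable /load xi0// add0n /inflow big1 ?sub0n ?/arw_rule//.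
move=> e _; rewrite /flow (IHn _ _ xi0)//; apply: contra yn => ye.
rewrite -[X in X \in _](subrK (dir e)).
by apply: (allpairs_f (fun (v : Zd d) e => v + dir e)) => //; rewrite mem_enum.
Qed.

Fixpoint drops (rho : occupation -> occupation -> bool) x (l : seq (cfg d)) : nat :=
  if l is eta :: l' then
    ((if l' is eta' :: _ then rho (eta' x) (eta x) else false) + drops rho x l')%N
  else 0%N.

End topplings.

(** * Averages along the jump chain, with fresh or with prescribed instructions *)

Section chain.
Context (R : realType) (d : nat) (p : Zd d -> R) (lam : R).
Hypotheses (hp : jump_distribution p) (lam_gt0 : 0 < lam).
Local Notation q := (instr_prob p lam).
Implicit Types (eta : cfg d) (x : Zd d) (w : stack d) (l : seq (cfg d)) (s : history d).

Let q_ge0 := instr_prob_ge0 hp lam_gt0.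
Let q_sum1 := instr_prob_sum1 hp lam_gt0.
Let lam1 := lam1_gt0 lam_gt0.

Definition particle_count (N : nat) eta := exists A : {fset Zd d},
  (forall x, x \notin A -> eta x = Active 0) /\ (\sum_(x <- A) mass (eta x) = N)%N.

Definition supp eta : {fset Zd d} := fset_set [set x | (0 < active (eta x))%N].

Lemma in_supp N eta x : particle_count N eta -> (x \in supp eta) = (0 < active (eta x))%N.
Proof.
move=> [A [A0 _]]; rewrite /supp in_fset_set.
  by apply/idP/idP; rewrite inE.
apply: (@sub_finite_set _ _ [set` A]) => // y /= ay.
by apply: contraTT ay => /A0 ->.
Qed.

Lemma particle_rate N eta : particle_count N eta -> exists A : {fset Zd d},
  [/\ forall x, x \notin A -> eta x = Active 0, (\sum_(x <- A) mass (eta x) = N)%N &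
  total_rate lam eta = \sum_(x <- A) ring_rate lam (eta x)].
Proof.
move=> [A [A0 AN]]; exists A; split => //.
by rewrite /total_rate (@fsbigTE _ _ _ _ A)// => x /A0 ->; rewrite /ring_rate mulr0.
Qed.

Lemma ring_rate_ge0 (k : occupation) : 0 <= ring_rate lam k.
Proof. by rewrite /ring_rate mulr_ge0// ltW. Qed.

Lemma total_rate_le N eta : particle_count N eta ->
  total_rate lam eta <= (1 + lam) * N%:R.
Proof.
move=> /particle_rate[A [_ <- ->]]; rewrite natr_sum mulr_sumr ler_sum// => x _.
by rewrite /ring_rate ler_wpM2l ?(ltW lam1)// ler_nat; case: (eta x).
Qed.

Lemma total_rateE N eta : particle_count N eta ->
  total_rate lam eta = \sum_(x <- supp eta) ring_rate lam (eta x).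
Proof.
move=> pc; rewrite /total_rate (@fsbigTE _ _ _ _ (supp eta))// => x.
by rewrite (in_supp _ pc) -eqn0Ngt /ring_rate => /eqP ->; rewrite mulr0.
Qed.

Lemma total_rate_ge0 eta : 0 <= total_rate lam eta.
Proof. by apply: fsumr_ge0 => x _; exact: ring_rate_ge0. Qed.

Lemma ring_rate_ge (k : occupation) : (0 < active k)%N -> 1 + lam <= ring_rate lam k.
Proof. by move=> ak; rewrite /ring_rate ler_peMr ?(ltW lam1)// ler1n. Qed.

Lemma total_rate_gt0 N eta x : particle_count N eta -> (0 < active (eta x))%N ->
  0 < total_rate lam eta.
Proof.
move=> pc ax; rewrite (total_rateE pc) (bigD1_seq x)/=; last 2 first.
- by rewrite (in_supp _ pc).
- exact: fset_uniq.
apply: (lt_le_trans lam1); rewrite -[leLHS]addr0 lerD ?ring_rate_ge//.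
by apply: sumr_ge0 => y _; exact: ring_rate_ge0.
Qed.

Lemma particle_count_topple N eta x t : particle_count N eta -> (0 < active (eta x))%N ->
  particle_count N (topple x t eta).
Proof.
move=> [A [A0 AN]] ax.
have xA : x \in A by apply: contraTT ax => /A0 ->.
pose y := if t is Some e then x + dir e else x.
have yE e : t = Some e -> y != x.
  by move=> te; rewrite /y te /= -[X in _ != X]addr0 (inj_eq (addrI x)) dir_neq0.
pose B := (A `|` [fset y])%fset.
have xB : x \in B by rewrite inE xA.
have yB : y \in B by rewrite !inE eqxx orbT.
exists B; split.
  move=> z; rewrite !inE negb_or => /andP[zA /negbTE zy]; rewrite toppleE.
  have zx : (z == x) = false by apply: contraNF zA => /eqP ->.
  by rewrite zx; move: zy; rewrite /y; case: (t) => [e /= ->|_]; rewrite A0.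
have one (z : Zd d) : z \in B -> (\sum_(v <- B) (v == z) = 1)%N.
  move=> zB; rewrite (bigD1_seq z) ?fset_uniq//= eqxx big1 ?addn0// => v /negPf ->//.
have NB : (\sum_(v <- B) mass (eta v) = N)%N.
  rewrite -AN; apply/esym/big_fset_incl; first exact: fsubsetUl.
  by move=> v _ /A0 ->.
suff : (\sum_(v <- B) (mass (topple x t eta v) + (v == x)) = \sum_(v <- B) (mass (eta v) + (v == y)))%N.
  by rewrite !big_split/= !one// NB !addn1 => -[].
apply: eq_bigr => v _; rewrite toppleE; move: yE; rewrite /y; case: (t) => [e|] /= yE.
  have /negbTE ye := yE e erefl.
  case: (eqVneq v x) => [->|vx]; first by rewrite eq_sym ye addn0; case: (eta x) ax => [[|n]|]//= _; rewrite addn1.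
  by rewrite addn0; case: eqP => _; rewrite ?addn0//; case: (eta v) => [n|]/=; rewrite addn1.
by case: eqVneq => [->|_]//; case: (eta x) => [[|[|n]]|].
Qed.

Lemma ring_probE N eta eta' : particle_count N eta -> total_rate lam eta != 0 ->
  ring_prob p lam eta eta' = \sum_(x <- supp eta) ring_rate lam (eta x) / total_rate lam eta *
    \sum_t q t * `[< eta' = topple x t eta >]%:R.
Proof.
move=> pc /negbTE R0; rewrite /ring_prob R0 (@fsbigTE _ _ _ _ (supp eta)); last first.
  by move=> x; rewrite (in_supp _ pc) -eqn0Ngt /ring_rate => /eqP ->; rewrite mulr0 !mul0r.
apply: eq_bigr => x _; rewrite big_option; congr (_ * (_ + _)).
rewrite (@reindex_fsbigT _ _ _ _ _ (fun z => z + x)); last first.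
  by exists (fun z => z - x) => z; rewrite ?addrK ?subrK.
under eq_fsbigr do rewrite addrK.
rewrite (@sum_dir _ _ _ hp (fun z => p z / (1 + lam) * `[< eta' = jump x (z + x) eta >]%:R)).
  by apply: eq_bigr => e _; rewrite /= (addrC x).
by move=> z ->; rewrite !mul0r.
Qed.

Implicit Types (kap : history d -> Zd d -> option ('I_d * bool) -> R) (F : seq (cfg d) -> R).

(** The site to be served is chosen by the rates in either case; only the law [kap] of the
    instruction distinguishes fresh instructions from those read in a given stack. *)
Definition step kap s eta (f : Zd d -> option ('I_d * bool) -> R) : R :=
  \sum_(x <- supp eta) ring_rate lam (eta x) / total_rate lam eta * \sum_t kap s x t * f x t.

Fixpoint mean kap n F s eta l : R :=
  if n is m.+1 then
    if total_rate lam eta == 0 then mean kap m F s eta (eta :: l)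
    else step kap s eta (fun x t => mean kap m F ((x, t) :: s) (topple x t eta) (eta :: l))
  else F (eta :: l).

Definition kernel kap :=
  (forall s x t, 0 <= kap s x t) /\ (forall s x, \sum_t kap s x t = 1).

Lemma step_le N kap s eta f g : kernel kap -> particle_count N eta ->
  (forall x t, (0 < active (eta x))%N -> kap s x t != 0 -> f x t <= g x t) ->
  step kap s eta f <= step kap s eta g.
Proof.
move=> [k0 _] pc fg; rewrite /step big_seq [leRHS]big_seq; apply: ler_sum => x.
rewrite (in_supp _ pc) => ax; apply: ler_wpM2l.
  by rewrite divr_ge0 ?ring_rate_ge0// total_rate_ge0.
apply: ler_sum => t _; have [->|kt] := eqVneq (kap s x t) 0; first by rewrite !mul0r.
by rewrite ler_wpM2l// fg.
Qed.

(** An active site [x] is the next one served with probability at least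
    [(1 + lam) / total_rate lam eta]. *)
Lemma step_drop N kap s eta b a x (D : pred (option ('I_d * bool))) : kernel kap ->
  particle_count N eta -> (0 < active (eta x))%N -> 0 <= a ->
  step kap s eta (fun y t => b - a * ((y == x) && D t)%:R) <=
  b - a * ((1 + lam) / total_rate lam eta * \sum_(t | D t) kap s x t).
Proof.
move=> [k0 k1] pc ax a0; have R0 := total_rate_gt0 pc ax.
have xs : x \in supp eta by rewrite (in_supp _ pc).
have -> : step kap s eta (fun y t => b - a * ((y == x) && D t)%:R) =
  \sum_(y <- supp eta) (ring_rate lam (eta y) / total_rate lam eta * b -
    (y == x)%:R * (a * (ring_rate lam (eta y) / total_rate lam eta * \sum_(t | D t) kap s y t))).
  apply: eq_bigr => y _; under eq_bigr do rewrite mulrBr.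
  rewrite sumrB -mulr_suml k1 mul1r mulrBr; congr (_ - _).
  case: (y == x) => /=; last by rewrite mul0r big1 ?mulr0// => t _; rewrite !mulr0.
  rewrite mul1r mulrCA; congr (_ * _).
  rewrite mulr_sumr [RHS]big_mkcond/=; apply: eq_bigr => t _.
  by case: (D t); rewrite ?mulr1 ?mulr0//; ring.
rewrite sumrB -!mulr_suml -(total_rateE pc) divff ?gt_eqF// mul1r lerD2l lerN2.
rewrite (bigD1_seq x) ?fset_uniq//= eqxx mul1r [X in _ <= _ + X]big1 ?addr0; last first.
  by move=> y /negPf ->; rewrite mul0r.
rewrite ler_wpM2l// ler_wpM2r ?sumr_ge0// ler_wpM2r ?invr_ge0 ?(ltW R0)//.
exact: ring_rate_ge.
Qed.

Lemma step_cst N kap s eta b : kernel kap -> particle_count N eta ->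
  total_rate lam eta != 0 -> step kap s eta (fun _ _ => b) = b.
Proof.
move=> [k0 k1] pc R0; rewrite /step.
under eq_bigr do rewrite -mulr_suml k1 mul1r.
by rewrite -!mulr_suml -(total_rateE pc) divff// mul1r.
Qed.

(** Supermartingale principle: [I] is preserved along the chain, [Psi] does not increase on average,
    and [Psi] dominates [F] at the end. *)
Lemma mean_le kap F (I : history d -> cfg d -> seq (cfg d) -> Prop)
    (Psi : history d -> cfg d -> seq (cfg d) -> R) N n s eta l :
  kernel kap -> I s eta l -> (forall s eta l, I s eta l -> particle_count N eta) ->
  (forall s eta l, I s eta l -> F (eta :: l) <= Psi s eta l) ->
  (forall s eta l, I s eta l -> total_rate lam eta = 0 ->
     I s eta (eta :: l) /\ Psi s eta (eta :: l) <= Psi s eta l) ->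
  (forall s eta l x t, I s eta l -> (0 < active (eta x))%N -> kap s x t != 0 ->
     I ((x, t) :: s) (topple x t eta) (eta :: l)) ->
  (forall s eta l, I s eta l -> total_rate lam eta != 0 ->
     step kap s eta (fun x t => Psi ((x, t) :: s) (topple x t eta) (eta :: l)) <= Psi s eta l) ->
  mean kap n F s eta l <= Psi s eta l.
Proof.
move=> kk + pc FPsi stuck move_I super; elim: n s eta l => [|n IHn] s eta l Isl /=.
  exact: FPsi.
case: eqVneq => R0.
  by have [I' le] := stuck _ _ _ Isl R0; exact: (le_trans (IHn _ _ _ I')).
apply: le_trans (super _ _ _ Isl R0); apply: (step_le kk (pc _ _ _ Isl)) => x t ax kt.
exact/IHn/move_I.
Qed.

Definition annealed : history d -> Zd d -> option ('I_d * bool) -> R := fun _ _ t => q t.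

Definition quenched w : history d -> Zd d -> option ('I_d * bool) -> R :=
  fun s x t => (w (x, visits s x) == t)%:R.

Lemma kernel_annealed : kernel annealed.
Proof. by []. Qed.

Lemma kernel_quenched w : kernel (quenched w).
Proof.
split=> [s x t|s x]; rewrite /quenched ?ler0n// (bigD1 (w (x, visits s x)))//= eqxx.
by rewrite big1 ?addr0// => t; rewrite eq_sym => /negPf ->.
Qed.

Lemma mean_bound N kap n F s eta l c : kernel kap -> particle_count N eta ->
  (forall l, F l <= c) -> mean kap n F s eta l <= c.
Proof.
move=> kk pc Fc.
apply: (@mean_le _ _ (fun _ eta _ => particle_count N eta) (fun _ _ _ => c) N) => //.
- by move=> *; exact: particle_count_topple.
- by move=> s' e l' pc' R0; rewrite (step_cst _ _ kk pc' R0).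
Qed.

Lemma mean_ge0 kap n F s eta l : kernel kap -> (forall l, 0 <= F l) ->
  0 <= mean kap n F s eta l.
Proof.
move=> [k0 _] F0; elim: n s eta l => [|n IHn] s eta l //=.
case: eqVneq => R0; first exact: IHn.
apply: sumr_ge0 => x _; rewrite mulr_ge0 ?divr_ge0 ?ring_rate_ge0 ?total_rate_ge0//.
by apply: sumr_ge0 => t _; rewrite mulr_ge0.
Qed.

Lemma measurable_quenched n F s eta l :
  measurable_fun setT (fun w : stack d => mean (quenched w) n F s eta l).
Proof.
elim: n s eta l => [|n IHn] s eta l /=; first exact: measurable_cst.
case: eqVneq => R0; first exact: IHn.
rewrite /step; apply: measurable_sum => x; apply: measurable_funM; first exact: measurable_cst.
apply: measurable_sum => t; apply: measurable_funM; last exact: IHn.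
apply: dmeas_measurable_fun.
exact: (dmeas_comp (fun o => (o == t)%:R) (dmeas_coord _)).
Qed.

Variable Q : probability (stack d) R.
Hypothesis Qcyl : forall (s : seq (Zd d * nat)) f, uniq s ->
  Q (cyl s f) = (\prod_(k <- s) q (f k))%:E.

(** No instruction is read twice, so averaging the chain driven by a fixed stack over the law of the
    stacks gives the chain with fresh instructions. *)
Lemma annealing n F s eta l : (forall l, 0 <= F l) ->
  (\int[Q]_w ((compat w s)%:R * mean (quenched w) n F s eta l)%:E =
   (hist_prob q s * mean annealed n F s eta l)%:E)%E.
Proof.
move=> F0; elim: n s eta l => [|n IHn] s eta l /=.
  under eq_integral do rewrite mulrC EFinM.
  have mc : measurable_fun setT (fun w : stack d => ((compat w s)%:R%:E : \bar R)).
    apply/measurable_EFinP; apply: dmeas_measurable_fun.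
    apply: (dmeas_comp (fun b : bool => b%:R)).
    by apply: measurable_pred; exact: measurable_compat.
  rewrite ge0_integralZl//; last by rewrite lee_fin.
  rewrite mulrC EFinM -(prob_compat q_ge0 Qcyl); congr (_ * _)%E.
  rewrite -[X in Q X]setIT -integral_indic//; last exact: measurable_compat.
  apply: eq_integral => w _; rewrite indicE; congr (_%:R%:E).
  by congr nat_of_bool; apply/idP/idP; rewrite inE.
have [R0|R0] := eqVneq (total_rate lam eta) 0; first exact: IHn.
pose c x := ring_rate lam (eta x) / total_rate lam eta.
have c0 x : 0 <= c x by rewrite divr_ge0 ?ring_rate_ge0 ?total_rate_ge0.
pose m w x t := mean (quenched w) n F ((x, t) :: s) (topple x t eta) (eta :: l).
have m0 w x t : 0 <= m w x t by apply: mean_ge0 => //; exact: kernel_quenched.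
pose g x t w := ((c x)%:E * ((compat w ((x, t) :: s))%:R * m w x t)%:E)%E.
have ms x t : measurable_fun setT (fun w : stack d => ((compat w ((x, t) :: s))%:R * m w x t)%:E).
  apply/measurable_EFinP; apply: measurable_funM; last exact: measurable_quenched.
  apply: dmeas_measurable_fun; apply: (dmeas_comp (fun b : bool => b%:R)).
  by apply: measurable_pred; exact: measurable_compat.
have ms0 x t w : (0 <= ((compat w ((x, t) :: s))%:R * m w x t)%:E)%E.
  by rewrite lee_fin mulr_ge0.
have mg x t : measurable_fun setT (g x t) by apply: measurable_funeM.
have g0 x t w : (0 <= g x t w)%E by rewrite mule_ge0// lee_fin.
transitivity (\int[Q]_w \sum_(x <- supp eta) \sum_t g x t w)%E.
  apply: eq_integral => w _; rewrite /step mulr_sumr -sumEFin; apply: eq_bigr => x _.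
  rewrite mulrCA mulr_sumr mulr_sumr -sumEFin; apply: eq_bigr => t _.
  rewrite /g -EFinM; congr (_%:E); rewrite /c /m /quenched /= -mulnb natrM.
  by congr (_ * _); rewrite mulrCA mulrA.
rewrite ge0_integral_sum//; last 2 first.
- by move=> x; exact: emeasurable_sum.
- by move=> x w _; exact: sume_ge0.
rewrite /step mulr_sumr -sumEFin; apply: eq_bigr => x _.
rewrite ge0_integral_sum// mulrCA mulr_sumr mulr_sumr -sumEFin; apply: eq_bigr => t _.
rewrite ge0_integralZl//; last by rewrite lee_fin.
rewrite IHn -EFinM /annealed /hist_prob big_cons /=; congr (_%:E); rewrite /c; ring.
Qed.

Lemma annealed_le N n F eta b (G : set (stack d)) : particle_count N eta ->
  measurable G -> (forall l, 0 <= F l <= 1) -> 0 <= b ->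
  (forall w, G w -> mean (quenched w) n F [::] eta [::] <= b) ->
  ((mean annealed n F [::] eta [::])%:E <= b%:E + Q (~` G))%E.
Proof.
move=> pc mG F01 b0 Gb; have F0 l : 0 <= F l by case/andP: (F01 l).
have := annealing n [::] eta [::] F0; rewrite /hist_prob big_nil mul1r => <-.
have mGC : measurable (~` G) by exact: measurableC.
have mi : measurable_fun setT (fun w : stack d => ((\1_(~` G) w)%:E : \bar R)).
  by apply/measurable_EFinP; exact: measurable_indic.
apply: (@le_trans _ _ (\int[Q]_w (b%:E + (\1_(~` G) w)%:E))%E).
  apply: ge0_le_integral => //.
  - by move=> w _; rewrite mul1r lee_fin mean_ge0//; exact: kernel_quenched.
  - apply/measurable_EFinP; apply: measurable_funM; last exact: measurable_quenched.
    exact: (@measurable_cst _ _ _ _ setT (1 : R)).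
  - exact: emeasurable_funD.
  move=> w _; rewrite mul1r lee_fin indicE; case: (boolP (w \in ~` G)) => wG.
    apply: (@le_trans _ _ 1); last by rewrite lerDr.
    apply: (mean_bound _ _ _ (kernel_quenched w) pc) => l'.
    by case/andP: (F01 l').
  rewrite addr0; apply: Gb; apply: contrapT => nG; move/negP: wG; apply.
  by rewrite inE.
rewrite ge0_integralD//.
rewrite integral_indic// setIT integral_cst//.
apply: leeD => //; rewrite -[leRHS]mule1; apply: lee_wpmul2l; first by rewrite lee_fin.
exact: (@probability_le1 _ _ _ Q).
Qed.

(** Mean holding time of the newest state if [b] holds. At total rate zero the holding time is
    infinite; the substitute [c], later equal to [L], is enough to bring [capped] to one. *)
Definition slot (b : seq (cfg d) -> bool) (c : R) (l : seq (cfg d)) : R :=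
  if l is eta :: _ then
    if b l then if total_rate lam eta == 0 then c else (total_rate lam eta)^-1 else 0
  else 0.

Fixpoint spent b c l : R := if l is _ :: l' then slot b c l + spent b c l' else 0.

Lemma slot_ge0 b c l : 0 <= c -> 0 <= slot b c l.
Proof.
case: l => //= eta l c0; case: ifP => // _; case: ifP => // _.
by rewrite invr_ge0 total_rate_ge0.
Qed.

Lemma spent_ge0 b c l : 0 <= c -> 0 <= spent b c l.
Proof. by move=> c0; elim: l => //= eta l IHl; rewrite addr_ge0// (slot_ge0 b (eta :: l)). Qed.

(** Bounds the conditional probability, given the states, that the time spent under [b] reaches [L].
    Only holding times before the newest state count, and the factor [2] comes from
    [geometric_le2]. *)
Definition capped b (L : R) (l : seq (cfg d)) : R :=
  Num.min 1 (2 / L * spent b L (behead l)).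

Lemma capped01 b L l : 0 < L -> 0 <= capped b L l <= 1.
Proof.
move=> L0; rewrite /capped ge_min lexx andbT le_min ler01/=.
by apply: mulr_ge0; [rewrite divr_ge0// ltW|apply: spent_ge0; exact: ltW].
Qed.

Lemma drops_topple rho eta l x t z : @detects d rho -> (0 < active (eta x))%N ->
  drops rho z (topple x t eta :: eta :: l) =
  ((z == x) && (t != None) + drops rho z (eta :: l))%N.
Proof. by move=> det ax /=; rewrite det. Qed.

Section quenched_history.
Variables (rho : occupation -> occupation -> bool) (x0 : Zd d).
Hypotheses (det : @detects d rho) (irr : forall k, rho k k = false).

Definition tracks N (xi : Zd d -> nat) w s eta l :=
  [/\ particle_count N eta, represents xi w (visits s) eta &
  drops rho x0 (eta :: l) = outflow w (visits s) x0].

Lemma tracks0 N xi w eta : particle_count N eta -> (forall x, eta x = Active (xi x)) ->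
  tracks N xi w [::] eta [::].
Proof.
move=> pc ex; split => //; first exact: represents0.
by rewrite outflowE.
Qed.

Lemma tracks_stuck N xi w s eta l : tracks N xi w s eta l -> tracks N xi w s eta (eta :: l).
Proof. by move=> [pc rep dr]; split => //=; rewrite irr add0n. Qed.

Lemma tracks_topple N xi w s eta l x t : tracks N xi w s eta l -> (0 < active (eta x))%N ->
  quenched w s x t != 0 -> tracks N xi w ((x, t) :: s) (topple x t eta) (eta :: l).
Proof.
move=> [pc rep dr] ax; rewrite /quenched pnatr_eq0 eqb0 negbK => /eqP <-.
split; rewrite ?visits_cons.
- exact: particle_count_topple.
- exact: represents_topple.
- by rewrite drops_topple// outflow_incr dr addnC.
Qed.

(** For a fixed stack the chain topples only unstable sites, so its visits stay below parallel
    toppling; when the latter never exceeds [k] at [x0], neither do the drops. *)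
Lemma annealed_drops N n (xi : Zd d -> nat) eta k : particle_count N eta ->
  (forall x, eta x = Active (xi x)) ->
  ((mean annealed n (fun l => (k < drops rho x0 l)%N%:R) [::] eta [::])%:E <=
   Q [set w | exists m, (k < parallel (@arw_rule d) xi w m x0)%N])%E.
Proof.
move=> pc ex; set B := [set w | _].
have mB : measurable B.
  rewrite (_ : B = \bigcup_m [set w : stack d | (k < parallel (@arw_rule d) xi w m x0)%N]).
    apply: bigcupT_measurable => m.
    apply: (dmeas_set (fun a => (k < a)%N)); apply: dmeas_parallel => *; exact: dmeas_cst || exact: dmeas_coord.
  by apply/seteqP; split => w [m]; [exists m|move=> _; exists m].
rewrite -[B]setCK -[leRHS]add0e; apply: (annealed_le pc) => //; first exact: measurableC.
  by move=> l; rewrite ler0n lern1 leq_b1.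
move=> w /forallNP wB.
apply: (@mean_le _ _ (fun s eta l => tracks N xi w s eta l /\
  exists m, forall y, (visits s y <= parallel (@arw_rule d) xi w m y)%N) (fun _ _ _ => 0) N).
- exact: kernel_quenched.
- by split; [exact: tracks0|exists 0%N].
- by move=> s e l [[]].
- move=> s e l [[_ _ ->] [m le]]; rewrite lern0 eqb0 -leqNgt.
  rewrite (leq_trans (outflow_le _ _ _))// (leq_trans (le x0))// leqNgt.
  by apply/negP; exact: wB.
- by move=> s e l [tr h] _; split => //; split => //; exact: tracks_stuck.
- move=> s e l x t [tr [m h]] ax kt; split; first exact: tracks_topple.
  exists m.+1 => y; rewrite visits_cons; apply: parallel_step => //.
    exact: arw_rule_mono.
  by rewrite -(active_unstable _ (proj2 (let: And3 a b c := tr in conj a b))).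
- move=> s e l [[pc' _ _] _] R0; rewrite (step_cst _ _ (kernel_quenched w) pc' R0)//.
Qed.

(** Until [k] departures have occurred, some site lagging behind [u] is active and is served at rate
    at least [1 + lam]. At most [m] such services are owed, so the mean waiting time is at most
    [m / (1 + lam)]. *)
Lemma annealed_time N n (xi0 xi : Zd d -> nat) eta (U : {fset Zd d}) n0 k m L :
  particle_count N eta -> (forall x, eta x = Active (xi x)) ->
  (forall x, (xi0 x <= xi x)%N) -> 0 < L ->
  let u w := parallel (@arw_rule d) xi0 w n0 in
  (forall w y, y \notin U -> u w y = 0%N) ->
  ((mean annealed n (capped (fun l => (drops rho x0 l < k)%N) L) [::] eta [::])%:E <=
   (2 / L * (m%:R / (1 + lam)))%:E + Q (~` [set w | (k <= outflow w (u w) x0)%N /\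
     (\sum_(y <- U) u w y <= m)%N]))%E.
Proof.
move=> pc ex xx L0 u uU.
have du y : dmeas (fun w => u w y).
  by apply: dmeas_parallel => *; exact: dmeas_cst || exact: dmeas_coord.
have a0 : 0 <= 2 / L by rewrite divr_ge0// ltW.
apply: (annealed_le pc).
- apply: measurableI.
    apply: (dmeas_set (fun a => (k <= a)%N)).
    by apply: dmeas_outflow => *; [exact: dmeas_coord|exact: du].
  apply: (dmeas_set (fun a => (a <= m)%N)); exact: dmeas_sum.
- by move=> l; exact: capped01.
- by rewrite mulr_ge0// divr_ge0// ltW.
move=> w [ku um].
(* [low] counts the services already rendered towards [u]; topplings beyond [u] are not credited. *)
pose low (h : Zd d -> nat) : R := \sum_(y <- U) (minn (h y) (u w y))%:R.
have low_le h : low h <= m%:R.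
  rewrite /low -natr_sum ler_nat (leq_trans _ um)// leq_sum// => y _; exact: geq_minr.
have lowS h x : low h + ((x \in U) && (h x < u w x)%N)%:R <= low (incr h x).
  have [xU|xU] := boolP (x \in U); last first.
    rewrite addr0; apply: ler_sum => y _; rewrite ler_nat /incr.
    by rewrite leq_min geq_minr (leq_trans (geq_minl _ _))// leq_addr.
  rewrite /low (bigD1_seq x xU (fset_uniq U))/= [leRHS](bigD1_seq x xU (fset_uniq U))/=.
  rewrite addrAC lerD//.
    rewrite -natrD ler_nat /incr eqxx /=; lia.
  by apply: ler_sum => y /negPf yx; rewrite /incr yx addn0.
pose b l := (drops rho x0 l < k)%N.
(* Time already spent plus the mean time budget [1 / (1 + lam)] for each service still owed. *)
pose Psi s (eta : cfg d) l := 2 / L * (spent b L l + (m%:R - low (visits s)) / (1 + lam)).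
have -> : 2 / L * (m%:R / (1 + lam)) = Psi [::] eta [::].
  rewrite /Psi /= add0r /low big1 ?subr0// => y _; by rewrite min0n.
have prog s : (outflow w (visits s) x0 < k)%N ->
    exists x, (visits s x < u w x)%N /\ unstable (@arw_rule d) xi w (visits s) x.
  move=> lt; apply: parallel_progress => //; exists x0; rewrite ltnNge; apply/negP => le.
  move: lt; rewrite ltnNge (leq_trans ku)//.
  by rewrite !outflowE -(subnKC le) iotaD count_cat leq_addr.
apply: (@mean_le _ _ (fun s eta l => tracks N xi w s eta l) Psi N).
- exact: kernel_quenched.
- exact: tracks0.
- by move=> s e l [].
- move=> s e l _; rewrite /capped /Psi ge_min; apply/orP; right => /=.
  by rewrite ler_wpM2l// lerDl divr_ge0 ?subr_ge0 ?low_le// ltW.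
- move=> s e l tr R0; split; first exact: tracks_stuck.
  rewrite ler_wpM2l// lerD2r /= R0 eqxx; case: ifP; last by rewrite add0r.
  have [pc' rep dr] := tr; rewrite /b dr => lt.
  have [x [_ ux]] := prog s lt.
  rewrite -(active_unstable _ rep) in ux.
  by have := total_rate_gt0 pc' ux; rewrite R0 ltxx.
- by move=> *; exact: tracks_topple.
move=> s e l tr R0; have [pc' rep dr] := tr.
have Rp : 0 < total_rate lam e by rewrite lt_neqAle eq_sym R0 total_rate_ge0.
pose B : R := 2 / L * (spent b L (e :: l) + (m%:R - low (visits s)) / (1 + lam)).
have [lt|ge] := boolP (b (e :: l)); last first.
  have -> : Psi s e l = B by rewrite /Psi /B /= (negbTE ge) add0r.
  rewrite -[leRHS](step_cst s _ (kernel_quenched w) pc' R0).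
  apply: (step_le (kernel_quenched w) pc') => x t _ _.
  rewrite /Psi visits_cons ler_wpM2l// lerD2l ler_wpM2r ?invr_ge0 ?(ltW lam1)//.
  by rewrite lerD2l lerN2 (le_trans _ (lowS _ _))// lerDl.
have [x [hx ux]] : exists x, (visits s x < u w x)%N /\ unstable (@arw_rule d) xi w (visits s) x.
  by apply: prog; move: lt; rewrite /b dr.
rewrite -(active_unstable _ rep) in ux.
have xU : x \in U by apply/negPn/negP => /uU h; rewrite h in hx.
apply: (@le_trans _ _ (step (quenched w) s e
  (fun y t => B - 2 / L / (1 + lam) * ((y == x) && xpredT t)%:R))).
  apply: (step_le (kernel_quenched w) pc') => y t _ _.
  rewrite /Psi visits_cons /B [leRHS](_ : _ = 2 / L * (spent b L (e :: l) +
    (m%:R - low (visits s) - ((y == x) && xpredT t)%:R) / (1 + lam))); last by ring.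
  rewrite ler_wpM2l// lerD2l ler_wpM2r ?invr_ge0 ?(ltW lam1)// -addrA lerD2l -opprD lerN2 andbT.
  have := lowS (visits s) y; case: eqVneq => [->|_]; first by rewrite xU hx.
  by move=> h; rewrite addr0 (le_trans _ h)// lerDl.
apply: (le_trans (step_drop s B xpredT (kernel_quenched w) pc' ux _)).
  by rewrite divr_ge0// ltW.
rewrite (kernel_quenched w).2 mulr1 /B /Psi /= lt (negbTE R0) mulrA divfK ?gt_eqF//.
rewrite le_eqVlt; apply/orP; left; apply/eqP; ring.
Qed.

End quenched_history.

(** An active site is served at rate at least [1 + lam] and the instruction is a jump with
    probability [1 / (1 + lam)]: departures occur at rate at least one, so the mean active time
    before [k] of them is at most [k]. *)
Lemma annealed_active N n x0 eta k L : particle_count N eta -> 0 < L ->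
  mean annealed n (capped (fun l => (0 < active (head (fun=> Active 0) l x0))%N &&
    (drops loses x0 l < k)%N) L) [::] eta [::] <= 2 / L * k%:R.
Proof.
move=> pc L0; have a0 : 0 <= 2 / L by rewrite divr_ge0// ltW.
pose b l := (0 < active (head (fun=> Active 0) l x0))%N && (drops loses x0 l < k)%N.
pose Psi (s : history d) (eta : cfg d) l :=
  2 / L * (spent b L l + (k - minn (drops loses x0 (eta :: l)) k)%N%:R).
apply: (@le_trans _ _ (Psi [::] eta [::])); last first.
  by rewrite /Psi /= add0r ler_wpM2l// ler_nat leq_subr.
apply: (@mean_le _ _ (fun _ eta _ => particle_count N eta) Psi N) => //.
- move=> s e l _; rewrite /capped /Psi ge_min; apply/orP; right => /=.
  by rewrite ler_wpM2l// lerDl.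
- move=> s e l pc' R0; split => //; rewrite /Psi ler_wpM2l// lerD//=.
    case: ifP; last by rewrite add0r.
    by move=> /andP[/= ax _]; have := total_rate_gt0 pc' ax; rewrite R0 ltxx.
  by rewrite /loses ltnn.
- by move=> *; exact: particle_count_topple.
move=> s e l pc' R0; have Rp : 0 < total_rate lam e by rewrite lt_neqAle eq_sym R0 total_rate_ge0.
pose B : R := 2 / L * (spent b L (e :: l) + (k - minn (drops loses x0 (e :: l)) k)%N%:R).
have [/andP[/= ax lt]|nb] := boolP (b (e :: l)); last first.
  have -> : Psi s e l = B by rewrite /Psi /B [spent b L (_ :: _)]/= (negbTE nb) add0r.
  rewrite -[leRHS](step_cst s _ kernel_annealed pc' R0).
  apply: (step_le kernel_annealed pc') => x t ax _.
  rewrite /Psi ler_wpM2l// lerD2l ler_nat (drops_topple _ _ _ (@detects_loses d))//; lia.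
apply: (@le_trans _ _ (step annealed s e
  (fun y t => B - 2 / L * ((y == x0) && (t != None))%:R))).
  apply: (step_le kernel_annealed pc') => y t ay _.
  rewrite /Psi /B [leRHS](_ : _ = 2 / L * (spent b L (e :: l) +
    ((k - minn (drops loses x0 (e :: l)) k)%N%:R - ((y == x0) && (t != None))%:R))); last by ring.
  rewrite ler_wpM2l// lerD2l (drops_topple _ _ _ (@detects_loses d))//.
  rewrite [x0 == y]eq_sym lerBrDr -natrD ler_nat.
  by case: (_ && _) => /=; lia.
apply: (le_trans (step_drop s B (fun t => t != None) kernel_annealed pc' ax a0)).
have -> : \sum_(t | t != None) annealed s x0 t = (1 + lam)^-1.
  have := q_sum1; rewrite (bigD1 None)//= => h.
  rewrite /annealed; apply: (@addrI _ (lam / (1 + lam))); rewrite h.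
  by field; rewrite gt_eqF.
have spE : spent b L (e :: l) = (total_rate lam e)^-1 + spent b L l.
  by rewrite /= /b /= ax lt (negbTE R0).
rewrite /B /Psi spE.
rewrite le_eqVlt; apply/orP; left; apply/eqP; field.
by rewrite !gt_eqF.
Qed.

End chain.

(** * Jump chain and holding times *)

Section prob_sums.
Context d (X : measurableType d) (R : realType) (P : probability X R).
Variables (I : choiceType) (F : I -> set X).
Hypothesis mF : forall i, measurable (F i).

Lemma measurable_bigcup_seq (r : seq I) : measurable (\bigcup_(i in [set` r]) F i).
Proof. by rewrite bigcup_seq; apply: bigsetU_measurable. Qed.

Lemma prob_bigcup_seq (r : seq I) : uniq r ->
  (forall i j, F i `&` F j !=set0 -> i = j) ->
  prob P (\bigcup_(i in [set` r]) F i) = \sum_(i <- r) prob P (F i).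
Proof.
move=> ur tF; apply: EFin_inj; rewrite -probE; last exact: measurable_bigcup_seq.
rewrite -sumEFin; under eq_bigr do rewrite -probE//.
by apply: measure_bigcup_seq => // i j _ _; exact: tF.
Qed.

Lemma prob_bigcup_seq_le (r : seq I) :
  prob P (\bigcup_(i in [set` r]) F i) <= \sum_(i <- r) prob P (F i).
Proof.
elim: r => [|i r IHr].
  by rewrite bigcup_seq !big_nil prob0.
rewrite bigcup_seq !big_cons -bigcup_seq; apply: (le_trans (prob_U P (mF i) (measurable_bigcup_seq r))).
by rewrite lerD2l.
Qed.

End prob_sums.

Lemma expRN1_le (R : realType) : expR (-1) <= 2^-1 :> R.
Proof.
rewrite expRN lef_pV2 ?posrE ?expR_gt0//.
by have := expR_ge1Dx (1 : R); apply: le_trans.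
Qed.

Lemma geometric_le2 (R : realType) n : \sum_(j < n) expR (- j%:R) <= 2 :> R.
Proof.
suff : \sum_(j < n) expR (- j%:R) <= 2 - 2 * 2^-1 ^+ n :> R.
  by move=> h; apply: (le_trans h); rewrite gerBl mulr_ge0// exprn_ge0.
elim: n => [|n IHn]; first by rewrite big_ord0 expr0 mulr1 subrr.
have half : expR (- n%:R) <= 2^-1 ^+ n :> R.
  rewrite (_ : - n%:R = n%:R * -1); last by rewrite mulrN1.
  by rewrite expRM_natl; apply: lerXn2r; rewrite ?nnegrE ?expR_ge0 ?invr_ge0// expRN1_le.
rewrite big_ord_recr/=; apply: (le_trans (lerD IHn half)).
by rewrite exprS le_eqVlt; apply/orP; left; apply/eqP; field.
Qed.

(** The law gives tail probabilities, so a holding time is bounded above by stairs of width [a],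
    unless all [K] of them are already filled. *)
Lemma staircase (R : realType) (t : \bar R) (a : R) K : 0 <= a ->
  let S := \sum_(j < K) a * ((j%:R * a)%:E < t)%E%:R in
  S = K%:R * a \/ (t <= S%:E)%E.
Proof.
move=> a0 /=; elim: K => [|K IHK]; first by left; rewrite big_ord0 mul0r.
rewrite big_ord_recr/=; case: IHK => [->|le].
  case: ltP => [_|le]; last by right; rewrite mulr0 addr0.
  by left; rewrite mulr1 -natr1 mulrDl mul1r.
by right; apply: (le_trans le); rewrite lee_fin lerDl mulr_ge0.
Qed.

Lemma measurable_cfg1 d (eta0 : cfg d) : measurable [set eta : cfg d | eta = eta0].
Proof.
rewrite (_ : [set _ | _] = \bigcap_x [set eta : cfg d | eta x = eta0 x]).
  by apply: measurable_bigcap_count => x _; exact: (dmeas_cfg x [set eta0 x]).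
by apply/seteqP; split => eta /= => [->//|h]; apply/funext => x; exact: h.
Qed.

Lemma dmeas_occupation2 d (X : measurableType d) (A : Type) (f g : X -> occupation)
    (op : occupation -> occupation -> A) :
  dmeas f -> dmeas g -> dmeas (fun o => op (f o) (g o)).
Proof.
move=> mf mg; pose dec o := if o is Some n then Active n else Sleeping.
pose cod k := if k is Active n then Some n else None.
have codK k : dec (cod k) = k by case: k.
have -> : (fun o => op (f o) (g o)) = fun o => op (dec (cod (f o))) (dec (cod (g o))).
  by apply/funext => o; rewrite !codK.
by apply: (dmeas_op (fun a b => op (dec a) (dec b))); exact: dmeas_comp.
Qed.

Section jump_chain.
Context (R : realType) (d : nat) (p : Zd d -> R) (lam : R).
Hypotheses (hp : jump_distribution p) (lam_gt0 : 0 < lam).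
Local Notation q := (instr_prob p lam).
Local Notation rate := (total_rate lam).
Local Notation annealed_mean := (mean lam (annealed p lam)).
Context (dO : measure_display) (Omega : measurableType dO) (Pr : probability Omega R).
Variables (Y : nat -> Omega -> cfg d) (tau : nat -> Omega -> \bar R)
  (mu : set (cfg d) -> \bar R).
Hypotheses (mY : forall n, measurable_fun setT (Y n))
  (mtau : forall n, measurable_fun setT (tau n)).
Hypothesis law : forall n (xi : nat -> cfg d) (t : nat -> R), (forall i, 0 <= t i) ->
  Pr [set o | (forall i, (i <= n)%N -> Y i o = xi i) /\
              (forall i, (i < n)%N -> ((t i)%:E < tau i o)%E)] =
  (mu [set xi 0%N] *
   (\prod_(i < n) (expR (- (rate (xi i) * t i)) * ring_prob p lam (xi i) (xi i.+1)))%:E)%E.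

Implicit Types (xi : nat -> cfg d) (t : nat -> R).

Definition path_event n xi t := [set o | (forall i, (i <= n)%N -> Y i o = xi i) /\
              (forall i, (i < n)%N -> ((t i)%:E < tau i o)%E)].

Lemma measurable_state n (eta : cfg d) : measurable [set o | Y n o = eta].
Proof. by rewrite -[X in measurable X]setTI; exact: (mY n measurableT (measurable_cfg1 eta)). Qed.

Lemma measurable_tail n (s : R) : measurable [set o | (s%:E < tau n o)%E].
Proof.
by rewrite -[X in measurable X]setTI; exact: (emeasurable_fun_o_infty measurableT (mtau n)).
Qed.

Lemma measurable_path_event n xi t : measurable (path_event n xi t).
Proof.
rewrite (_ : path_event n xi t = (\bigcap_(i in [set i | (i <= n)%N]) [set o | Y i o = xi i]) `&`
    (\bigcap_(i in [set i | (i < n)%N]) [set o | ((t i)%:E < tau i o)%E])); last first.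
  by apply/seteqP; split => o [].
apply: measurableI; apply: bigcap_measurableType => i _; [exact: measurable_state|exact: measurable_tail].
Qed.

Lemma prob_path n xi t : (forall i, 0 <= t i) -> prob Pr (path_event n xi t) =
  prob Pr [set o | Y 0 o = xi 0%N] *
  \prod_(i < n) (expR (- (rate (xi i) * t i)) * ring_prob p lam (xi i) (xi i.+1)).
Proof.
move=> t0; have m0 : mu [set xi 0%N] = Pr [set o | Y 0 o = xi 0%N].
  have := @law 0 xi t t0; rewrite big_ord0 mule1 => <-; congr (Pr _).
  by apply/seteqP; split => o /=; [by move=> [h _]; exact: h|by move=> h; split => // -[]].
have h := law n xi t0; apply: EFin_inj.
rewrite -probE; last exact: measurable_path_event.
by rewrite h m0 EFinM -probE//; exact: measurable_state.
Qed.

Local Notation path n xi := (path_event n xi (fun=> 0)).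

Lemma prob_path0 n xi : prob Pr (path n xi) = prob Pr [set o | Y 0 o = xi 0%N] *
  \prod_(i < n) ring_prob p lam (xi i) (xi i.+1).
Proof. by rewrite prob_path//; congr (_ * _); apply: eq_bigr => i _; rewrite mulr0 oppr0 expR0 mul1r. Qed.

Lemma prob_path_tail n xi i s : (i < n)%N -> 0 <= s ->
  prob Pr (path n xi `&` [set o | (s%:E < tau i o)%E]) =
  prob Pr (path n xi) * expR (- (rate (xi i) * s)).
Proof.
move=> i_n s0; pose t j := if j == i then s else 0.
have -> : path n xi `&` [set o | (s%:E < tau i o)%E] = path_event n xi t.
  apply/seteqP; split => o /=.
    by move=> [[h1 h2] h3]; split => // j jn; rewrite /t; case: eqP => [->//|_]; exact: h2.
  move=> [h1 h2]; split; last by have := h2 i i_n; rewrite /t eqxx.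
  split=> // j jn; apply: (le_lt_trans _ (h2 j jn)).
  by rewrite lee_fin /t; case: ifP.
rewrite prob_path; last by move=> j; rewrite /t; case: ifP.
rewrite prob_path0 -mulrA; congr (_ * _); rewrite big_split/= mulrC; congr (_ * _).
rewrite (bigD1 (Ordinal i_n))//= /t eqxx big1 ?mulr1// => j ji.
by rewrite (_ : (j : nat) == i = false) ?mulr0 ?oppr0 ?expR0//; apply/negbTE.
Qed.

Fixpoint past (xi : nat -> cfg d) n : seq (cfg d) :=
  if n is m.+1 then xi m :: past xi m else [::].

Lemma eq_past xi xi' n : (forall i, (i < n)%N -> xi i = xi' i) -> past xi n = past xi' n.
Proof.
elim: n => //= n IHn h; rewrite h// IHn// => i i_n; apply: h.
by rewrite ltnS ltnW.
Qed.

Definition extend xi n y : nat -> cfg d := fun i => if (i <= n)%N then xi i else y.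

Lemma path_extend n xi y : path n.+1 (extend xi n y) =
  path n xi `&` [set o | Y n.+1 o = y /\ (0 < tau n o)%E].
Proof.
apply/seteqP; split => o /=.
  move=> [h1 h2]; split; first split.
  - by move=> i i_n; have := h1 i (leqW i_n); rewrite /extend i_n.
  - by move=> i i_n; exact: (h2 i (leqW i_n)).
  - by split; [have := h1 n.+1 (leqnn _); rewrite /extend ltnn|exact: (h2 n (leqnn _))].
move=> [[h1 h2] [h3 h4]]; split => i.
  by rewrite leq_eqVlt => /predU1P[->|i_n]; rewrite /extend ?ltnn//; rewrite -ltnS i_n; exact: h1.
by rewrite ltnS leq_eqVlt => /predU1P[->//|]; exact: h2.
Qed.

Definition successors (eta : cfg d) : seq (cfg d) :=
  if rate eta == 0 then [:: eta]
  else undup [seq topple x u eta | x <- enum_fset (supp eta), u <- enum {: option ('I_d * bool)}].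

Lemma uniq_successors eta : uniq (successors eta).
Proof. by rewrite /successors; case: ifP => // _; exact: undup_uniq. Qed.

(* [ring_prob] sums over final configurations and [step] over instructions. *)
Lemma sum_successors N eta l f : particle_count N eta ->
  \sum_(y <- successors eta) ring_prob p lam eta y * f y =
  if rate eta == 0 then f eta
  else step lam (annealed p lam) l eta (fun x u => f (topple x u eta)).
Proof.
move=> pc; rewrite /successors; case: ifP => [R0|/negbT R0].
  by rewrite big_seq1 /ring_prob R0; rewrite asboolT// mul1r.
under eq_bigr do rewrite (ring_probE hp _ pc R0) mulr_suml.
rewrite exchange_big/= /step big_seq [RHS]big_seq; apply: eq_bigr => x xs.
under eq_bigr do rewrite -mulrA.
rewrite -mulr_sumr; congr (_ * _); under eq_bigr do rewrite mulr_suml.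
rewrite exchange_big/=; apply: eq_bigr => t _.
under eq_bigr do rewrite -mulrA.
rewrite -mulr_sumr; congr (_ * _).
rewrite (bigD1_seq (topple x t eta)) ?undup_uniq//=; last first.
  rewrite mem_undup; apply: (allpairs_f (fun x u => topple x u eta)) => //.
  by rewrite mem_enum.
rewrite asboolT// mul1r big1 ?addr0// => y yt; rewrite asboolF ?mul0r//.
by apply/eqP.
Qed.

Lemma successor_count N eta y : particle_count N eta -> y \in successors eta ->
  particle_count N y.
Proof.
move=> pc; rewrite /successors; case: ifP => _; first by rewrite inE => /eqP ->.
rewrite mem_undup => /allpairsP[[x t] [/= xs _ ->]]; apply: particle_count_topple => //.
by rewrite -(in_supp _ pc).
Qed.

Lemma prob_path_extend n xi y :
  prob Pr (path n.+1 (extend xi n y)) = prob Pr (path n xi) * ring_prob p lam (xi n) y.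
Proof.
rewrite !prob_path0 big_ord_recr/= mulrA.
have -> : extend xi n y n.+1 = y by rewrite /extend ltnn.
have -> : extend xi n y n = xi n by rewrite /extend leqnn.
congr (_ * _ * _); apply: eq_bigr => i _.
by rewrite /extend ltn_ord (ltnW (ltn_ord i)).
Qed.

(** The probabilities of the successors sum to one, so the path event is their disjoint union up to
    a null set. *)
Lemma prob_path_split n xi N (C : set Omega) : particle_count N (xi n) -> measurable C ->
  prob Pr (path n xi `&` C) <=
  \sum_(y <- successors (xi n)) prob Pr (path n.+1 (extend xi n y) `&` C).
Proof.
move=> pc mC; pose E y := path n.+1 (extend xi n y).
have mE y : measurable (E y) by exact: measurable_path_event.
pose U := \bigcup_(y in [set` successors (xi n)]) E y.
have mU : measurable U by apply: measurable_bigcup_seq.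
have mp : measurable (path n xi) by exact: measurable_path_event.
have UE : prob Pr U = prob Pr (path n xi).
  rewrite prob_bigcup_seq//; last 2 first.
  - exact: uniq_successors.
  - by move=> y y' [v []]; rewrite /E !path_extend => -[_ [<- _]] [_ [<- _]].
  rewrite /E; under eq_bigr do rewrite prob_path_extend -[ring_prob _ _ _ _]mulr1.
  rewrite -mulr_sumr (@sum_successors N (xi n) [::] (fun=> 1))//.
  case: eqVneq => R0; rewrite ?mulr1//.
  by rewrite (step_cst _ _ (kernel_annealed hp lam_gt0) pc R0) mulr1.
have Usub : U `<=` path n xi by move=> o [y _]; rewrite /E path_extend => -[].
have D0 : prob Pr (path n xi `\` U) = 0 by rewrite prob_setD// UE subrr.
apply: (@le_trans _ _ (prob Pr ((path n xi `\` U) `|`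
    \bigcup_(y in [set` successors (xi n)]) (E y `&` C)))).
  apply: prob_sub; first exact: measurableI.
    apply: measurableU; first exact: measurableD.
    by apply: measurable_bigcup_seq => y; exact: measurableI.
  move=> o [po Co]; have [[y ys Ey]|nU] := pselect (U o); last by left.
  by right; exists y.
apply: (le_trans (prob_U _ _ _)); first exact: measurableD.
  by apply: measurable_bigcup_seq => y; exact: measurableI.
rewrite D0 add0r; apply: prob_bigcup_seq_le => y; exact: measurableI.
Qed.

Lemma mean_history k F s s' eta l :
  annealed_mean k F s eta l = annealed_mean k F s' eta l.
Proof.
elim: k s s' eta l => //= k IHk s s' eta l; case: ifP => _; first exact: IHk.
by apply: eq_bigr => x _; congr (_ * _); apply: eq_bigr => t _; congr (_ * _); exact: IHk.
Qed.

(** A conditional bound at length [m] is carried back to shorter paths: splitting over successors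
    reproduces one step of the average. *)
Lemma prob_le_mean N m F (C : set Omega) : measurable C ->
  (forall xi, (forall i, (i <= m)%N -> particle_count N (xi i)) ->
     prob Pr (path m xi `&` C) <= prob Pr (path m xi) * F (past xi m.+1)) ->
  forall k n xi, (n + k = m)%N -> (forall i, (i <= n)%N -> particle_count N (xi i)) ->
  prob Pr (path n xi `&` C) <= prob Pr (path n xi) * annealed_mean k F [::] (xi n) (past xi n).
Proof.
move=> mC H; elim=> [|k IHk] n xi nk pc.
  by move: nk; rewrite addn0 => nm; subst n; exact: H.
have pcn := pc n (leqnn n).
apply: (le_trans (prob_path_split pcn mC)).
pose f y := annealed_mean k F [::] y (xi n :: past xi n).
have -> : annealed_mean k.+1 F [::] (xi n) (past xi n) =
    \sum_(y <- successors (xi n)) ring_prob p lam (xi n) y * f y.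
  rewrite (sum_successors [::] f pcn) /=; case: ifP => // _.
  by apply: eq_bigr => x _; congr (_ * _); apply: eq_bigr => t _; congr (_ * _); exact: mean_history.
rewrite mulr_sumr big_seq [leRHS]big_seq; apply: ler_sum => y ys.
rewrite mulrA -prob_path_extend.
have -> : f y = annealed_mean k F [::] (extend xi n y n.+1) (past (extend xi n y) n.+1).
  rewrite /f {1}/extend ltnn /=; congr (annealed_mean _ _ _ _ (_ :: _)).
    by rewrite /extend leqnn.
  by apply: eq_past => i i_n; rewrite /extend ltnW.
apply: IHk; first by rewrite addSnnS.
move=> i; rewrite leq_eqVlt => /predU1P[->|i_n].
  by rewrite /extend ltnn; exact: (successor_count pcn).
by rewrite /extend -ltnS i_n; apply: pc; rewrite -ltnS.
Qed.

Lemma prob_start_le_mean N m F (C : set Omega) (eta : cfg d) : measurable C -> particle_count N eta ->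
  (forall xi, (forall i, (i <= m)%N -> particle_count N (xi i)) ->
     prob Pr (path m xi `&` C) <= prob Pr (path m xi) * F (past xi m.+1)) ->
  prob Pr ([set o | Y 0 o = eta] `&` C) <=
  prob Pr [set o | Y 0 o = eta] * annealed_mean m F [::] eta [::].
Proof.
move=> mC pc H.
have pE : path 0 (fun=> eta) = [set o | Y 0 o = eta].
  by apply/seteqP; split => o /= => [[h _]|h]; [exact: h|split => // -[]].
by rewrite -pE; apply: (prob_le_mean mC H).
Qed.

Definition time_spent (b : seq (cfg d) -> bool) n o : \bar R :=
  (\sum_(i < n) if b (past (fun j => Y j o) i.+1) then tau i o else 0)%E.

(** Given the states, the holding times have exponential tails. Stairs of width [1 / r i] bound each
    by a variable of mean at most [2 / r i], and Markov's inequality concludes. *)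
Lemma prob_time_spent b L n xi : 0 < L -> measurable [set o | (L%:E <= time_spent b n o)%E] ->
  prob Pr (path n xi `&` [set o | (L%:E <= time_spent b n o)%E]) <=
  prob Pr (path n xi) * capped lam b L (past xi n.+1).
Proof.
move=> L0; set C := [set o | _] => mC.
have mp : measurable (path n xi) by exact: measurable_path_event.
have [big|small] := leP 1 (2 / L * spent lam b L (past xi n)).
  rewrite /capped /= min_l// mulr1; apply: prob_sub (measurableI _ _ mp mC) mp _.
  by move=> o [].
rewrite /capped /= min_r; last exact: ltW.
pose B i := b (past xi i.+1); pose r i := rate (xi i).
have a0 : 0 < 2 / L by rewrite divr_gt0.
have r0 i : 0 <= r i by exact: total_rate_ge0.
have spE : spent lam b L (past xi n) = \sum_(i < n) if B i then if r i == 0 then L else (r i)^-1 else 0.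
  by elim: (n) => [|k IHk]; rewrite ?big_ord0// big_ord_recr/= IHk addrC.
have term0 i : 0 <= (if B i then if r i == 0 then L else (r i)^-1 else 0).
  by case: ifP => // _; case: ifP => _; [exact: ltW|rewrite invr_ge0].
(* A zero rate under [b] would contribute [L] to [spent] and make the bound at least [2], against
   [small]. *)
have rgt (i : 'I_n) : B i -> 0 < r i.
  move=> Bi; rewrite lt_neqAle r0 andbT eq_sym; apply/eqP => ri.
  move: small; apply/negP; rewrite -leNgt spE (bigD1 i)//= Bi ri eqxx.
  apply: (@le_trans _ _ (2 / L * L)); first by rewrite divfK ?gt_eqF// ler1n.
  by rewrite ler_wpM2l ?(ltW a0)// lerDl sumr_ge0.
(* Enough stairs for their total width to reach [L]: if they are all filled, [S o >= L] already. *)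
pose K i := Num.bound (L * r i).
have LK i : B i -> 0 < r i -> L <= (K i)%:R / r i.
  move=> _ ri; rewrite ler_pdivlMr// ltW// /K.
  by apply: archi_boundP; rewrite mulr_ge0// ltW.
pose A i j := [set o | ((j%:R * (r i)^-1)%:E < tau i o)%E].
have mA i j : measurable (A i j) by exact: measurable_tail.
have AE i j o : \1_(A i j) o = ((j%:R * (r i)^-1)%:E < tau i o)%E%:R :> R.
  by rewrite indicE; congr (nat_of_bool _)%:R; apply/idP/idP; rewrite inE.
pose S o := \sum_(i < n | B i) \sum_(j < K i) (r i)^-1 * \1_(A i j) o : R.
have mS : measurable_fun setT S.
  rewrite /S; under eq_fun do rewrite big_mkcond.
  apply: measurable_sum => i; case: (B i); last exact: measurable_cst.
  apply: measurable_sum => j; apply: measurable_funM; first exact: measurable_cst.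
  exact: measurable_indic.
have S0 o : 0 <= S o.
  by rewrite /S sumr_ge0// => i _; rewrite sumr_ge0// => j _; rewrite mulr_ge0// invr_ge0.
have CS o : (path n xi `&` C) o -> L <= S o.
  move=> [[Yo to] Co]; rewrite leNgt; apply/negP => SL.
  suff : (time_spent b n o < L%:E)%E by rewrite ltNge; apply/negP; rewrite negbK.
  apply: (le_lt_trans _ (_ : (S o)%:E < _)%E); last by rewrite lte_fin.
  rewrite /time_spent /S [X in (_ <= X%:E)%E]big_mkcond -sumEFin; apply: lee_sum => i _.
  have -> : b (past (fun j => Y j o) i.+1) = B i.
    congr (b _); apply: eq_past => j ji; apply: Yo.
    by rewrite (leq_trans (ltnW ji)).
  case: ifP => // Bi; have ri := rgt i Bi.
  have [TK|//] := staircase (tau i o) (K i) (ltW (ltac:(by rewrite invr_gt0) : 0 < (r i)^-1)); last first.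
    by move=> h; apply: (le_trans h); rewrite lee_fin; apply: ler_sum => j _; rewrite AE.
  exfalso; move: SL; apply/negP; rewrite -leNgt (le_trans (LK i Bi ri))// /S (bigD1 i)//=.
  have -> : \sum_(j < K i) (r i)^-1 * \1_(A i j) o = (K i)%:R / r i.
    by rewrite -TK; apply: eq_bigr => j _; rewrite AE.
  by rewrite lerDl sumr_ge0// => k _; rewrite sumr_ge0// => j _; rewrite mulr_ge0// invr_ge0.
have mSE : measurable_fun setT (EFin \o S) by exact/measurable_EFinP.
have SE0 o : (0 <= (EFin \o S) o)%E by rewrite lee_fin.
have mpC : measurable (path n xi `&` C) by exact: measurableI.
have LP : L * prob Pr (path n xi `&` C) <= \sum_(i < n | B i) \sum_(j < K i) (r i)^-1 * prob Pr (path n xi `&` A i j).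
  rewrite -lee_fin EFinM -probE//.
  apply: (@le_trans _ _ (\int[Pr]_(o in path n xi `&` C) (EFin \o S) o)%E).
    rewrite -integral_cst//; apply: ge0_le_integral => //.
    - by move=> o _; rewrite lee_fin ltW.
    - exact: measurable_funTS.
  apply: (@le_trans _ _ (\int[Pr]_(o in path n xi) (EFin \o S) o)%E).
    by apply: ge0_subset_integral => //; exact: measurable_funTS.
  have mf i j : measurable_fun (path n xi) (fun o => ((r i)^-1 * \1_(A i j) o)%:E).
    apply/measurable_EFinP; apply: measurable_funM; first exact: measurable_cst.
    exact: measurable_indic.
  have f0 i j o : path n xi o -> (0 <= ((r i)^-1 * \1_(A i j) o)%:E)%E.
    by move=> _; rewrite lee_fin mulr_ge0// invr_ge0.
  under eq_integral => o _.
    rewrite /= /S -sumEFin; under eq_bigr do rewrite -sumEFin.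
    rewrite -big_filter; over.
  rewrite ge0_integral_sum//; last 2 first.
  - by move=> i; exact: emeasurable_sum.
  - by move=> i o po; apply: sume_ge0 => j _; exact: f0.
  rewrite -sumEFin [in leRHS]big_mkcond/= big_filter [in leLHS]big_mkcond/=; apply: lee_sum => i _.
  case: ifP => // _; rewrite ge0_integral_sum//; last by move=> j o; exact: f0.
  rewrite -sumEFin; apply: lee_sum => j _.
  under eq_integral do rewrite EFinM.
  rewrite ge0_integralZl//; last 2 first.
  - by apply/measurable_EFinP; exact: measurable_indic.
  - by rewrite lee_fin invr_ge0.
  rewrite integral_indic// setIC EFinM; apply: lee_wpmul2l.
    by rewrite lee_fin invr_ge0.
  rewrite -probE; first exact: lexx.
  exact: measurableI.
have -> : 2 / L * spent lam b L (past xi n) = L^-1 * (2 * spent lam b L (past xi n)) by ring.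
rewrite mulrCA -ler_pdivrMl ?invr_gt0// invrK (le_trans LP)//.
rewrite spE mulr_sumr mulr_sumr big_mkcond/=; apply: ler_sum => i _.
case: ifP => Bi; last by rewrite !mulr0.
have ri := rgt i Bi; rewrite (gt_eqF ri).
under eq_bigr => j _.
  rewrite prob_path_tail//; last by rewrite mulr_ge0// invr_ge0.
  rewrite mulrCA (_ : rate (xi i) * _ = j%:R); last by rewrite mulrCA divff ?mulr1// gt_eqF.
  over.
rewrite -mulr_sumr ler_wpM2l ?prob_ge0// -mulr_sumr mulrC ler_wpM2r ?invr_ge0//.
exact: geometric_le2.
Qed.


Lemma prob_path_short n xi N a : (forall i, (i <= n)%N -> particle_count N (xi i)) ->
  prob Pr (path n xi `&` [set o | forall i, (a <= i < n)%N -> (tau i o <= 1%:E)%E]) <=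
  prob Pr (path n xi) * (1 - expR (- ((1 + lam) * N%:R))) ^+ (n - a).
Proof.
move=> pc; pose L : R := (1 + lam) * N%:R.
have rL i : (i <= n)%N -> rate (xi i) <= L by move=> /pc; exact: total_rate_le.
pose D j t := path_event n xi t `&` [set o | forall i, (a <= i < j)%N -> (tau i o <= 1%:E)%E].
have mD j t : measurable (D j t).
  apply: measurableI; first exact: measurable_path_event.
  rewrite (_ : [set o | _] = \bigcap_(i in [set i | (a <= i < j)%N]) ~` [set o | (1%:E < tau i o)%E]).
    by apply: bigcap_measurableType => i _; apply: measurableC; exact: measurable_tail.
  apply/seteqP; split => o h i /= ij; first by apply/negP; rewrite -leNgt; exact: h.
  by rewrite leNgt; apply/negP; exact: h.
pose f j t i := (if (a <= i < j)%N then 1 - expR (- rate (xi i)) else expR (- (rate (xi i) * t i))) *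
  ring_prob p lam (xi i) (xi i.+1).
have main j t : (j <= n)%N -> (forall i, 0 <= t i) -> (forall i, (a <= i < j)%N -> t i = 0) ->
    prob Pr (D j t) = prob Pr [set o | Y 0 o = xi 0%N] * \prod_(i < n) f j t i.
  elim: j t => [|j IHj] t jn t0 tz.
    rewrite (_ : D 0 t = path_event n xi t); last first.
      apply/seteqP; split => o; first by move=> [].
      by move=> h; split => // i; rewrite ltn0 andbF.
    rewrite prob_path//; congr (_ * _); apply: eq_bigr => i _.
    by rewrite /f ltn0 andbF.
  have [ja|aj] := ltnP j a.
    have e i : (a <= i < j.+1)%N = (a <= i < j)%N by lia.
    rewrite (_ : D j.+1 t = D j t).
      rewrite IHj ?(ltnW jn)//; last by move=> i; rewrite -e; exact: tz.
      by congr (_ * _); apply: eq_bigr => i _; rewrite /f e.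
    by rewrite /D; under eq_fun do under eq_forall do rewrite e.
  pose t' i := if i == j then 1 else t i.
  have tz' i : (a <= i < j)%N -> t i = 0 by move=> h; apply: tz; lia.
  (* The law is given on upper tails only, so a holding time at most one is a difference of the
     tails at [0] and at [1]. *)
  have -> : D j.+1 t = D j t `\` D j t'.
    apply/seteqP; split => o /=.
      move=> [[h1 h2] h3]; split; first by split => // i h; apply: h3; lia.
      move=> [[_ h4] _]; have := h4 j jn; rewrite /t' eqxx ltNge h3//; lia.
    move=> [[[h1 h2] h3] h4]; split => // i /andP[ai]; rewrite ltnS leq_eqVlt => /predU1P[->|ij].
      rewrite leNgt; apply/negP => t1; apply: h4; split => //; split => // k kn.
      by rewrite /t'; case: eqP => [->//|_]; exact: h2.
    by apply: h3; rewrite ai.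
  rewrite prob_setD//; last first.
    move=> o [[h1 h2] h3]; split => //; split => // i i_n; apply: le_lt_trans (h2 i i_n).
    rewrite lee_fin /t'; case: eqP => [->|//]; rewrite tz//; lia.
  rewrite !IHj ?(ltnW jn)//; last 2 first.
  - by move=> i; rewrite /t'; case: ifP.
  - by move=> i h; rewrite /t' ifF ?tz'//; lia.
  rewrite -mulrBr; congr (_ * _).
  rewrite [LHS](_ : _ = (expR (- (rate (xi j) * t j)) - expR (- (rate (xi j) * t' j))) *
      ring_prob p lam (xi j) (xi j.+1) * \prod_(i < n | i != Ordinal jn) f j t i); last first.
    rewrite (bigD1 (Ordinal jn))//= [X in _ - X](bigD1 (Ordinal jn))//= /f ltnn andbF.
    rewrite mulrBl mulrBl; congr (_ - _ * _); apply: eq_bigr => i ij.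
    have ij' : ((i : nat) == j) = false by apply/negbTE.
    by rewrite /t' ij'.
  rewrite [RHS](bigD1 (Ordinal jn))//= /f ltnSn aj/= /t' eqxx tz ?mulr0 ?oppr0 ?expR0 ?mulr1; last by lia.
  congr (_ * _ * _); apply: eq_bigr => i ij.
  have ij' : (i : nat) != j by exact: ij.
  by rewrite (_ : (i < j.+1)%N = (i < j)%N)//; lia.
have rho0 : 0 <= 1 - expR (- L).
  by rewrite subr_ge0 -expR0 ler_expR oppr_le0 mulr_ge0// ltW// lam1_gt0.
have -> : path n xi `&` [set o | forall i, (a <= i < n)%N -> (tau i o <= 1%:E)%E] = D n (fun=> 0) by [].
rewrite main// prob_path0 -mulrA ler_wpM2l ?prob_ge0//.
have -> : (1 - expR (- L)) ^+ (n - a) = \prod_(i < n) (if (a <= i)%N then 1 - expR (- L) else 1).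
  elim: (n) => [|m IHm]; first by rewrite big_ord0 sub0n.
  rewrite big_ord_recr/= -IHm; case: leqP => am; first by rewrite subSn// exprSr.
  have -> : (m - a = 0)%N by lia.
  have -> : (m.+1 - a = 0)%N by lia.
  by rewrite mulr1.
rewrite -big_split/=; apply: ler_prod => i _; rewrite /f ltn_ord andbT.
have rp0 : 0 <= ring_prob p lam (xi i) (xi i.+1).
  rewrite /ring_prob; case: ifP => // _; apply: fsumr_ge0 => x _.
  rewrite mulr_ge0 ?divr_ge0 ?ring_rate_ge0 ?total_rate_ge0//.
  rewrite addr_ge0//; first by rewrite mulr_ge0// divr_ge0 ?ltW// lam1_gt0.
  apply: fsumr_ge0 => y _; rewrite mulr_ge0// divr_ge0 ?(jump_ge0 hp)// ltW// lam1_gt0//.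
case: ifP => _; last first.
  by rewrite mulr0 oppr0 expR0 mul1r mulr1 rp0 lexx.
have re := rL i (ltnW (ltn_ord i)).
rewrite mulr_ge0//= 1?mulrC ?ler_wpM2l//.
  by rewrite lerD2l lerN2 ler_expR lerN2.
by rewrite subr_ge0 -expR0 ler_expR oppr_le0 total_rate_ge0.
Qed.

End jump_chain.

(* Not the restriction of functions of the analysis library. *)
Local Notation restrict := Defs.restrict.

Lemma masses_active d (eta : cfg d) : (forall z, eta z <> Sleeping) ->
  forall x, eta x = Active (masses eta x).
Proof. by move=> ns x; rewrite /masses; have := ns x; case: (eta x). Qed.

(** * The finite system started from a random configuration *)

Section finite_system.
Context (R : realType) (d : nat) (p : Zd d -> R) (lam : R).
Hypotheses (hp : jump_distribution p) (lam_gt0 : 0 < lam).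
Local Notation q := (instr_prob p lam).
Local Notation rate := (total_rate lam).
Local Notation annealed_mean := (mean lam (annealed p lam)).
Variable Q : probability (stack d) R.
Hypothesis Qcyl : forall (s : seq (Zd d * nat)) f, uniq s ->
  Q (cyl s f) = (\prod_(k <- s) q (f k))%:E.
Variable nu : probability (cfg d) R.
Hypothesis awake : nu [set eta | forall x : Zd d, eta x <> Sleeping] = 1%E.
Variable V : {fset Zd d}.
Context (dO : measure_display) (Omega : measurableType dO) (Pr : probability Omega R).
Variables (Y : nat -> Omega -> cfg d) (tau : nat -> Omega -> \bar R).
Hypotheses (mY : forall n, measurable_fun setT (Y n))
  (mtau : forall n, measurable_fun setT (tau n)).
Hypothesis law : forall n (xi : nat -> cfg d) (t : nat -> R), (forall i, 0 <= t i) ->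
  Pr [set o | (forall i, (i <= n)%N -> Y i o = xi i) /\
              (forall i, (i < n)%N -> ((t i)%:E < tau i o)%E)] =
  (pushforward nu (restrict V) [set xi 0%N] *
   (\prod_(i < n) (expR (- (rate (xi i) * t i)) * ring_prob p lam (xi i) (xi i.+1)))%:E)%E.

Lemma measurable_restrict : measurable_fun setT (@restrict d V).
Proof.
apply: measurable_to_cfg => x; rewrite /restrict; case: (x \in V); first exact: dmeas_cfg.
exact: dmeas_cst.
Qed.

Lemma measurable_awake : measurable [set eta : cfg d | forall x : Zd d, eta x <> Sleeping].
Proof.
rewrite (_ : [set _ | _] = \bigcap_x [set eta : cfg d | eta x <> Sleeping]).
  by apply: measurable_bigcap_count => x _; exact: (dmeas_cfg x [set k | k <> Sleeping]).
by apply/seteqP; split => eta /= h x *; exact: h.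
Qed.

(** The law is prescribed on single configurations. Awake ones supported in [V] are coded by a
    countable type, so the start can be split into countably many cases. *)
Definition decode (c : {ffun V -> nat}) : cfg d :=
  fun z => if insub z is Some v then Active (c v) else Active 0.

Lemma decode_inj : injective decode.
Proof.
move=> c c' h; apply/ffunP => v; have := congr1 (fun e : cfg d => e (val v)) h.
by rewrite /decode valK => -[].
Qed.

Lemma decode_awake c z : decode c z <> Sleeping.
Proof. by rewrite /decode; case: insub. Qed.

Lemma decode_count c : exists N, particle_count N (decode c).
Proof.
exists (\sum_(x <- V) mass (decode c x))%N; exists V; split => // x xV.
by rewrite /decode insubN.
Qed.

Let code n : option {ffun V -> nat} := choice.pickle_inv n.

Let start n := [set o | if code n is Some c then Y 0 o = decode c else False].
Let origin n := [set eta : cfg d | if code n is Some c then restrict V eta = decode c else False].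

Let mstart n : measurable (start n).
Proof. by rewrite /start; case: (code n) => [c|]; [exact: measurable_state|exact: measurable0]. Qed.

Let morigin n : measurable (origin n).
Proof.
rewrite /origin; case: (code n) => [c|]; last exact: measurable0.
by rewrite -[X in measurable X]setTI; exact: (measurable_restrict measurableT (measurable_cfg1 (decode c))).
Qed.

Let code_inj n m c : code n = Some c -> code m = Some c -> n = m.
Proof.
move=> h h'; have := @choice.pickle_invK {ffun V -> nat} n; have := @choice.pickle_invK {ffun V -> nat} m.
by rewrite -/(code n) -/(code m) h h' /= => -> ->.
Qed.

Let tstart : trivIset setT start.
Proof.
move=> n m _ _ [v []]; rewrite /start /=; case En: (code n) => [c|]//; case Em: (code m) => [c'|]// -> /decode_inj cc.
by subst c'; exact: (code_inj En Em).
Qed.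

Let torigin : trivIset setT origin.
Proof.
move=> n m _ _ [e []]; rewrite /origin /=; case En: (code n) => [c|]//; case Em: (code m) => [c'|]// -> /decode_inj cc.
by subst c'; exact: (code_inj En Em).
Qed.

Let start_origin n : Pr (start n) = nu (origin n).
Proof.
rewrite /start /origin; case: (code n) => [c|]; last by rewrite !measure0.
have := law 0 (fun=> decode c) (fun=> lexx 0); rewrite big_ord0 mule1 /pushforward => h.
transitivity (nu (restrict V @^-1` [set decode c])); last by [].
rewrite -h; congr (Pr _); apply/seteqP; split => o /=; last by move=> [h' _]; exact: h'.
by move=> h'; split => // -[].
Qed.

Let origin_full : nu (\bigcup_n origin n) = 1%E.
Proof.
have mU : measurable (\bigcup_n origin n) by exact: bigcupT_measurable.
apply/eqP; rewrite eq_le probability_le1//= -awake le_measure ?inE//; first exact: measurable_awake.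
move=> eta ns; pose c : {ffun V -> nat} := [ffun v => masses eta (val v)].
exists (choice.pickle c) => //; rewrite /origin /code /= choice.pickleK_inv.
apply/funext => z; rewrite /restrict /decode; case: insubP => [v vV ev|/negPf ->//].
by rewrite vV ffunE ev -(masses_active ns).
Qed.

Let start_full : Pr (~` \bigcup_n start n) = 0%E.
Proof.
have mU : measurable (\bigcup_n start n) by exact: bigcupT_measurable.
have U1 : Pr (\bigcup_n start n) = 1%E.
  rewrite -origin_full !measure_bigcup//.
  by apply: eq_eseriesr => n _; exact: start_origin.
by have := probability_setC Pr mU; rewrite U1 subee.
Qed.

Lemma prob_le_joint (B : set Omega) (D : set (cfg d * stack d)) (c : R) :
  measurable B -> measurable D -> 0 <= c ->
  (forall eta N, particle_count N eta -> (forall z, eta z <> Sleeping) ->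
   prob Pr ([set o | Y 0 o = eta] `&` B) <=
   prob Pr [set o | Y 0 o = eta] * (c + prob Q [set w | D (eta, w)])) ->
  (Pr B <= c%:E + \int[nu]_eta Q [set w | D (restrict V eta, w)])%E.
Proof.
move=> mB mD c0 H; pose g eta := (c%:E + Q [set w | D (restrict V eta, w)])%E.
have mh : measurable_fun setT (fun eta => Q [set w | D (restrict V eta, w)]).
  exact: (measurableT_comp (measurable_section Q mD) measurable_restrict).
have g0 eta : (0 <= g eta)%E by rewrite adde_ge0// lee_fin.
have mg : measurable_fun setT g by apply: emeasurable_funD.
have mU : measurable (\bigcup_n start n) by exact: bigcupT_measurable.
have mBn n : measurable (B `&` start n) by exact: measurableI.
apply: (@le_trans _ _ (\int[nu]_eta g eta)%E); last first.
  rewrite /g ge0_integralD// integral_cst//; apply: leeD => //.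
  rewrite -[leRHS]mule1; apply: lee_wpmul2l; first by rewrite lee_fin.
  exact: (@probability_le1 _ _ _ nu).
have mUB : measurable (\bigcup_n (B `&` start n)) by exact: bigcupT_measurable.
have mUC : measurable (~` \bigcup_n start n) by exact: measurableC.
apply: (@le_trans _ _ (Pr (\bigcup_n (B `&` start n) `|` ~` \bigcup_n start n))).
  apply: le_measure; rewrite ?inE//; first exact: measurableU.
  move=> o Bo; have [[n _ on]|nU] := pselect ((\bigcup_n start n) o); last by right.
  by left; exists n.
apply: (le_trans (measureU2 _ _ _)) => //.
rewrite [X in (_ + X <= _)%E](_ : _ = 0%E) ?adde0; last exact: start_full.
have tB : trivIset setT (fun n => B `&` start n).
  move=> n m _ _ [v [[_ vn] [_ vm]]]; apply: (tstart I I); by exists v.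
have hB := measure_semi_bigcup Pr mBn tB mUB.
apply: (@le_trans _ _ (\sum_(n <oo) Pr (B `&` start n))%E); first by rewrite -hB; exact: lexx.
apply: (@le_trans _ _ (\sum_(n <oo) \int[nu]_(eta in origin n) g eta)%E); last first.
  rewrite -ge0_integral_bigcup//; last exact: measurable_funTS.
  by apply: ge0_subset_integral => //; exact: bigcupT_measurable.
apply: lee_nneseries => // n _; rewrite /start /origin.
case E: (code n) => [a|]; last first.
  by rewrite setI0 measure0 integral_ge0.
have mo : measurable [set eta : cfg d | restrict V eta = decode a].
  by have := morigin n; rewrite /origin E.
have ms : measurable [set o | Y 0 o = decode a] by exact: measurable_state.
have mDa : measurable [set w | D (decode a, w)] by exact: measurable_sectionE.
rewrite (_ : (\int[nu]_(eta in _) g eta = (c + prob Q [set w | D (decode a, w)])%:E * nu [set eta : cfg d | restrict V eta = decode a])%E).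
  rewrite setIC probE; last exact: measurableI.
  have -> : nu [set eta : cfg d | restrict V eta = decode a] = Pr [set o | Y 0 o = decode a].
    by have := start_origin n; rewrite /start /origin E.
  rewrite muleC (probE Pr ms) -EFinM lee_fin.
  have [N pc] := decode_count a; apply: (H _ N) => // z; exact: decode_awake.
rewrite -integral_cst//; apply: eq_integral => eta; rewrite inE /g => ->.
by rewrite EFinD -probE.
Qed.

Lemma null_from_starts (B : set Omega) : measurable B ->
  (forall eta N, particle_count N eta -> prob Pr ([set o | Y 0 o = eta] `&` B) <= 0) ->
  Pr B = 0%E.
Proof.
move=> mB H; apply/eqP; rewrite eq_le measure_ge0 andbT.
have := @prob_le_joint B set0 0 mB measurable0 (lexx _); rewrite add0e integral0_eq; last first.
  by move=> eta _; exact: measure0.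
apply=> eta N pc _; apply: (le_trans (H eta N pc)).
by rewrite mulr_ge0// ?prob_ge0// add0r prob_ge0.
Qed.

Lemma dmeas_drops rho x n : dmeas (fun o => drops rho x (past (fun j => Y j o) n)).
Proof.
have mYx i : dmeas (fun o => Y i o x) by exact: (dmeas_measurable_comp (mY i) (dmeas_cfg x)).
elim: n => [|[|n] IHn]; [exact: dmeas_cst|exact: dmeas_cst|].
apply: (dmeas_op addn _ IHn); apply: (dmeas_comp nat_of_bool).
exact: (dmeas_occupation2 rho (mYx n) (mYx n.+1)).
Qed.

Lemma measurable_time_spent b n L : (forall i, dmeas (fun o => b (past (fun j => Y j o) i.+1))) ->
  measurable [set o | (L%:E <= time_spent Y tau b n o)%E].
Proof.
move=> mb; rewrite -[X in measurable X]setTI.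
apply: (emeasurable_fun_c_infty measurableT).
apply: emeasurable_sum => i.
apply: measurable_fun_ifT => //.
exact: dmeas_measurable_fun.
Qed.

Lemma prob_drops rho x n k : @detects d rho -> (forall a, rho a a = false) ->
  (Pr [set o | (k < drops rho x (past (fun j => Y j o) n))%N] <=
   \int[nu]_eta Q [set w | exists m, (k < parallel (@arw_rule d) (masses (restrict V eta)) w m x)%N])%E.
Proof.
move=> det irr; case: n => [|n]; first by rewrite set_false measure0 integral_ge0.
set B := [set o | _].
have mB : measurable B by exact: (dmeas_set (fun a => (k < a)%N) (dmeas_drops rho x n.+1)).
pose D := [set z : cfg d * stack d | exists m, (k < parallel (@arw_rule d) (masses z.1) z.2 m x)%N].
have mD : measurable D.
  rewrite (_ : D = \bigcup_m reaches k.+1 m x).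
    by apply: bigcupT_measurable => m; exact: measurable_reaches.
  by apply/seteqP; split => z [m]; [exists m|move=> _; exists m].
rewrite -[leRHS]add0e; apply: (@prob_le_joint B D 0) => // eta N pc ns; rewrite add0r.
apply: (le_trans (@prob_start_le_mean _ _ _ _ hp lam_gt0 _ _ _ _ _ _ mY mtau law N n
  (fun l => (k < drops rho x l)%N%:R) B eta mB pc _)).
  move=> xi _; have mp : measurable (path_event Y tau n xi (fun=> 0)) by exact: measurable_path_event.
  have [lt|ge] := boolP (k < drops rho x (past xi n.+1))%N.
    by rewrite mulr1; apply: (prob_sub _ (measurableI _ _ mp mB) mp) => o [].
  rewrite mulr0 (_ : _ `&` _ = set0) ?prob0//; apply/seteqP; split => // o [[Yo _] Bo].
  have eP : past (fun j => Y j o) n.+1 = past xi n.+1.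
    by apply: eq_past => i; rewrite ltnS; exact: Yo.
  by move: Bo; rewrite /B /mkset eP (negbTE ge).
rewrite ler_wpM2l ?prob_ge0// -lee_fin -probE; last exact: (measurable_sectionE eta mD).
exact: (annealed_drops hp lam_gt0 Qcyl x det irr n k pc (masses_active ns)).
Qed.

Lemma prob_time_le_joint b n L D c : 0 < L -> (forall i, dmeas (fun o => b (past (fun j => Y j o) i.+1))) ->
  measurable D -> 0 <= c ->
  (forall eta N, particle_count N eta -> (forall z, eta z <> Sleeping) ->
   ((annealed_mean n (capped lam b L) [::] eta [::])%:E <= c%:E + Q [set w | D (eta, w)])%E) ->
  (Pr [set o | (L%:E <= time_spent Y tau b n o)%E] <=
   c%:E + \int[nu]_eta Q [set w | D (restrict V eta, w)])%E.
Proof.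
move=> L0 mb mD c0 H; have mC := measurable_time_spent n L mb.
apply: prob_le_joint => // eta N pc ns.
apply: (le_trans (@prob_start_le_mean _ _ _ _ hp lam_gt0 _ _ _ _ _ _ mY mtau law N n _ _ eta mC pc _)).
  move=> xi _; exact: (prob_time_spent lam_gt0 mY mtau law xi L0 mC).
rewrite ler_wpM2l ?prob_ge0// -lee_fin EFinD -probE; first exact: (H _ _ pc).
exact: (measurable_sectionE eta mD).
Qed.

Lemma prob_active_time x n k L : 0 < L ->
  (Pr [set o | (L%:E <= time_spent Y tau (fun l => (0 < active (head (fun=> Active 0) l x))%N &&
     (drops loses x l < k)%N) n o)%E] <= (2 / L * k%:R)%:E)%E.
Proof.
move=> L0; pose b (l : seq (cfg d)) := (0 < active (head (fun=> Active 0) l x))%N && (drops loses x l < k)%N.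
have mb i : dmeas (fun o => b (past (fun j => Y j o) i.+1)).
  apply: (dmeas_op andb).
    apply: (dmeas_comp (fun a => 0 < active a)%N).
    exact: (dmeas_measurable_comp (mY i) (dmeas_cfg x)).
  exact: (dmeas_comp (fun a => a < k)%N (dmeas_drops loses x i.+1)).
have := @prob_time_le_joint b n L set0 (2 / L * k%:R) L0 mb measurable0.
rewrite [X in (_ + X)%E]integral0_eq ?adde0; last by move=> eta _; exact: measure0.
apply; first by rewrite mulr_ge0// divr_ge0// ltW.
move=> eta N pc _; rewrite [X in (_ + X)%E](_ : _ = 0%E) ?adde0; last exact: measure0.
by rewrite lee_fin; exact: (annealed_active hp lam_gt0 n x k pc L0).
Qed.

Lemma prob_slow_drops rho x n k m L n0 (V0 U : {fset Zd d}) : @detects d rho -> (forall a, rho a a = false) ->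
  0 < L -> (V0 `<=` V)%fset ->
  (forall xi w, (forall y, y \notin V0 -> xi y = 0%N) ->
    forall y, y \notin U -> parallel (@arw_rule d) xi w n0 y = 0%N) ->
  forall u, u = (fun (eta : cfg d) w => parallel (@arw_rule d) (masses (restrict V0 eta)) w n0) ->
  (Pr [set o | (L%:E <= time_spent Y tau (fun l => (drops rho x l < k)%N) n o)%E] <=
   (2 / L * (m%:R / (1 + lam)))%:E +
   \int[nu]_eta Q (~` [set w | (k <= outflow w (u eta w) x)%N /\ (\sum_(y <- U) u eta w y <= m)%N]))%E.
Proof.
move=> det irr L0 V0V US _ ->.
pose u (eta : cfg d) w := parallel (@arw_rule d) (masses (restrict V0 eta)) w n0.
pose D := ~` [set z : cfg d * stack d | (k <= outflow z.2 (u z.1 z.2) x)%N /\ (\sum_(y <- U) u z.1 z.2 y <= m)%N].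
have du y : dmeas (fun z : cfg d * stack d => u z.1 z.2 y).
  apply: (@dmeas_parallel _ _ d (fun=> @arw_rule d) (fun z => masses (restrict V0 z.1)) snd).
  - by move=> *; exact: dmeas_cst.
  - move=> v; apply: (dmeas_comp mass); rewrite /restrict; case: (v \in V0); last exact: dmeas_cst.
    exact: (dmeas_measurable_comp measurable_fst (dmeas_cfg v)).
  - by move=> j; exact: (dmeas_measurable_comp measurable_snd (dmeas_coord j)).
have mD : measurable D.
  apply: measurableC; apply: measurableI.
    apply: (dmeas_set (fun a => (k <= a)%N)); apply: dmeas_outflow => *; last exact: du.
    exact: (dmeas_measurable_comp measurable_snd (dmeas_coord _)).
  by apply: (dmeas_set (fun a => (a <= m)%N)); exact: dmeas_sum.
have rr eta : restrict V0 (restrict V eta) = restrict V0 eta.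
  apply/funext => z; rewrite /restrict; case: ifP => // z0.
  by rewrite (fsubsetP V0V).
rewrite [X in (_ + X)%E](_ : _ = \int[nu]_eta Q [set w | D (restrict V eta, w)])%E; last first.
  apply: eq_integral => eta _; congr (Q _); rewrite /D /u /=.
  by apply/seteqP; split => w /=; rewrite rr.
apply: prob_time_le_joint => //.
- by move=> i; exact: (dmeas_comp (fun a => a < k)%N (dmeas_drops rho x i.+1)).
- by rewrite mulr_ge0 ?divr_ge0 ?(ltW L0) ?(ltW (lam1_gt0 lam_gt0)).
move=> eta N pc ns.
have xx y : (masses (restrict V0 eta) y <= masses eta y)%N.
  by rewrite /masses /restrict; case: ifP.
have zU w y : y \notin U -> parallel (@arw_rule d) (masses (restrict V0 eta)) w n0 y = 0%N.
  move=> yU; apply: US => // z zV0.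
  by rewrite /masses /restrict (negbTE zV0).
have h := annealed_time hp lam_gt0 Qcyl x det irr n k m pc (masses_active ns) xx L0 zU.
exact: h.
Qed.

(** At thresholds [0] the path events already require positive holding times, and they exhaust the
    probability of each start. *)
Lemma holding_positive : {ae Pr, forall o, forall i, (0 < tau i o)%E}.
Proof.
have neg i : Pr [set o | ~ (0 < tau i o)%E] = 0%E.
  have mB : measurable [set o | ~ (0 < tau i o)%E].
    by apply: (@measurableC _ _ [set o | (0 < tau i o)%E]); exact: measurable_tail.
  apply: null_from_starts => // eta N pc.
  apply: (le_trans (@prob_start_le_mean _ _ _ _ hp lam_gt0 _ _ _ _ _ _ mY mtau law N i.+1
    (fun=> 0) _ eta mB pc _)).
    move=> xi _; rewrite mulr0 (_ : _ `&` _ = set0) ?prob0//; apply/seteqP; split => // o.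
    by move=> [[_ h] /=]; apply; exact: (h i (leqnn _)).
  rewrite mulr_ge0_le0 ?prob_ge0//; exact: (mean_bound _ _ _ _ (kernel_annealed hp lam_gt0) pc).
exists (\bigcup_i [set o | ~ (0 < tau i o)%E]); split.
- apply: bigcupT_measurable => i.
  by apply: (@measurableC _ _ [set o | (0 < tau i o)%E]); exact: measurable_tail.
- by apply: measure_bigcup_null => // i; apply: (@measurableC _ _ [set o | (0 < tau i o)%E]); exact: measurable_tail.
- by move=> o /= h; apply: contrapT => nb; apply: h => i; apply: contrapT => h; apply: nb; exists i.
Qed.

(** Topplings conserve particles, so the total rate stays at most [(1 + lam) * N] and each holding
    time exceeds one with probability bounded below. Hence jump times do not accumulate. *)
Lemma holding_long : {ae Pr, forall o, forall a, exists2 i, (a <= i)%N & (1%:E < tau i o)%E}.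
Proof.
pose B a := [set o | forall i, (a <= i)%N -> (tau i o <= 1%:E)%E].
have mshort i : measurable [set o | (tau i o <= 1%:E)%E].
  rewrite (_ : [set o | _] = ~` [set o | (1%:E < tau i o)%E]); first by apply: measurableC; exact: measurable_tail.
  by apply/seteqP; split => o /=; rewrite leNgt => /negP.
have mB a : measurable (B a).
  rewrite (_ : B a = \bigcap_(i in [set i | (a <= i)%N]) [set o | (tau i o <= 1%:E)%E])//.
  exact: bigcap_measurableType.
have neg a : Pr (B a) = 0%E.
  apply: null_from_starts => // eta N pc.
  pose rho := 1 - expR (- ((1 + lam) * N%:R)).
  have L0 : 0 <= (1 + lam) * N%:R by rewrite mulr_ge0// ltW// lam1_gt0.
  have rho1 : rho < 1 by rewrite /rho ltrBlDr ltrDl expR_gt0.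
  have rho0 : 0 <= rho by rewrite /rho subr_ge0 -[leRHS]expR0 ler_expR oppr_le0.
  rewrite leNgt; apply/negP => pos.
  have bound n : prob Pr ([set o | Y 0 o = eta] `&` B a) <= rho ^+ (n - a).
    apply: (le_trans (@prob_start_le_mean _ _ _ _ hp lam_gt0 _ _ _ _ _ _ mY mtau law N n
      (fun=> rho ^+ (n - a)) _ eta (mB a) pc _)).
      move=> xi pcxi; apply: le_trans (prob_path_short hp lam_gt0 mY mtau law a pcxi).
      have mp : measurable (path_event Y tau n xi (fun=> 0)) by exact: measurable_path_event.
      apply: prob_sub; [exact: measurableI| |by move=> o [h1 h2]; split => // i /andP[/h2]].
      apply: measurableI => //.
      rewrite (_ : [set o | _] = \bigcap_(i in [set i | (a <= i < n)%N]) [set o | (tau i o <= 1%:E)%E])//.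
      exact: bigcap_measurableType.
    rewrite -[leRHS]mul1r ler_pM ?prob_ge0 ?prob_le1//.
    - apply: mean_ge0 => //; [exact: kernel_annealed|by move=> l; rewrite exprn_ge0].
    - exact: measurable_state.
    - exact: (mean_bound _ _ _ _ (kernel_annealed hp lam_gt0) pc).
  have cv : rho ^+ n @[n --> \oo] --> (0 : R) by apply: cvg_expr; rewrite ger0_norm.
  have [m _ hm] : \forall n \near \oo, rho ^+ n < prob Pr ([set o | Y 0 o = eta] `&` B a).
    exact: (cvgr_lt _ cv _ pos).
  have := bound (m + a)%N; rewrite addnK leNgt; apply/negP; rewrite negbK; exact: (hm m (leqnn m)).
exists (\bigcup_a B a); split; [exact: bigcupT_measurable|exact: measure_bigcup_null|].
move=> o /= h; apply: contrapT => nb; apply: h => a; apply: contrapT => h; apply: nb.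
exists a => // i ai; rewrite leNgt; apply/negP => lt; by apply: h; exists i.
Qed.

End finite_system.

(** * Trajectories *)

Section sampling.
Context (R : realType) (d : nat).
Implicit Types (f : R -> cfg d) (r : seq rat) (x : Zd d).

Definition snap f r : seq (cfg d) := [seq f (ratr q) | q <- r].

Definition timeline (t : R) r : bool :=
  sorted (fun a b : rat => b < a) r && all (fun q : rat => (0 <= q) && (ratr q <= t)) r.

(** Lists of rational times are countable, which makes this a window event. *)
Definition many_drops rho k t x f := exists r, timeline t r /\ (k <= drops rho x (snap f r))%N.

Definition active_during (T L : R) x f :=
  forall q : rat, T <= ratr q <= T + L -> (0 < active (f (ratr q) x))%N.

Section measurability.
Context dX (X : measurableType dX) (F : X -> R -> cfg d) (t : R) (x : Zd d).
Hypothesis mF : forall s, 0 <= s <= t -> dmeas (fun o => F o s x).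

Lemma measurable_many_drops rho k : measurable [set o | many_drops rho k t x (F o)].
Proof.
rewrite (_ : [set o | _] = \bigcup_(r in [set r | timeline t r])
    [set o | (k <= drops rho x (snap (F o) r))%N]); last first.
  by apply/seteqP; split => o /= [r]; [move=> [tr kr]; exists r|exists r].
apply: measurable_bigcup_count => r /andP[_ tr].
apply: (dmeas_set (fun n => (k <= n)%N)).
elim: r tr => [|q r IHr] /=; first by move=> _; exact: dmeas_cst.
move=> /andP[/andP[q0 qt] /[dup] tr /IHr mr]; apply: (dmeas_op addn _ mr).
have mq : dmeas (fun o => F o (ratr q) x) by apply: mF; rewrite ler0q q0.
case: r tr {IHr mr} => [|q' r] /= tr; first exact: dmeas_cst.
apply: (dmeas_comp nat_of_bool); apply: dmeas_occupation2 => //.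
by apply: mF; case/andP: tr => /andP[q'0 ->] _; rewrite ler0q q'0.
Qed.

Lemma measurable_active_during T L : 0 <= T -> T + L = t ->
  measurable [set o | active_during T L x (F o)].
Proof.
move=> T0 TL; rewrite (_ : [set o | _] = \bigcap_(q in [set q : rat | T <= ratr q <= T + L])
    [set o | (0 < active (F o (ratr q) x))%N])//.
apply: measurable_bigcap_count => q /= /andP[qT qL].
apply: (dmeas_set (fun a => (0 < active a)%N)).
by apply: mF; rewrite (le_trans T0 qT) -TL.
Qed.

End measurability.

Lemma dmeas_generated (X : pointedType) (G : set (set X)) (f : X -> occupation) :
  (forall k, G [set w | f w = k]) -> dmeas (f : g_sigma_algebraType G -> occupation).
Proof.
move=> Gf B; pose dec (o : option nat) := if o is Some n then Active n else Sleeping.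
rewrite (_ : _ @^-1` B = \bigcup_(o in [set o | B (dec o)]) [set w : g_sigma_algebraType G | f w = dec o]).
  by apply: measurable_bigcup_count => o _; apply: sub_sigma_algebra; exact: Gf.
apply/seteqP; split => w /=; last by move=> [k Bk ->].
move=> Bw; exists (if f w is Active n then Some n else None).
  by move: Bw => /=; case: (f w).
by rewrite /=; case: (f w).
Qed.

Lemma dmeas_window t x s : 0 <= s <= t ->
  dmeas (fun w : g_sigma_algebraType (@window_gen R d [set` [fset x]%fset] `[0, t]) => (w : trajectory R d) s x).
Proof.
move=> st; apply: (@dmeas_generated (trajectory R d)) => k; exists x, s, k; split => //=; by rewrite ?inE ?in_itv.
Qed.

Lemma dmeas_path x s : 0 <= s -> dmeas (fun w : path_space R d => (w : trajectory R d) s x).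
Proof.
by move=> s0; apply: (@dmeas_generated (trajectory R d)) => k; exists x, s, k.
Qed.

Lemma window_many_drops rho k t x :
  window_event [fset x]%fset t [set w : path_space R d | many_drops rho k t x (state w)].
Proof. exact: (measurable_many_drops (@dmeas_window t x) rho k). Qed.

Lemma window_active_during T L x : 0 <= T ->
  window_event [fset x]%fset (T + L) [set w : path_space R d | active_during T L x (state w)].
Proof. by move=> T0; apply: (measurable_active_during (@dmeas_window (T + L) x)). Qed.

Lemma measurable_path_drops rho k t x :
  measurable [set w : path_space R d | many_drops rho k t x (state w)].
Proof.
by apply: (measurable_many_drops (F := fun w : path_space R d => state w)) => s /andP[s0 _]; exact: dmeas_path.
Qed.

Lemma measurable_path_active T L x : 0 <= T ->
  measurable [set w : path_space R d | active_during T L x (state w)].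
Proof.
move=> T0; apply: (measurable_active_during (F := fun w : path_space R d => state w) (t := T + L)) => //.
by move=> s /andP[s0 _]; exact: dmeas_path.
Qed.

End sampling.

(** * From the jump chain to a sampled trajectory *)

Section one_trajectory.
Context (R : realType) (d : nat).
Variables (y : nat -> cfg d) (tau : nat -> \bar R) (f : R -> cfg d).
Hypotheses (tau_gt0 : forall i, (0 < tau i)%E)
  (tau_long : forall a, exists2 i, (a <= i)%N & (1%:E < tau i)%E)
  (link : forall n (t : R), 0 <= t ->
    (\sum_(i < n) tau i <= t%:E < \sum_(i < n.+1) tau i)%E -> f t = y n).
Implicit Types (x : Zd d) (r : seq rat).

Definition arrival n : \bar R := (\sum_(i < n) tau i)%E.

Lemma arrivalS n : arrival n.+1 = (arrival n + tau n)%E.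
Proof. by rewrite /arrival big_ord_recr. Qed.

Lemma arrival_leS n : (arrival n <= arrival n.+1)%E.
Proof. by rewrite arrivalS leeDl// ltW. Qed.

Lemma arrival_le n m : (n <= m)%N -> (arrival n <= arrival m)%E.
Proof.
move=> /subnKC <-; elim: (m - n)%N => [|k IHk]; first by rewrite addn0.
by rewrite addnS (le_trans IHk)// arrival_leS.
Qed.

Lemma arrival_ge0 n : (0 <= arrival n)%E.
Proof. by apply: sume_ge0 => i _; exact: ltW. Qed.

Lemma arrival_infty (t : R) : exists n, (t%:E < arrival n)%E.
Proof.
have nat_le k : exists n, (k%:R%:E <= arrival n)%E.
  elim: k => [|k [n IHn]]; first by exists 0%N; rewrite arrival_ge0.
  have [i ni ti] := tau_long n; exists i.+1; rewrite arrivalS -natr1 EFinD leeD//.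
    exact: (le_trans IHn (arrival_le ni)).
  exact: ltW.
have [n hn] := nat_le (Num.bound `|t|); exists n; apply: lt_le_trans hn.
by rewrite lte_fin (le_lt_trans (ler_norm t))// archi_boundP.
Qed.

Lemma locate (t : R) : 0 <= t -> exists n, (arrival n <= t%:E < arrival n.+1)%E.
Proof.
move=> t0; have ex : exists n, (t%:E < arrival n)%E by exact: arrival_infty.
case: (ex_minnP ex) => -[|n] tn min.
  by move: tn; rewrite /arrival big_ord0 lte_fin ltNge t0.
exists n; rewrite tn andbT leNgt; apply/negP => /min.
by rewrite ltnn.
Qed.

Lemma drops_pastS rho x n : drops rho x (past y n.+2) =
  (rho (y n x) (y n.+1 x) + drops rho x (past y n.+1))%N.
Proof. by []. Qed.

(* A drop between two sampled states forces one between consecutive states. *)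
Lemma drops_skip x j n : (j <= n)%N ->
  (loses (y j x) (y n x) + drops loses x (past y j.+1) <= drops loses x (past y n.+1))%N.
Proof.
move=> /subnKC <-; elim: (n - j)%N => [|m IHm]; first by rewrite addn0 /loses ltnn.
rewrite addnS drops_pastS; move: IHm; rewrite /loses.
set a := rank (y j x); set b := rank (y (j + m)%N x); set c := rank _.
by case: (ltnP b a); case: (ltnP c b); case: (ltnP c a) => /=; lia.
Qed.

Lemma drops_snap x r : sorted (fun a b : rat => b < a) r -> all (fun q : rat => 0 <= q) r ->
  exists n, (drops loses x (snap f r) <= drops loses x (past y n))%N.
Proof.
case: r => [|q r] /=; first by exists 0%N.
move=> qr /andP[q0 r0].
suff : exists2 j, (arrival j <= (ratr q)%:E < arrival j.+1)%E &
    (drops loses x (snap f (q :: r)) <= drops loses x (past y j.+1))%N.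
  by move=> [j _ h]; exists j.+1.
elim: r q q0 qr r0 => [|q' r IHr] q q0 /=.
  by move=> _ _; have [j hj] := locate (ltac:(by rewrite ler0q) : 0 <= ratr q :> R); exists j.
move=> /andP[qq' qr] /andP[q'0 r0].
have [j' /[dup] hj' /andP[j'1 j'2] le'] := IHr q' q'0 qr r0.
have q0R : 0 <= ratr q :> R by rewrite ler0q.
have q0R' : 0 <= ratr q' :> R by rewrite ler0q.
have [j /[dup] hj /andP[j1 j2]] := locate q0R; exists j => //.
have jj : (j' <= j)%N.
  rewrite -ltnS ltnNge; apply/negP => /arrival_le h.
  have := le_lt_trans (le_trans h j'1) (_ : ((ratr q')%:E < (ratr q)%:E)%E).
  rewrite lte_fin ltr_rat => /(_ qq') lt; by have := lt_trans lt j2; rewrite ltxx.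
have E1 := link q0R hj; have E2 := link q0R' hj'.
rewrite -[X in (X <= _)%N]/(loses (f (ratr q') x) (f (ratr q) x) + drops loses x (snap f (q' :: r)))%N.
rewrite E1 E2; apply: leq_trans (drops_skip x jj); by rewrite leq_add2l.
Qed.

Lemma pick_time i (l t : R) : 0 <= l -> l < t -> (arrival i < t%:E)%E ->
  (l%:E < arrival i.+1)%E -> exists q : rat,
  [/\ 0 <= q, l <= ratr q <= t & (arrival i <= (ratr q)%:E < arrival i.+1)%E].
Proof.
move=> l0 lt it li; have ai : (arrival i = (fine (arrival i))%:E)%E.
  rewrite fineK// ge0_fin_numE ?arrival_ge0//; exact: (lt_le_trans it (leey _)).
set a := fine _ in ai.
have at' : a < t by rewrite -lte_fin -ai.
have [u [au ut ui]] : exists u : R, [/\ Num.max l a < u, u <= t & (u%:E <= arrival i.+1)%E].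
  have [le|lt'] := leP t%:E (arrival i.+1).
    by exists t; split => //; rewrite gt_max lt.
  have fi : (arrival i.+1 = (fine (arrival i.+1))%:E)%E.
    rewrite fineK// ge0_fin_numE ?arrival_ge0//; exact: (lt_le_trans lt' (leey _)).
  exists (fine (arrival i.+1)); rewrite -fi; split => //; last by rewrite -lee_fin -fi ltW.
  rewrite gt_max -!lte_fin -fi li -ai/=.
  by rewrite arrivalS ai lteDl// tau_gt0.
have [q] := rat_in_itvoo au; rewrite in_itv/= gt_max => /andP[/andP[lq aq] qu]; exists q; split.
- by rewrite -(@ler0q R) (le_trans l0)// ltW.
- by rewrite (ltW lq) (le_trans (ltW qu)).
- by rewrite ai lee_fin (ltW aq)/= (lt_le_trans _ ui)// lte_fin.
Qed.

(** One rational time is picked in each sojourn interval; the sampled states then reproduce the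
    chain exactly. *)
Lemma sample_jumps i (t : R) : (arrival i < t%:E)%E -> exists q r,
  [/\ timeline t (q :: r), snap f (q :: r) = past y i.+1 &
      (arrival i <= (ratr q)%:E < arrival i.+1)%E].
Proof.
move=> it; have t0 : 0 < t by rewrite -lte_fin (le_lt_trans (arrival_ge0 i)).
have pos j : (0 < arrival j.+1)%E.
  by rewrite arrivalS (lt_le_trans (tau_gt0 j))// leeDr// arrival_ge0.
elim: i it => [|i IHi] it.
  have [q [q0 /andP[_ qt] hq]] := pick_time (lexx 0) t0 it (pos 0%N); exists q, [::]; split => //.
    by rewrite /timeline /= q0 qt.
  by rewrite /= (link _ hq)// ler0q.
have [q' [r [/andP[/= s' a'] sn hq']]] := IHi (le_lt_trans (arrival_leS i) it).
have [q [q0 /andP[_ qt] hq]] := pick_time (lexx 0) t0 it (pos i.+1); exists q, (q' :: r); split => //.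
  rewrite /timeline /= q0 qt s' andbT /= a' andbT -(ltr_rat R) -lte_fin.
  by case/andP: hq' => _ h; case/andP: hq => h' _; exact: (lt_le_trans h h').
by rewrite /= (link _ hq) ?ler0q//; congr (_ :: _); exact: sn.
Qed.

Definition spent_time (b : seq (cfg d) -> bool) n : \bar R :=
  (\sum_(i < n) if b (past y i.+1) then tau i else 0)%E.

Lemma few_drops_slow rho k x (t : R) : 0 < t -> ~ many_drops rho k t x f ->
  exists n, (t%:E <= spent_time (fun l => (drops rho x l < k)%N) n)%E.
Proof.
move=> t0 few; have ex : exists n, (t%:E <= arrival n)%E.
  by have [n /ltW h] := arrival_infty t; exists n.
(* For the first [n] with arrival at or after [t], all earlier states are entered before [t] and can
   be sampled; having few drops, they all count, and together they last until [t]. *)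
case: (ex_minnP ex) => n tn min; exists n; apply: (le_trans tn).
rewrite /spent_time /arrival le_eqVlt; apply/orP; left; apply/eqP.
apply: eq_bigr => i _; rewrite ifT// ltnNge; apply/negP => k_le; apply: few.
have it : (arrival i < t%:E)%E by rewrite ltNge; apply/negP => /min; rewrite leqNgt ltn_ord.
by have [q [r [tl sn _]]] := sample_jumps it; exists (q :: r); rewrite sn.
Qed.

Lemma active_long k x (T L : R) : 0 <= T -> 0 < L -> active_during T L x f ->
  (forall n, (drops loses x (past y n) <= k)%N) ->
  exists n, (L%:E <= spent_time (fun l => (0 < active (head (fun=> Active 0%N) l x))%N &&
     (drops loses x l < k.+1)%N) n)%E.
Proof.
move=> T0 L0 act few; set b := (X in spent_time X).
have bE i : b (past y i.+1) = (0 < active (y i x))%N.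
  by rewrite /b ltnS few andbT.
(* [cl] clamps a time to [[T, T + L]]: the part of the window covered by the first [n] sojourns is
   at most the active time recorded so far. *)
pose cl (s : \bar R) : R := if s is s'%:E then Num.max T (Num.min s' (T + L)) else T + L.
have clT s : T <= cl s.
  by case: s => [s||] /=; rewrite ?le_max ?lexx// lerDl ltW.
suff main n : ((cl (arrival n) - T)%:E <= spent_time b n)%E.
  have [n hn] := arrival_infty (T + L); exists n; apply: le_trans (main n).
  rewrite lee_fin; case: (arrival n) hn => [s||] //=; last by move=> _; lra.
  by rewrite lte_fin => /ltW h; rewrite min_r// lerBrDr addrC le_max lexx orbT.
elim: n => [|n IHn].
  rewrite /spent_time /arrival !big_ord0 lee_fin /= min_l; last by lra.
  by rewrite max_l// subrr.
have -> : spent_time b n.+1 = (spent_time b n + if b (past y n.+1) then tau n else 0)%E.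
  by rewrite /spent_time big_ord_recr.
have [/andP[n1 n2]|out] := boolP ((arrival n < (T + L)%:E)%E && (T%:E < arrival n.+1)%E); last first.
  rewrite -[leLHS]adde0; apply: leeD; last by case: ifP => // _; exact: ltW.
  apply: le_trans IHn; rewrite lee_fin lerD2r.
  have hi s : cl s <= T + L.
    by case: s => [s||] //=; rewrite ge_max ge_min lexx orbT andbT lerDl ltW.
  have top s : ((T + L)%:E <= s)%E -> cl s = T + L.
    case: s => [s||] //=; rewrite lee_fin => h.
    by rewrite min_r// max_r// lerDl ltW.
  have low s : (0 <= s)%E -> (s <= T%:E)%E -> cl s = T.
    by case: s => [s||] //= _; rewrite lee_fin => h; rewrite max_l// ge_min h.
  move: out; rewrite negb_and -!leNgt => /orP[h|h]; first by rewrite (top _ h) hi.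
  by rewrite (low _ (arrival_ge0 _) h) clT.
have nfin : (arrival n = (fine (arrival n))%:E)%E.
  rewrite fineK// ge0_fin_numE ?arrival_ge0//; exact: (lt_le_trans n1 (leey _)).
have ax : (0 < active (y n x))%N.
  have TL : T < T + L by rewrite ltrDl.
  have [q [q0 qT hq]] := pick_time T0 TL n1 n2.
  by have := act q qT; rewrite (link _ hq)// ler0q.
rewrite bE ax; have sp0 : (spent_time b n != -oo)%E.
  by rewrite gt_eqF// (lt_le_trans (ltNyr (cl (arrival n) - T))).
rewrite arrivalS; case: (tau n) (tau_gt0 n) => [e||] //= e0; last by rewrite [X in (_ <= X)%E]addey// leey.
rewrite lte_fin in e0; apply: (@le_trans _ _ ((cl (arrival n) - T)%:E + e%:E)%E); last exact: leeD.
rewrite nfin -EFinD lee_fin /=.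
rewrite addrAC lerD2r; set s := fine _; have := clT s%:E; rewrite /cl => Tcl.
rewrite ge_max (le_trans Tcl) ?lerDl ?(ltW e0)//=.
apply: (@le_trans _ _ (Num.min s (T + L) + e)); last by rewrite lerD2r le_max lexx orbT.
rewrite addr_minl le_min ge_min lexx /= ge_min; apply/orP; right.
by rewrite lerDl ltW.
Qed.

End one_trajectory.

(** * Activity of a cadlag path and its number of drops *)

Section trajectories.
Context (R : realType) (d : nat).
Implicit Types (w : trajectory R d) (r : seq rat) (x : Zd d) (rho : occupation -> occupation -> bool).

Lemma right_constant w x (t : R) : 0 <= t ->
  exists2 e : R, 0 < e & forall s, t <= s < t + e -> w s x = w t x.
Proof.
move=> t0; have [/(_ t t0) h _] := state_cadlag w x.
have [e /= e0 He] : exists2 e : R, 0 < e & ball t e `<=` [set s | t < s -> w s x = w t x].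
  by move/nbhs_ballP : h => [e e0 He]; exists e.
exists e => // s /andP[]; rewrite le_eqVlt => /predU1P[->//|ts se].
by apply: He => //; rewrite /ball/= ltr0_norm ?subr_lt0// opprB ltrBlDl.
Qed.

Lemma left_constant w x (t : R) : 0 < t ->
  exists2 e : R, 0 < e & exists k, forall s, t - e < s < t -> w s x = k.
Proof.
move=> t0; have [_ /(_ t t0)[k h]] := state_cadlag w x.
have [e /= e0 He] : exists2 e : R, 0 < e & ball t e `<=` [set s | s < t -> w s x = k].
  by move/nbhs_ballP : h => [e e0 He]; exists e.
exists e => //; exists k => s /andP[es st].
by apply: He => //; rewrite /ball/= gtr0_norm ?subr_gt0// ltrBlDl -ltrBlDr.
Qed.

Lemma rational_after w x (t : R) : 0 <= t -> exists q : rat, [/\ 0 <= q, t < ratr q & w (ratr q) x = w t x].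
Proof.
move=> t0; have [e e0 he] := right_constant w x t0.
have te : t < t + e by rewrite ltrDl.
have [q] := rat_in_itvoo te; rewrite in_itv/= => /andP[tq qe]; exists q; split => //.
  by rewrite -(@ler0q R) (le_trans t0)// ltW.
by apply: he; rewrite (ltW tq).
Qed.

Lemma stays_activeE : @stays_active R d = \bigcap_x \bigcap_(n : nat)
  \bigcup_(q in [set q : rat | 0 <= q /\ n%:R <= ratr q :> R])
  [set w : path_space R d | (0 < active (state w (ratr q) x))%N].
Proof.
apply/seteqP; split => [w act x _ n _|w act x T].
  have [t [t0 nt at']] := act x n%:R.
  have [q [q0 tq qE]] := rational_after w x t0.
  by exists q; rewrite /= ?qE//; split => //; rewrite (le_trans nt)// ltW.
have [q [q0 nq] aq] := act x I (Num.bound `|T|) I; exists (ratr q); split => //.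
  by rewrite ler0q.
apply: le_trans nq; rewrite (le_trans (ler_norm T))// ltW//; exact: archi_boundP.
Qed.

Lemma measurable_stays_active : measurable (@stays_active R d).
Proof.
rewrite stays_activeE; apply: measurable_bigcap_count => x _.
apply: measurable_bigcap_count => n _; apply: measurable_bigcup_count => q [q0 _].
by apply: (dmeas_set (fun a => (0 < active a)%N)); apply: dmeas_path; rewrite ler0q.
Qed.

(** After a timeline with the maximal number of drops the rank is nondecreasing at rational times. A
    site that is active again and again then remains active from some time on. *)
Lemma eventually_active w x k : (forall t : R, ~ many_drops loses k t x w) ->
  (forall T : R, exists t, [/\ 0 <= t, T <= t & (0 < active (w t x))%N]) ->
  exists T : nat, forall q : rat, T%:R <= ratr q :> R -> (0 < active (w (ratr q) x))%N.
Proof.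
move=> few often.
pose V n := `[< exists t r, timeline (t : R) r /\ drops loses x (snap w r) = n >].
have exV : exists n, V n by exists 0%N; apply/asboolP; exists 0, [::].
have ubV n : V n -> (n <= k)%N.
  move=> /asboolP[t [r [tr <-]]]; rewrite leqNgt; apply/negP => /ltnW lt.
  by apply: (few t); exists r.
case: (ex_maxnP exV ubV) => m /asboolP[t0 [r [tr dr]]] max_m.
have mono (s s' : rat) : 0 <= s -> head 0 r < s -> s <= s' -> (rank (w (ratr s) x) <= rank (w (ratr s') x))%N.
  move=> s0 hs; rewrite le_eqVlt => /predU1P[->//|ss'].
  rewrite leqNgt; apply/negP => lt.
  have /max_m : V (drops loses x (snap w (s' :: s :: r))).
    apply/asboolP; exists (Num.max t0 (ratr s')), (s' :: s :: r); split => //.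
    move: tr; rewrite /timeline /= => /andP[sr ar].
    rewrite ss' (ltW (le_lt_trans s0 ss')) s0 !le_max lexx ler_rat (ltW ss') !orbT /=.
    apply/andP; split.
      by case: (r) sr hs => [|h r'] //= -> ->.
    by apply: sub_all ar => q /andP[-> q_t]; rewrite le_max q_t.
  rewrite leqNgt; apply/negP; rewrite negbK -dr /= /loses lt add1n ltnS.
  exact: leq_addl.
have next (s : rat) : exists q : rat, [/\ 0 <= q, s < q & (0 < active (w (ratr q) x))%N].
  have [t [t0' st at']] := often (ratr s).
  have [q [q0 tq qE]] := rational_after w x t0'; exists q; split => //; last by rewrite qE.
  by rewrite -(ltr_rat R) (le_lt_trans st).
have conclude (s : rat) : (forall q, s <= q -> (0 < active (w (ratr q) x))%N) ->
    exists T : nat, forall q : rat, T%:R <= ratr q :> R -> (0 < active (w (ratr q) x))%N.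
  move=> h; exists (Num.bound `|s|) => q; rewrite -ratr_nat ler_rat => sq; apply: h.
  by apply: le_trans sq; rewrite (le_trans (ler_norm s))// ltW// archi_boundP.
have [s1 [s1_0 hs1 a1]] := next (head 0 r).
(* Sleep is the only inactive state of positive rank. If it occurs at [s2], the next active state
   has rank above it, thus two particles or more, and the site can sleep no more. *)
have [[s2 [s12 S2]]|noS] := pselect (exists s2, s1 <= s2 /\ w (ratr s2) x = Sleeping); last first.
  apply: (conclude s1) => q s1q; have := mono _ _ s1_0 hs1 s1q.
  have nS : w (ratr q) x <> Sleeping by move=> e; apply: noS; exists q.
  by case: (w (ratr s1) x) a1 nS => [[|[|n]]|] //=; case: (w (ratr q) x) => [[|[|n']]|].
have s2_0 : 0 <= s2 by exact: le_trans s12.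
have hs2 : head 0 r < s2 by exact: lt_le_trans s12.
have [s3 [s3_0 s23 a3]] := next s2; apply: (conclude s3) => q s3q.
have := mono _ _ s3_0 (lt_trans hs2 s23) s3q; have := mono _ _ s2_0 hs2 (ltW s23).
rewrite S2; case: (w (ratr s3) x) a3 => [[|[|n]]|] //= _ _.
by case: (w (ratr q) x) => [[|[|n']]|].
Qed.

Lemma drops_cat rho x (l1 l2 : seq (cfg d)) :
  (drops rho x (l1 ++ l2) <= drops rho x l1 + 1 + drops rho x l2)%N.
Proof.
elim: l1 => [|e [|e' l1] IHl] /=; first by rewrite leq_addl.
  by rewrite !addn0 leq_add2r; case: (l2) => // a l; case: (rho _ _).
by move: IHl => /=; lia.
Qed.

Lemma drops_constant rho x (l : seq (cfg d)) k : (forall a, rho a a = false) ->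
  (forall e, e \in l -> e x = k) -> drops rho x l = 0%N.
Proof.
move=> irr; elim: l => [|e [|e' l] IHl] //= h.
have /= := IHl (fun a al => h a (mem_behead (s := e :: e' :: l) al)) => ->.
by rewrite !h ?irr ?inE ?eqxx ?orbT.
Qed.

Lemma sorted_split (P : pred rat) r : (forall a b, a < b -> P a -> P b) ->
  sorted (fun a b : rat => b < a) r -> r = [seq q <- r | P q] ++ [seq q <- r | ~~ P q].
Proof.
move=> up; elim: r => //= q r IHr qr.
have /IHr rE : sorted (fun a b : rat => b < a) r by exact: path_sorted qr.
case: ifP => /= Pq; first by rewrite -rE.
have : all (fun a => a < q) r.
  by apply: order_path_min qr => a b c; move=> ab bc; exact: lt_trans ab.
move=> /allP lt; have nP a : a \in r -> P a = false.
  by move=> /lt aq; apply/negP => /(up _ _ aq); rewrite Pq.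
rewrite (eq_in_filter (a2 := pred0)) ?filter_pred0//= (eq_in_filter (a2 := predT)) ?filter_predT//.
by move=> a /nP ->.
Qed.

(** Compactness of [[0, T]] as a supremum argument: left limits bring the bound up to [S], and right
    continuity pushes it beyond. *)
Lemma drops_finite w rho x (T : R) : (forall a, rho a a = false) -> 0 <= T ->
  exists K, forall r, timeline T r -> (drops rho x (snap w r) <= K)%N.
Proof.
move=> irr T0.
pose bounded (s : R) := exists K, forall r, timeline s r -> (drops rho x (snap w r) <= K)%N.
pose A := [set s : R | 0 <= s <= T /\ bounded s].
have A0 : A 0.
  split; first by rewrite lexx.
  exists 0%N => r /andP[_ /allP ar]; rewrite (@drops_constant rho x _ (w 0 x))// => e.
  move=> /mapP[q /ar /andP[q0 q1] ->]; congr (w _ x); apply/eqP.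
  by rewrite eq_le q1 ler0q.
have supA : has_sup A by split; [exists 0|exists T => s [/andP[]]].
pose S := sup A.
have S0 : 0 <= S by apply: ub_le_sup => //; case: supA.
have ST : S <= T by apply: ge_sup; [exists 0|move=> s [/andP[]]].
have [e e0 he] := right_constant w x S0.
have [a [[/andP[a0 aT] [K hK]] aS [k hk]]] : exists a, [/\ A a, a <= S &
    exists k, forall s, a < s < S -> w s x = k].
  move: S0; rewrite le_eqVlt => /predU1P[S0|Sp].
    exists 0; split; rewrite -?S0//; exists (w 0 x) => s /andP[s0 s1].
    by have := lt_trans s0 s1; rewrite ltxx.
  have [e' e'0 [k hk]] := left_constant w x Sp.
  have [a Aa ea] := sup_adherent e'0 supA; exists a; split => //.
    by apply: ub_le_sup => //; case: supA.
  by exists k => s /andP[as' sS]; apply: hk; rewrite sS andbT (lt_trans ea).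
have ext s : S <= s < S + e -> bounded s.
  (* Samples at or after [S] and samples strictly between [a] and [S] form two blocks constant at
     [x]; each of the two junctions adds at most one drop to those up to [a]. *)
  move=> /andP[Ss se]; exists (K + 2)%N => r /andP[sr /allP ar].
  have up (c : R) : forall u v : rat, u < v -> c <= ratr u -> c <= ratr v.
    by move=> u v uv h; rewrite (le_trans h)// ler_rat ltW.
  have up' (c : R) : forall u v : rat, u < v -> c < ratr u -> c < ratr v.
    by move=> u v uv h; rewrite (lt_le_trans h)// ler_rat ltW.
  pose r1 := [seq q <- r | S <= ratr q]; pose r2 := [seq q <- r | ~~ (S <= ratr q)].
  have gt_trans : transitive (fun u v : rat => v < u) by move=> v u z uv vz; exact: lt_trans uv.
  have sr2 : sorted (fun u v : rat => v < u) r2 by exact: sorted_filter.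
  pose r3 := [seq q <- r2 | a < ratr q]; pose r4 := [seq q <- r2 | ~~ (a < ratr q)].
  have -> : snap w r = snap w r1 ++ (snap w r3 ++ snap w r4).
    by rewrite -!map_cat -(sorted_split (up' a) sr2) -(sorted_split (up S) sr).
  have d1 : drops rho x (snap w r1) = 0%N.
    apply: (@drops_constant rho x _ (w S x)) => // _ /mapP[q + ->].
    rewrite mem_filter => /andP[Sq /ar /andP[_ qs]]; apply: he.
    by rewrite Sq (le_lt_trans qs).
  have d3 : drops rho x (snap w r3) = 0%N.
    apply: (@drops_constant rho x _ k) => // _ /mapP[q + ->].
    rewrite !mem_filter => /and3P[aq Sq _]; apply: hk.
    by rewrite aq ltNge.
  have d4 : (drops rho x (snap w r4) <= K)%N.
    apply: hK; rewrite /timeline sorted_filter//=; apply/allP => q.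
    by rewrite !mem_filter -leNgt => /and3P[qa _ /ar /andP[-> _]].
  by have := drops_cat rho x (snap w r1) (snap w r3 ++ snap w r4);
     have := drops_cat rho x (snap w r3) (snap w r4); lia.
move: ST; rewrite le_eqVlt => /predU1P[ST|ST].
  by rewrite -/(bounded T) -ST; apply: ext; rewrite lexx ltrDl.
pose s := Num.min T (S + e / 2).
have Ss : S < s by rewrite lt_min ST ltrDl divr_gt0.
have As : A s.
  split; first by rewrite (le_trans S0 (ltW Ss)) ge_min lexx.
  apply: ext; rewrite (ltW Ss)/= (@le_lt_trans _ _ (S + e / 2))//; first by rewrite ge_min lexx orbT.
  by rewrite ltrD2l ltr_pdivrMr// ltr_pMr// ltr1n.
have : s <= S by apply: ub_le_sup => //; case: supA.
by rewrite leNgt Ss.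
Qed.

Lemma recurrent_active w x : (forall k, exists t : R, many_drops active_loses k t x w) ->
  forall T : R, exists t, [/\ 0 <= t, T <= t & (0 < active (w t x))%N].
Proof.
move=> many T; apply: contrapT => none.
have irr a : active_loses a a = false by rewrite /active_loses /loses ltnn andbF.
pose T' := Num.max 0 T; have T'0 : 0 <= T' by rewrite le_max lexx.
have inact s : T' <= s -> active (w s x) = 0%N.
  rewrite ge_max => /andP[s0 Ts]; apply/eqP; rewrite -leqn0 leqNgt; apply/negP => h.
  by apply: none; exists s.
have [K hK] := drops_finite w x irr T'0.
(* At most [K] drops before [T'], one across it, and none afterwards as no active state is seen
   there: [K.+2] is out of reach. *)
have [t [r [/andP[sr /allP ar] kr]]] := many K.+2.
move: kr; apply/negP; rewrite -ltnNge.
have up : forall u v : rat, u < v -> T' <= ratr u -> T' <= ratr v :> R.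
  by move=> u v uv h; rewrite (le_trans h)// ler_rat ltW.
have gt_trans : transitive (fun u v : rat => v < u) by move=> v u z uv vz; exact: lt_trans uv.
pose r1 := [seq q <- r | T' <= ratr q]; pose r2 := [seq q <- r | ~~ (T' <= ratr q)].
have -> : snap w r = snap w r1 ++ snap w r2 by rewrite -map_cat -(sorted_split up sr).
have d1 : drops active_loses x (snap w r1) = 0%N.
  have : forall e, e \in snap w r1 -> active (e x) = 0%N.
    by move=> _ /mapP[q + ->]; rewrite mem_filter => /andP[h _]; exact: inact.
  elim: (snap w r1) => [|e [|e' l] IHl] //= h.
  have /= := IHl (fun a al => h a (mem_behead (s := e :: e' :: l) al)) => ->.
  by rewrite /active_loses h ?inE ?eqxx ?orbT.
have d2 : (drops active_loses x (snap w r2) <= K)%N.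
  apply: hK; rewrite /timeline sorted_filter//=; apply/allP => q.
  by rewrite mem_filter -ltNge => /andP[/ltW qT /ar /andP[-> _]].
by have := drops_cat active_loses x (snap w r1) (snap w r2); rewrite d1; lia.
Qed.

End trajectories.

(** * Infinite volume *)

Lemma ae_measure_le dX (X : measurableType dX) (R : realType) (P : {measure set X -> \bar R})
    (G A B : set X) : measurable A -> measurable B -> {ae P, forall o, G o} ->
  (forall o, G o -> A o -> B o) -> (P A <= P B)%E.
Proof.
move=> mA mB [N [mN N0 sub]] h.
apply: (@le_trans _ _ (P (B `|` N))).
  apply: le_measure; rewrite ?inE//; first exact: measurableU.
  move=> o Ao; have [No|nN] := pselect (N o); first by right.
  by left; apply: h => //; apply: contrapT => nG; apply: nN; exact: sub.
apply: (le_trans (measureU2 _ mB mN)).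
by rewrite [X in (_ + X <= _)%E](_ : _ = 0%E) ?adde0//; exact: N0.
Qed.

Lemma measure_union_le dX (X : measurableType dX) (R : realType) (P : {measure set X -> \bar R})
    (F : nat -> set X) c : (forall n, measurable (F n)) -> (forall n, F n `<=` F n.+1) ->
  (forall n, (P (F n) <= c)%E) -> (P (\bigcup_n F n) <= c)%E.
Proof.
move=> mF FS Fc; have mU : measurable (\bigcup_n F n) by exact: bigcupT_measurable.
have nd : {homo F : n m / (n <= m)%N >-> (n <= m)%O}.
  apply: homo_leq => [A|B A C|n]; [exact: lexx|exact: le_trans|].
  by apply/subsetPset; exact: FS.
have cv := nondecreasing_cvg_mu mF mU nd (mu := P).
rewrite -(cvg_lim _ cv)//; apply: lime_le; first by apply/cvg_ex; exists (P (\bigcup_n F n)).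
exact: nearW.
Qed.

Lemma exhaustion_le (R : realType) d (f : {fset Zd d} -> \bar R) (l c : \bar R) V0 :
  f V @[V --> @exhaustion d] --> l -> (forall V, (V0 `<=` V)%fset -> (f V <= c)%E) -> (l <= c)%E.
Proof.
move=> fl fc.
have cl : closed [set y : \bar R | (y <= c)%E] by exact: closed_ereal_ge_ereal.
apply: (cl l) => A Al; have [W _ hW] := fl _ Al.
exists (f (V0 `|` W)%fset); split; first by apply: fc; exact: fsubsetUl.
by apply: hW => /=; exact: fsubsetUr.
Qed.

Section finite_volume.
Context (R : realType) (d : nat) (p : Zd d -> R) (lam : R).
Hypotheses (hp : jump_distribution p) (lam_gt0 : 0 < lam).
Local Notation q := (instr_prob p lam).
Variable Q : probability (stack d) R.
Hypothesis Qcyl : forall (s : seq (Zd d * nat)) f, uniq s ->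
  Q (cyl s f) = (\prod_(k <- s) q (f k))%:E.
Variable nu : probability (cfg d) R.
Hypothesis awake : nu [set eta | forall x : Zd d, eta x <> Sleeping] = 1%E.

Definition toppled_more k x (eta : cfg d) : set (stack d) :=
  [set w | exists m, (k < parallel (@arw_rule d) (masses eta) w m x)%N].

Definition progressed n0 k m x (V0 U : {fset Zd d}) (eta : cfg d) : set (stack d) :=
  let u w := parallel (@arw_rule d) (masses (restrict V0 eta)) w n0 in
  [set w | (k <= outflow w (u w) x)%N /\ (\sum_(y <- U) u w y <= m)%N].

Section one_volume.
Variables (V : {fset Zd d}) (PV : probability (path_space R d) R).
Hypothesis PVlaw : finite_ARW_law p lam (pushforward nu (restrict V)) PV.

Lemma finite_volume_drops k t x : 0 <= t ->
  (PV [set w : path_space R d | many_drops loses k.+1 t x (state w)] <=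
   \int[nu]_eta Q (toppled_more k x (restrict V eta)))%E.
Proof.
move=> t0; have [dO [ Omega [Pr [Y [tau [X [mY mtau law [mX link] PVE]]]]]]] := PVlaw.
have pos := holding_positive hp lam_gt0 Q awake mY mtau law.
have long := holding_long hp lam_gt0 Q awake mY mtau law.
have mW := @measurable_path_drops R d loses k.+1 t x.
rewrite PVE//.
pose B n := [set o | (k < drops loses x (past (fun j => Y j o) n))%N].
have mB n : measurable (B n) by exact: (dmeas_set (fun a => (k < a)%N) (dmeas_drops mY loses x n)).
apply: (@le_trans _ _ (Pr (\bigcup_n B n))).
  apply: (ae_measure_le _ _ (filterI (filterI pos long) link)).
  - by rewrite -[X in measurable X]setTI; exact: (mX measurableT _ mW).
  - exact: bigcupT_measurable.
  move=> o [[po lo] li] [r [/andP[sr ar] kr]].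
  have a0 : all (fun q : rat => 0 <= q) r by apply: sub_all ar => v /andP[].
  have [n hn] := drops_snap po lo li x sr a0.
  by exists n => //; exact: (leq_trans kr hn).
apply: measure_union_le => // [[|n] o|n]; [by []|by move=> h; exact: (leq_trans h (leq_addl _ _))|].
exact: (prob_drops hp lam_gt0 Qcyl awake mY mtau law x n k (@detects_loses d) (fun a => ltnn _)).
Qed.

Lemma time_spent_mono (dO : measure_display) (Omega : measurableType dO) (Y : nat -> Omega -> cfg d) (tau : nat -> Omega -> \bar R) b n (L : R) o :
  (forall i, (0 < tau i o)%E) ->
  (L%:E <= time_spent Y tau b n o)%E -> (L%:E <= time_spent Y tau b n.+1 o)%E.
Proof.
move=> po h; apply: (le_trans h); rewrite /time_spent big_ord_recr/=.
by rewrite leeDl//; case: ifP => // _; exact: ltW.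
Qed.

(** Either [x] has more than [k] departures, or it spends a time of at least [L] active with no more
    than [k] of them. *)
Lemma finite_volume_active k T L x : 0 <= T -> 0 < L ->
  (PV [set w : path_space R d | active_during T L x (state w)] <=
   (2 / L * k.+1%:R)%:E + \int[nu]_eta Q (toppled_more k x (restrict V eta)))%E.
Proof.
move=> T0 L0; have [dO [ Omega [Pr [Y [tau [X [mY mtau law [mX link] PVE]]]]]]] := PVlaw.
have pos := holding_positive hp lam_gt0 Q awake mY mtau law.
have long := holding_long hp lam_gt0 Q awake mY mtau law.
have mW := @measurable_path_active R d T L x T0.
rewrite PVE//.
pose B n := [set o | (k < drops loses x (past (fun j => Y j o) n))%N].
have mB n : measurable (B n) by exact: (dmeas_set (fun a => (k < a)%N) (dmeas_drops mY loses x n)).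
pose b (l : seq (cfg d)) := (0 < active (head (fun=> Active 0) l x))%N && (drops loses x l < k.+1)%N.
(* Positivity of all holding times is built into the events so that they increase with [n]. *)
pose G := \bigcap_i [set o | (0%:E < tau i o)%E].
have mG : measurable G by apply: bigcapT_measurable => i; exact: measurable_tail.
pose C n := [set o | (L%:E <= time_spent Y tau b n o)%E].
have mC n : measurable (C n).
  apply: (measurable_time_spent mtau) => i; apply: (dmeas_op andb).
    apply: (dmeas_comp (fun a => 0 < active a)%N).
    exact: (dmeas_measurable_comp (mY i) (dmeas_cfg x)).
  exact: (dmeas_comp (fun a => a < k.+1)%N (dmeas_drops mY loses x i.+1)).
have mGC n : measurable (G `&` C n) by exact: measurableI.
apply: (@le_trans _ _ (Pr (\bigcup_n (G `&` C n) `|` \bigcup_n B n))).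
  apply: (ae_measure_le _ _ (filterI (filterI pos long) link)).
  - by rewrite -[X in measurable X]setTI; exact: (mX measurableT _ mW).
  - by apply: measurableU; exact: bigcupT_measurable.
  move=> o [[po lo] li] act.
  have [[n _ Bn]|nB] := pselect ((\bigcup_n B n) o); first by right; exists n.
  left; have few n : (drops loses x (past (fun j => Y j o) n) <= k)%N.
    by rewrite leqNgt; apply/negP => h; apply: nB; exists n.
  have [n hn] := active_long po lo li T0 L0 act few.
  by exists n => //; split => // i _; exact: po.
apply: le_trans (measureU2 _ _ _) _; [exact: bigcupT_measurable|exact: bigcupT_measurable|].
apply: leeD.
  apply: measure_union_le => // [n o [Go Co]|n].
    split=> //; apply: time_spent_mono Co => i; exact: (Go i I).
  apply: (@le_trans _ _ (Pr (C n))); first by apply: le_measure; rewrite ?inE// => o [].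
  exact: (prob_active_time hp lam_gt0 Q awake mY mtau law x n k.+1 L0).
apply: measure_union_le => // [[|n] o|n]; [by []|by move=> h; exact: (leq_trans h (leq_addl _ _))|].
exact: (prob_drops hp lam_gt0 Qcyl awake mY mtau law x n k (@detects_loses d) (fun a => ltnn _)).
Qed.

Lemma finite_volume_slow n0 k m t x (V0 U : {fset Zd d}) : 0 < t -> (V0 `<=` V)%fset ->
  (forall xi w, (forall y, y \notin V0 -> xi y = 0%N) ->
    forall y, y \notin U -> parallel (@arw_rule d) xi w n0 y = 0%N) ->
  (PV (~` [set w : path_space R d | many_drops active_loses k t x (state w)]) <=
   (2 / t * (m%:R / (1 + lam)))%:E + \int[nu]_eta Q (~` progressed n0 k m x V0 U eta))%E.
Proof.
move=> t0 V0V US; have [dO [ Omega [Pr [Y [tau [X [mY mtau law [mX link] PVE]]]]]]] := PVlaw.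
have pos := holding_positive hp lam_gt0 Q awake mY mtau law.
have long := holding_long hp lam_gt0 Q awake mY mtau law.
have mW := measurableC (@measurable_path_drops R d active_loses k t x).
rewrite PVE//.
pose b (l : seq (cfg d)) := (drops active_loses x l < k)%N.
pose G := \bigcap_i [set o | (0%:E < tau i o)%E].
have mG : measurable G by apply: bigcapT_measurable => i; exact: measurable_tail.
pose C n := [set o | (t%:E <= time_spent Y tau b n o)%E].
have mC n : measurable (C n).
  apply: (measurable_time_spent mtau) => i.
  exact: (dmeas_comp (fun a => a < k)%N (dmeas_drops mY active_loses x i.+1)).
have mGC n : measurable (G `&` C n) by exact: measurableI.
apply: (@le_trans _ _ (Pr (\bigcup_n (G `&` C n)))).
  apply: (ae_measure_le _ _ (filterI (filterI pos long) link)).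
  - by rewrite -[X in measurable X]setTI; exact: (mX measurableT _ mW).
  - exact: bigcupT_measurable.
  move=> o [[po lo] li] few.
  have [n hn] := few_drops_slow po lo li t0 few.
  by exists n => //; split => // i _; exact: po.
apply: measure_union_le => // [n o [Go Co]|n].
  split=> //; apply: time_spent_mono Co => i; exact: (Go i I).
have irr a : active_loses a a = false by rewrite /active_loses /loses ltnn andbF.
apply: (@le_trans _ _ (Pr (C n))); first by apply: le_measure; rewrite ?inE// => o [].
exact: (prob_slow_drops hp lam_gt0 Qcyl awake mY mtau law x n k m
  (@detects_active_loses d) irr t0 V0V US (erefl _)).
Qed.

End one_volume.

Lemma measurable_toppled_more k x :
  measurable [set z : cfg d * stack d | toppled_more k x z.1 z.2].
Proof.
rewrite (_ : [set z | _] = \bigcup_m reaches k.+1 m x).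
  by apply: bigcupT_measurable => m; exact: measurable_reaches.
by apply/seteqP; split => z [m]; [exists m|move=> _; exists m].
Qed.

Lemma toppled_more_restrict V k x eta : toppled_more k x (restrict V eta) `<=` toppled_more k x eta.
Proof.
move=> w [m h]; exists m; apply: (leq_trans h); apply: (parallel_mono_init (@arw_rule_mono d)) => y.
by rewrite /masses /restrict; case: ifP.
Qed.

Lemma integral_toppled_restrict V k x :
  (\int[nu]_eta Q (toppled_more k x (restrict V eta)) <= \int[nu]_eta Q (toppled_more k x eta))%E.
Proof.
have mD := measurable_toppled_more k x.
apply: ge0_le_integral => //.
- exact: (measurableT_comp (measurable_section Q mD) (measurable_restrict V)).
- exact: (measurable_section Q mD).
move=> eta _; apply: le_measure; rewrite ?inE; last exact: toppled_more_restrict.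
- exact: (measurable_sectionE (restrict V eta) mD).
- exact: (measurable_sectionE eta mD).
Qed.

Variable P : probability (path_space R d) R.
Hypothesis Plaw : ARW_law p lam nu P.

Lemma prob_many_drops k t x : 0 <= t ->
  (P [set w : path_space R d | many_drops loses k.+1 t x (state w)] <=
   \int[nu]_eta Q (toppled_more k x eta))%E.
Proof.
move=> t0; have [PV [PVlaw lim]] := Plaw.
have cv := lim _ _ _ t0 (@window_many_drops R d loses k.+1 t x).
apply: (exhaustion_le (V0 := fset0) cv) => V _.
exact: (le_trans (finite_volume_drops (PVlaw V) k x t0) (integral_toppled_restrict _ _ _)).
Qed.

Lemma prob_active_during k T L x : 0 <= T -> 0 < L ->
  (P [set w : path_space R d | active_during T L x (state w)] <=
   (2 / L * k.+1%:R)%:E + \int[nu]_eta Q (toppled_more k x eta))%E.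
Proof.
move=> T0 L0; have [PV [PVlaw lim]] := Plaw.
have TL0 : 0 <= T + L by rewrite addr_ge0// ltW.
have cv := lim _ _ _ TL0 (@window_active_during R d T L x T0).
apply: (exhaustion_le (V0 := fset0) cv) => V _.
apply: (le_trans (finite_volume_active (PVlaw V) k x T0 L0)); apply: leeD => //.
exact: integral_toppled_restrict.
Qed.

Lemma prob_few_drops n0 k m t x (V0 U : {fset Zd d}) : 0 < t ->
  (forall xi w, (forall y, y \notin V0 -> xi y = 0%N) ->
    forall y, y \notin U -> parallel (@arw_rule d) xi w n0 y = 0%N) ->
  (P (~` [set w : path_space R d | many_drops active_loses k t x (state w)]) <=
   (2 / t * (m%:R / (1 + lam)))%:E + \int[nu]_eta Q (~` progressed n0 k m x V0 U eta))%E.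
Proof.
move=> t0 US; have [PV [PVlaw lim]] := Plaw.
have mW : window_event [fset x]%fset t (~` [set w : path_space R d | many_drops active_loses k t x (state w)]).
  pose W := g_sigma_algebraType (@window_gen R d [set` [fset x]%fset] `[0, t]).
  have mD : measurable ([set w | many_drops active_loses k t x (state w)] : set W).
    exact: (@window_many_drops R d active_loses k t x).
  exact: (measurableC mD).
have cv := lim _ _ _ (ltW t0) mW.
apply: (exhaustion_le (V0 := V0) cv) => V V0V.
exact: (finite_volume_slow (PVlaw V) k m x t0 V0V US).
Qed.

End finite_volume.

(** * Limits under the joint law of configuration and stacks *)

Section joint_limits.
Context (R : realType) (d : nat) (nu : probability (cfg d) R) (Q : probability (stack d) R).
Implicit Types (A B : set (cfg d * stack d)).

Definition joint A : \bar R := (\int[nu]_eta Q [set w | A (eta, w)])%E.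

Lemma jointE A : joint A = (nu \x Q)%E A.
Proof.
apply: eq_integral => eta _; congr (Q _).
by apply/seteqP; split => w /=; rewrite /xsection/= ?inE.
Qed.

Lemma joint_le1 A : measurable A -> (joint A <= 1)%E.
Proof.
move=> mA; apply: (@le_trans _ _ (\int[nu]_eta (cst 1%:E eta))%E).
  apply: ge0_le_integral => //; first exact: measurable_section.
  by move=> eta _; apply: probability_le1; exact: measurable_sectionE.
rewrite integral_cst// mul1e; exact: (@probability_le1 _ _ _ nu).
Qed.

Lemma joint_U A B : measurable A -> measurable B -> (joint (A `|` B) <= joint A + joint B)%E.
Proof. by move=> mA mB; rewrite !jointE; exact: measureU2. Qed.

Lemma joint_null A (N : set (cfg d)) : measurable A -> measurable N -> nu N = 0%E ->
  (forall eta, ~ N eta -> Q [set w | A (eta, w)] = 0%E) -> joint A = 0%E.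
Proof.
move=> mA mN N0 h; apply/eqP; rewrite eq_le integral_ge0// andbT -N0.
rewrite -[X in nu X]setIT -integral_indic//; apply: ge0_le_integral => //.
- exact: measurable_section.
- by apply/measurable_EFinP; exact: measurable_indic.
move=> eta _; rewrite indicE; have [Ne|nN] := pselect (N eta).
  by rewrite mem_set//; apply: probability_le1; exact: measurable_sectionE.
by rewrite h// lee_fin.
Qed.

Lemma joint_decreasing (F : nat -> set (cfg d * stack d)) (e : R) :
  (forall n, measurable (F n)) -> (forall n, F n.+1 `<=` F n) ->
  joint (\bigcap_n F n) = 0%E -> 0 < e -> exists n, (joint (F n) < e%:E)%E.
Proof.
move=> mF FS F0 e0; apply: contrapT => /forallNP no.
have mI : measurable (\bigcap_n F n) by exact: bigcapT_measurable.
have ni : {homo F : m n / (m <= n)%N >-> (n <= m)%O}.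
  move=> m n /subnKC <-; elim: (n - m)%N => [|k IHk]; first by rewrite addn0; exact: lexx.
  rewrite addnS; apply: le_trans IHk; apply/subsetPset; exact: FS.
have fin : ((nu \x Q)%E (F 0%N) < +oo)%E.
  by rewrite -jointE (le_lt_trans (joint_le1 (mF 0%N)))// ltry.
have cv := nonincreasing_cvg_mu fin mF mI ni.
have : (e%:E <= (nu \x Q)%E (\bigcap_n F n))%E.
  rewrite -(cvg_lim _ cv)//; apply: lime_ge.
    by apply/cvg_ex; exists ((nu \x Q)%E (\bigcap_n F n)).
  by apply: nearW => n /=; rewrite leNgt; apply/negP => h; apply: (no n); rewrite jointE.
have F0' := F0; rewrite jointE in F0'.
rewrite [X in (_ <= X)%E](_ : _ = 0%E); last exact: F0'.
by rewrite lee_fin leNgt e0.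
Qed.

End joint_limits.

Lemma ereal_le0 (R : realType) (a : \bar R) :
  (0 <= a)%E -> (forall e : R, 0 < e -> (a <= e%:E)%E) -> a = 0%E.
Proof.
move=> a0 h; apply/eqP; rewrite eq_le a0 andbT.
by apply/lee_addgt0Pr => e e0; rewrite add0e; exact: h.
Qed.

(** * Fixation without explosion, activity with explosion *)

Section dichotomy.
Context (R : realType) (d : nat) (p : Zd d -> R) (lam : R).
Hypotheses (hp : jump_distribution p) (lam_gt0 : 0 < lam).
Local Notation q := (instr_prob p lam).
Variable Q : probability (stack d) R.
Hypothesis Qcyl : forall (s : seq (Zd d * nat)) f, uniq s ->
  Q (cyl s f) = (\prod_(k <- s) q (f k))%:E.
Variable nu : probability (cfg d) R.
Hypothesis awake : nu [set eta | forall x : Zd d, eta x <> Sleeping] = 1%E.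
Variable P : probability (path_space R d) R.
Hypothesis Plaw : ARW_law p lam nu P.

Lemma measurable_explosion_neq y : measurable [set eta | explosion_prob Q eta <> y].
Proof.
rewrite (_ : [set _ | _] = setT `&` [set eta | explosion_prob Q eta != y]).
  exact: (emeasurable_neq measurableT (measurable_explosion_prob Q) y).
by rewrite setTI; apply/seteqP; split => eta /= /eqP.
Qed.

Lemma toppled_more_limit (e : R) : nu [set eta | explosion_prob Q eta <> 0%E] = 0%E -> 0 < e ->
  exists k, (\int[nu]_eta Q (toppled_more k 0 eta) < e%:E)%E.
Proof.
move=> fixed e0.
apply: (@joint_decreasing _ _ nu Q (fun k => [set z | toppled_more k 0 z.1 z.2])) => //.
- by move=> k; exact: measurable_toppled_more.
- by move=> k z [m h]; exists m; exact: ltnW.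
apply: (joint_null _ (measurable_explosion_neq 0%E) fixed).
  by apply: bigcapT_measurable => k; exact: measurable_toppled_more.
move=> eta /contrapT <-; rewrite /explosion_prob; congr (Q _).
apply/seteqP; split => w /= h k; first by have [m hm] := h k I; exists m; exact: ltnW.
by move=> _; have [m hm] := h k.+1; exists m.
Qed.

(** The origin alone decides. With boundedly many departures, recurrent activity there becomes
    permanent activity by [eventually_active], which is unlikely to last long without departures. *)
Lemma stays_active_null : nu [set eta | explosion_prob Q eta <> 0%E] = 0%E ->
  P (@stays_active R d) = 0%E.
Proof.
move=> fixed; have mS := @measurable_stays_active R d.
pose W k (n : nat) := [set w : path_space R d | many_drops loses k.+1 n%:R 0 (state w)].
have mW k n : measurable (W k n) by exact: measurable_path_drops.
pose E (T : nat) := [set w : path_space R d | forall u : rat, T%:R <= ratr u :> R -> (0 < active (state w (ratr u) 0%R))%N].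
have mE T : measurable (E T).
  rewrite (_ : E T = \bigcap_(u in [set u : rat | T%:R <= ratr u :> R]) [set w : path_space R d | (0 < active (state w (ratr u) 0%R))%N])//.
  apply: measurable_bigcap_count => u Tu; apply: (dmeas_set (fun a => (0 < active a)%N)).
  by apply: dmeas_path; exact: (le_trans (ler0n R T)).
have mUW k : measurable (\bigcup_n W k n) by exact: bigcupT_measurable.
have mUE : measurable (\bigcup_T E T) by exact: bigcupT_measurable.
have sub k : @stays_active R d `<=` \bigcup_n W k n `|` \bigcup_T E T.
  move=> w act; have [Ww|nW] := pselect ((\bigcup_n W k n) w); first by left.
  right; have few t : ~ many_drops loses k.+1 t 0 (state w).
    move=> [r [/andP[sr ar] kr]]; apply: nW; exists (Num.bound `|t|) => //.
    exists r; split => //; rewrite /timeline sr /=; apply: sub_all ar => u /andP[-> ut].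
    by rewrite (le_trans ut)// (le_trans (ler_norm t))// ltW//; exact: archi_boundP.
  by have [T hT] := eventually_active few (act 0); exists T.
apply: ereal_le0 => // e e0; have e2 : 0 < e / 2 by rewrite divr_gt0.
have [k hk] := toppled_more_limit fixed (divr_gt0 e2 (ltr0n _ 2)).
apply: (@le_trans _ _ (P (\bigcup_n W k n `|` \bigcup_T E T))).
  by apply: le_measure; rewrite ?inE//; exact: measurableU.
apply: (le_trans (measureU2 _ (mUW k) mUE)).
rewrite [e]splitr EFinD; apply: leeD.
  apply: measure_union_le => // [n w [r [/andP[sr ar] kr]]|n].
    exists r; split => //; rewrite /timeline sr /=; apply: sub_all ar => u /andP[-> un].
    by rewrite (le_trans un)// ler_nat.
  apply: (le_trans (prob_many_drops hp lam_gt0 Qcyl awake Plaw k 0 (ler0n R n))).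
  apply: (le_trans (ltW hk)); rewrite lee_fin ler_pdivrMr//; lra.
apply: measure_union_le => // [T w h u Tu|T].
  by apply: h; rewrite (le_trans _ Tu)// ler_nat.
(* Chosen so that [2 / L * k.+1%:R] equals a quarter of [e]. *)
pose L := 2 * k.+1%:R / (e / 2 / 2).
have e4 : 0 < e / 2 / 2 by rewrite divr_gt0.
have L0 : 0 < L by rewrite /L divr_gt0// mulr_gt0.
apply: (@le_trans _ _ (P [set w : path_space R d | active_during T%:R L 0 (state w)])).
  apply: le_measure; rewrite ?inE//; first exact: measurable_path_active.
  by move=> w h u /andP[Tu _]; exact: h.
apply: (le_trans (prob_active_during hp lam_gt0 Qcyl awake Plaw k 0 (ler0n R T) L0)).
rewrite [e / 2]splitr EFinD; apply: leeD; last exact: ltW.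
rewrite lee_fin le_eqVlt; apply/orP; left; apply/eqP; rewrite /L; field.
by rewrite !gt_eqF// -?natr1 ?ltr_wpDl.
Qed.

Definition box (j : nat) : {fset Zd d} :=
  [fset z in pmap (@choice.unpickle (Zd d)) (iota 0 j)]%fset.

Lemma in_box j z : (z \in box j) = [exists i : 'I_j, choice.unpickle i == Some z].
Proof.
rewrite /box inE /= mem_pmap; apply/mapP/existsP => [[i]|[i /eqP zi]].
  by rewrite mem_iota => /= ij zi; exists (Ordinal ij); rewrite zi.
by exists (val i) => //; rewrite mem_iota /=.
Qed.

Lemma box_mono j j' : (j <= j')%N -> (box j `<=` box j')%fset.
Proof.
move=> jj; apply/fsubsetP => z; rewrite !in_box => /existsP[i zi].
by apply/existsP; exists (widen_ord jj i).
Qed.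

Lemma box_full z : exists j, z \in box j.
Proof.
exists (choice.pickle z).+1; rewrite in_box; apply/existsP.
by exists ord_max; rewrite /= choice.pickleK.
Qed.

Lemma parallel_box eta w n x : exists J, forall j, (J <= j)%N ->
  parallel (@arw_rule d) (masses (restrict (box j) eta)) w n x =
  parallel (@arw_rule d) (masses eta) w n x.
Proof.
elim: n x => [|n IHn] x; first by exists 0%N.
have [J0 h0] := IHn x; have [J1 h1] := box_full x.
have [Je he] := choice (fun e => IHn (x - dir e)).
exists (maxn (maxn J0 J1) (\max_e Je e)) => j; rewrite !geq_max => /andP[/andP[j0 j1] je] /=.
rewrite h0//; congr (_ + nat_of_bool _)%N; rewrite /unstable.
rewrite (asleep_local w (h0 j j0)); congr (arw_rule _ _); rewrite /load.
rewrite (outflow_local w (h0 j j0)); congr (_ + _ - _)%N.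
  by rewrite /masses /restrict (fsubsetP (box_mono j1) _ h1).
apply: eq_bigr => e _; apply: flow_local; apply: he.
exact: leq_trans (leq_bigmax e) je.
Qed.

(** The index [j] is both the box and the number of parallel steps, so that one increasing sequence
    of events exhausts space and time. *)
Definition outflows k x (j : nat) : set (cfg d * stack d) :=
  [set z | (k <= outflow z.2 (parallel (@arw_rule d) (masses (restrict (box j) z.1)) z.2 j) x)%N].

Lemma dmeas_box_parallel j n y :
  dmeas (fun z : cfg d * stack d => parallel (@arw_rule d) (masses (restrict (box j) z.1)) z.2 n y).
Proof.
apply: (@dmeas_parallel _ _ d (fun=> @arw_rule d) (fun z => masses (restrict (box j) z.1)) snd).
- by move=> *; exact: dmeas_cst.
- move=> v; apply: (dmeas_comp mass); rewrite /restrict; case: (v \in box j); last exact: dmeas_cst.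
  exact: (dmeas_measurable_comp measurable_fst (dmeas_cfg v)).
- by move=> i; exact: (dmeas_measurable_comp measurable_snd (dmeas_coord i)).
Qed.

Lemma measurable_outflows k x j : measurable (outflows k x j).
Proof.
apply: (dmeas_set (fun a => (k <= a)%N)); apply: dmeas_outflow => *; last exact: dmeas_box_parallel.
exact: (dmeas_measurable_comp measurable_snd (dmeas_coord _)).
Qed.

Lemma outflow_mono w (h h' : Zd d -> nat) x : (h x <= h' x)%N -> (outflow w h x <= outflow w h' x)%N.
Proof. by move=> /subnKC e; rewrite !outflowE -e iotaD count_cat leq_addr. Qed.

Lemma outflows_mono k x j : outflows k x j `<=` outflows k x j.+1.
Proof.
move=> z; rewrite /outflows /= => h; apply: (leq_trans h); apply: outflow_mono.
apply: (@leq_trans (parallel (@arw_rule d) (masses (restrict (box j) z.1)) z.2 j.+1 x)).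
  exact: leq_addr.
apply: (parallel_mono_init (@arw_rule_mono d)) => y; rewrite /masses /restrict.
by case: ifP => // yj; rewrite (fsubsetP (box_mono (leqnSn j)) _ yj).
Qed.

(** Explosion counts all instructions, sleeps included; since jumps occur infinitely often in the
    stack, it also produces [k] departures, and these need only a finite box. *)
Lemma outflows_unbounded eta w x e k :
  (forall m, exists j, (m <= j)%N /\ w (x, j) = Some e) -> arw_explodes eta x w ->
  exists j, outflows k x j (eta, w).
Proof.
move=> often expl.
have [M hM] : exists M, (k <= count (fun j => w (x, j) != None) (iota 0 M))%N.
  elim: k => [|k [M hM]]; first by exists 0%N.
  have [j [Mj wj]] := often M; exists j.+1.
  have := iotaD 0 j 1; rewrite addn1 => ->; rewrite count_cat /= add0n wj /= addn1 ltnS (leq_trans hM)//.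
  by rewrite -(subnKC Mj) iotaD count_cat leq_addr.
have [n hn] := expl M; have [J hJ] := parallel_box eta w n x.
exists (maxn J n); rewrite /outflows /= (leq_trans hM)//.
apply: (@leq_trans (outflow w (parallel (@arw_rule d) (masses eta) w n) x)).
  by rewrite outflowE -(subnKC hn) iotaD count_cat leq_addr.
apply: outflow_mono; rewrite -(hJ (maxn J n) (leq_maxl _ _)).
by apply: parallel_leS; exact: leq_maxr.
Qed.

Hypothesis nuE : translation_ergodic nu.

(** Explosion yields [k] departures in some finite box and time up to probability [e / 2]; the
    topplings made there are finitely many, hence at most some [m] up to another [e / 2]. *)
Lemma progress_limit k x (e : R) : nu [set eta | explosion_prob Q eta <> 1%E] = 0%E -> 0 < e ->
  exists n0 m V0 U,
  (forall xi w, (forall y, y \notin V0 -> xi y = 0%N) ->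
    forall y, y \notin U -> parallel (@arw_rule d) xi w n0 y = 0%N) /\
  (\int[nu]_eta Q (~` progressed n0 k m x V0 U eta) <= e%:E)%E.
Proof.
move=> expl e0; have e2 : 0 < e / 2 by rewrite divr_gt0.
have [a qa] := exists_dir hp lam_gt0.
have q_ge0 := instr_prob_ge0 hp lam_gt0; have q_sum1 := instr_prob_sum1 hp lam_gt0.
have mO j := measurable_outflows k x j.
pose N := [set eta | Q (arw_explodes eta x) <> 1%E].
have NE : N = translate x @^-1` [set eta | explosion_prob Q eta <> 1%E].
  by apply/seteqP; split => eta; rewrite /N /= (explosion_prob_translate Qcyl).
have mN : measurable N.
  rewrite NE -[X in measurable X]setTI.
  exact: (measurable_translate x measurableT (measurable_explosion_neq 1%E)).
have N0 : nu N = 0%E by rewrite NE nuE.1//; exact: measurable_explosion_neq.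
have [j hj] : exists j, (joint nu Q (~` outflows k x j) < (e / 2)%:E)%E.
  apply: joint_decreasing => //.
  - by move=> j; exact: measurableC.
  - by move=> j; apply: subsetC; exact: outflows_mono.
  apply: (joint_null _ mN N0); first by apply: bigcapT_measurable => j; exact: measurableC.
  move=> eta /contrapT Q1.
  pose A : set (stack d) := [set w | ~ (forall m, exists j, (m <= j)%N /\ w (x, j) = Some a)].
  have QA : Q A = 0%E by exact: (ae_often q_ge0 q_sum1 Qcyl x qa).
  have mA : measurable A.
    rewrite (_ : A = ~` \bigcap_m \bigcup_(j in [set j | (m <= j)%N]) [set w : stack d | w (x, j) = Some a]).
      apply: measurableC; apply: measurable_bigcap_count => m _.
      by apply: measurable_bigcup_count => i _; exact: (dmeas_coord (x, i) [set Some a]).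
    apply/seteqP; split => w /= h; apply: contra_not h => h m.
      by have [i mi wi] := h m I; exists i.
    by move=> _; have [i [mi wi]] := h m; exists i.
  have mX := measurable_arw_explodes eta x.
  have QX : Q (~` arw_explodes eta x) = 0%E.
    by have := probability_setC Q mX; rewrite Q1 subee.
  have mD : measurable [set w : stack d | (\bigcap_j ~` outflows k x j) (eta, w)].
    by apply: measurable_sectionE; apply: bigcapT_measurable => i; exact: measurableC.
  apply/eqP; rewrite eq_le measure_ge0 andbT.
  apply: (@le_trans _ _ (Q (A `|` ~` arw_explodes eta x))).
    apply: le_measure; rewrite ?inE//; first by apply: measurableU => //; exact: measurableC.
    move=> w h; have [Aw|nA] := pselect (A w); [by left|right => ex].
    have [i hi] := outflows_unbounded k (contrapT nA) ex.
    exact: (h i I).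
  apply: (le_trans (measureU2 _ mA (measurableC mX))).
  by rewrite [X in (X + _ <= _)%E](_ : _ = 0%E)// [X in (_ + X <= _)%E](_ : _ = 0%E)// adde0.
have [U US] := parallel_support (box j) j.
pose big m := [set z : cfg d * stack d | (m < \sum_(y <- U)
  parallel (@arw_rule d) (masses (restrict (box j) z.1)) z.2 j y)%N].
have mbig m : measurable (big m).
  by apply: (dmeas_set (fun a => (m < a)%N)); apply: dmeas_sum => y; exact: dmeas_box_parallel.
have [m hm] : exists m, (joint nu Q (big m) < (e / 2)%:E)%E.
  apply: joint_decreasing => //; first by move=> m z; exact: ltnW.
  rewrite (_ : \bigcap_m big m = set0); last first.
    by apply/seteqP; split => // z h; have := h (\sum_(y <- U) parallel (@arw_rule d) (masses (restrict (box j) z.1)) z.2 j y)%N I; rewrite /big /= ltnn.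
  by apply: integral0_eq => eta _; exact: measure0.
exists j, m, (box j), U; split => //.
apply: (@le_trans _ _ (joint nu Q (~` outflows k x j `|` big m))).
  rewrite /joint le_eqVlt; apply/orP; left; apply/eqP; apply: eq_integral => eta _; congr (Q _).
  apply/seteqP; split => w; rewrite /progressed /outflows /big /=.
    move=> h; have [ok|nk] := boolP (k <= outflow w (parallel (@arw_rule d) (masses (restrict (box j) eta)) w j) x)%N.
      by right; rewrite ltnNge; apply/negP => le; apply: h.
    by left; exact/negP.
  by move=> [h [h1 _]|h [_ h2]]; [exact: h|move: h; rewrite ltnNge h2].
apply: (le_trans (@joint_U _ _ nu Q _ _ (measurableC (mO j)) (mbig m))).
by rewrite [e]splitr EFinD leeD// ltW.
Qed.

Lemma stays_active_full : nu [set eta | explosion_prob Q eta <> 1%E] = 0%E ->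
  P (@stays_active R d) = 1%E.
Proof.
move=> expl; have mS := @measurable_stays_active R d.
pose W k x (n : nat) := [set w : path_space R d | many_drops active_loses k n%:R x (state w)].
have mW k x n : measurable (W k x n) by exact: measurable_path_drops.
have mUW k x : measurable (\bigcup_n W k x n) by exact: bigcupT_measurable.
have UW0 k x : P (~` \bigcup_n W k x n) = 0%E.
  apply: ereal_le0 => // e e0; have e2 : 0 < e / 2 by rewrite divr_gt0.
  have [n0 [m [V0 [U [US h]]]]] := progress_limit k x expl e2.
  have lam1 := lam1_gt0 lam_gt0.
  (* The time beyond which [2 / n * (m / (1 + lam))] is at most [e / 2]; box and [m] are fixed
     before the time. *)
  pose c := 2 * (m%:R / (1 + lam)) / (e / 2).
  have c0 : 0 <= c by rewrite /c divr_ge0 ?(ltW e2)// mulr_ge0// divr_ge0// ltW.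
  pose n := (Num.bound c).+1; have n0' : 0 < n%:R :> R by rewrite ltr0n.
  apply: (@le_trans _ _ (P (~` W k x n))).
    apply: le_measure; rewrite ?inE; [exact: measurableC|exact: measurableC|].
    by apply: subsetC => w ww; exists n.
  apply: (le_trans (prob_few_drops hp lam_gt0 Qcyl awake Plaw k m x n0' US)).
  rewrite [e]splitr EFinD; apply: leeD => //; rewrite lee_fin.
  have cn : c <= n%:R.
    by rewrite (le_trans (ltW (archi_boundP c0)))// ler_nat.
  move: cn; rewrite /c ler_pdivrMr// => cn.
  by rewrite mulrAC ler_pdivrMr// [leRHS]mulrC.
pose Z := \bigcup_k \bigcup_x ~` \bigcup_n W k x n.
have mZ : measurable Z.
  apply: bigcupT_measurable => k; apply: measurable_bigcup_count => x _; exact: measurableC.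
have Z0 : P Z = 0%E.
  apply: measure_bigcup_null => k; first by apply: measurable_bigcup_count => x _; exact: measurableC.
  by apply: measure_bigcup_null => x; [exact: measurableC|exact: UW0].
have sub : ~` @stays_active R d `<=` Z.
  move=> w nS; apply: contrapT => nZ; apply: nS => x T.
  apply: recurrent_active => k; apply: contrapT => /forallNP no.
  by apply: nZ; exists k => //; exists x => // -[n _ Wn]; exact: (no n%:R).
have SC : P (~` @stays_active R d) = 0%E.
  by apply: (subset_measure0 _ mZ sub Z0); exact: measurableC.
have h := probability_setC P (measurableC mS); rewrite setCK in h.
by rewrite h SC sube0.
Qed.

End dichotomy.

(** * Two particles at every site, and the critical density *)

Section two_everywhere.
Context (R : realType) (d : nat).

Definition all_two : cfg d := fun=> Active 2.

Definition two_law : probability (cfg d) R := \d_all_two.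

Lemma two_law_ergodic : translation_ergodic two_law.
Proof.
split=> [x A mA|A mA _]; rewrite /two_law /= !diracE; first by congr (_%:R%:E); congr nat_of_bool; apply/idP/idP; rewrite !inE.
by case: (_ \in _); [right|left].
Qed.

Lemma density_two : density two_law = 2%:E.
Proof.
rewrite /density /two_law integral_dirac//; first by rewrite diracT mul1e.
apply/measurable_EFinP; apply: dmeas_measurable_fun.
exact: (dmeas_comp (fun a => (mass a)%:R) (dmeas_cfg 0)).
Qed.

End two_everywhere.

Theorem theorem2p13 (R : realType) (d : nat) (hd : (0 < d)%N)
    (p : Zd d -> R) (hp : jump_distribution p)
    (lam : R) (hlam : 0 < lam) :
  exists zeta_c : R,
    forall (nu : probability (cfg d) R) (P : probability (path_space R d) R),
      translation_ergodic nu ->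
      nu [set eta | forall x : Zd d, eta x <> Sleeping] = 1%E ->
      (density nu < +oo)%E ->
      ARW_law p lam nu P ->
      ((density nu < zeta_c%:E)%E -> P (@stays_active R d) = 0%E) /\
      ((zeta_c%:E < density nu)%E -> P (@stays_active R d) = 1%E).
Proof.
have [Q Qcyl] := @iid_exists R (Zd d * nat)%type _ _
  (instr_prob_ge0 hp hlam) (instr_prob_sum1 hp hlam).
pose fixates (nu : probability (cfg d) R) := nu [set eta | explosion_prob Q eta <> 0%E] = 0%E.
pose Z := [set r : R | exists nu : probability (cfg d) R,
  [/\ translation_ergodic nu, density nu = r%:E & fixates nu]].
have density_ge0 (nu : probability (cfg d) R) : (0 <= density nu)%E by exact: integral_ge0.
have two_active : ~ fixates (two_law R d).
  move=> fix2; have mN := measurable_explosion_neq Q 0%E.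
  have := two_explodes hp hlam Qcyl; apply/negP; rewrite negbK; apply/eqP.
  have E0 : explosion_prob Q (@all_two d) = 0%E.
    apply: contrapT => ne; move: fix2; rewrite /fixates /two_law /= diracE mem_set// => h.
    by have := @oner_neq0 R; rewrite (EFin_inj h : 1 = 0) eqxx.
  by rewrite /prob; have := E0; rewrite /explosion_prob /arw_explodes => ->.
(* A non-exploding law denser than [2] would, by comparison, make the constant configuration
   non-exploding. *)
have Z2 : ubound Z 2.
  move=> r [nu [nuE nur nufix]]; rewrite leNgt; apply/negP => r2; apply: two_active.
  apply: (explosion_prob_comparison hp hlam Qcyl (@two_law_ergodic R d) nuE) => //.
    by rewrite density_two nur lte_fin.
  by rewrite nur ltry.
exists (sup Z) => nu P nuE awake fin Plaw.
have nur : density nu = (fine (density nu))%:E by rewrite fineK// ge0_fin_numE.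
split=> [below|above].
  apply: (stays_active_null hp hlam Qcyl awake Plaw).
  (* The supremum of the empty set is [0] by convention, and no density lies below [0]. *)
  have Z0 : Z !=set0.
    apply: contrapT => nZ; move: below; rewrite (_ : Z = set0) ?sup0 ?ltNge ?density_ge0//.
    by apply/seteqP; split => // r Zr; apply: nZ; exists r.
  have lt : 0 < sup Z - fine (density nu) by rewrite subr_gt0 -lte_fin -nur.
  have [r [nu' [nu'E nu'r fix']]] := sup_adherent lt (conj Z0 (ex_intro _ 2 Z2)).
  rewrite opprB addrC subrK => rlt.
  apply: (explosion_prob_comparison hp hlam Qcyl nuE nu'E) fix'.
    by rewrite nu'r nur lte_fin.
  by rewrite nu'r ltry.
have [fixed|expl] := explosion01 hp hlam Qcyl nuE; last first.
  exact: (stays_active_full hp hlam Qcyl awake Plaw nuE expl).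
have : fine (density nu) <= sup Z.
  apply: ub_le_sup; first by exists 2.
  by exists nu.
by rewrite leNgt -lte_fin -nur above.
Qed.
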